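(* Let $g_t$ be the hypoelliptic Brownian motion on $\mathbb{H}$ and $\phi(t)=\sqrt{\frac{\log\log t}{t}}$. The almost surely constant value $c=\liminf_{t\to\infty}\phi(t)\max_{0\le s\le t}|g_s|$ satisfies \[ \sqrt{\lambda_1^{(2)}}\le c\le\sqrt{c\left(\lambda_1^{(1)},\lambda_1^{(2)}\right)}, \] where $c\left(\lambda_1^{(1)},\lambda_1^{(2)}\right):=\inf_{x\in(0,1)}\left(\frac{\lambda_1^{(2)}}{\sqrt{1-x}}+\frac{\lambda_1^{(1)}\sqrt{1-x}}{4x}\right)$.
   Context: The Heisenberg group $\mathbb{H}$ is $\mathbb{R}^2\times\mathbb{R}$ with multiplication $(\mathbf{v}_1,z_1)\cdot(\mathbf{v}_2,z_2)=(\mathbf{v}_1+\mathbf{v}_2,\ z_1+z_2+\tfrac12\omega(\mathbf{v}_1,\mathbf{v}_2))$, where $\omega((x_1,y_1),(x_2,y_2))=x_1y_2-x_2y_1$. The homogeneous norm on $\mathbb{H}$ is $|(\mathbf{x},z)|:=\left(\|\mathbf{x}\|_{\mathbb{R}^2}^4+z^2\right)^{1/4}$. Let $\bm{W}_t$ be a standard two-dimensional Brownian motion. The hypoelliptic Brownian motion is $g_t:=(\bm{W}_t,A_t)$ with $A_t:=\frac12\int_0^t (W_1(s)\,dW_2(s)-W_2(s)\,dW_1(s))$. For $n\ge1$, $\lambda_1^{(n)}$ denotes the lowest Dirichlet eigenvalue of $-\frac12\Delta_{\mathbb{R}^n}$ on the unit ball $\{x\in\mathbb{R}^n:|x|<1\}$.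 *)

(* Defs.v *)
From HB Require Import structures.
From mathcomp Require Import all_boot all_order all_algebra.
From mathcomp Require Import all_classical all_reals all_analysis.
Set Implicit Arguments. Unset Strict Implicit. Unset Printing Implicit Defensive.
Import Order.TTheory GRing.Theory Num.Theory.
Import numFieldNormedType.Exports.
Local Open Scope classical_set_scope.
Local Open Scope ring_scope.

Definition enorm {R : realType} {n : nat} (x : 'rV[R]_n) : R :=
  Num.sqrt (\sum_(i < n) x ord0 i ^+ 2).

Definition evec {R : realType} {n : nat} (i : 'I_n) : 'rV[R]_n :=
  \row_(j < n) (i == j)%:R.

Definition laplacian {R : realType} {n : nat} (f : 'rV[R]_n -> R) (x : 'rV[R]_n) : R :=
  \sum_(i < n) 'D_(evec i) ('D_(evec i) f) x.

(* lam is a Dirichlet eigenvalue of -(1/2) Laplacian on the open unit ball B: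
   there is a nonzero classical eigenfunction f in C^2(B) /\ C(closure B)
   vanishing on the boundary sphere with -(1/2) Laplacian f = lam f in B. *)
Definition dirichlet_eigenvalue {R : realType} (n : nat) (lam : R) : Prop :=
  exists f : 'rV[R]_n -> R,
    [/\ exists x, enorm x < 1 /\ f x != 0,
        {within [set x | enorm x <= 1], continuous f},
        (forall x, enorm x = 1 -> f x = 0),
        (forall x, enorm x < 1 ->
           [/\ differentiable f x,
               (forall i, differentiable ('D_(evec i) f) x) &
               (forall i j, {for x, continuous ('D_(evec j) ('D_(evec i) f))}) ]) &
        (forall x, enorm x < 1 -> - (2^-1 * laplacian f x) = lam * f x) ].

Definition lambda1 {R : realType} (n : nat) : R :=
  inf [set lam : R | dirichlet_eigenvalue n lam].

(* (W1, W2) is a standard two-dimensional Brownian motion on the probability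
   space (T, P): measurable coordinates, started at 0, continuous paths on
   [0, oo), and for all times 0 <= t_0 < t_1 < ... < t_n the 2n increments
   W1(t_{k+1}) - W1(t_k), W2(t_{k+1}) - W2(t_k) are independent N(0, t_{k+1}-t_k)
   (stated as the product rule for their joint law on measurable rectangles). *)
Definition is_BM2 {d : measure_display} {T : measurableType d} {R : realType}
    (P : probability T R) (W1 W2 : R -> T -> R) : Prop :=
  [/\ (forall t, measurable_fun setT (W1 t) /\ measurable_fun setT (W2 t)),
      (forall w, W1 0 w = 0 /\ W2 0 w = 0),
      (forall w, {within `[0, +oo[, continuous (fun t => W1 t w)} /\
                 {within `[0, +oo[, continuous (fun t => W2 t w)}) &
      (forall (n : nat) (t : nat -> R), 0 <= t 0%N ->
         (forall k, (k < n)%N -> t k < t k.+1) ->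
         forall A B : nat -> set R, (forall k, measurable (A k) /\ measurable (B k)) ->
         P (\bigcap_(k in [set k | (k < n)%N])
              ([set w | A k (W1 (t k.+1) w - W1 (t k) w)] `&`
               [set w | B k (W2 (t k.+1) w - W2 (t k) w)])) =
         (\prod_(k < n) (normal_prob 0 (Num.sqrt (t k.+1 - t k)) (A k) *
                         normal_prob 0 (Num.sqrt (t k.+1 - t k)) (B k)))%E) ].

(* Dyadic Riemann (Ito) sum approximating
   A_t = 1/2 int_0^t (W1 dW2 - W2 dW1), with 2^m subintervals. *)
Definition levy_sum {T : Type} {R : realType} (W1 W2 : R -> T -> R)
    (m : nat) (t : R) (w : T) : R :=
  let s := fun k : nat => t * k%:R / (2 ^+ m) in
  2^-1 * \sum_(k < 2 ^ m)
    (W1 (s k) w * (W2 (s k.+1) w - W2 (s k) w)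
     - W2 (s k) w * (W1 (s k.+1) w - W1 (s k) w)).

(* A is (a continuous version of) the Levy area process of (W1, W2): measurable,
   continuous paths on [0, oo), and for each t >= 0, A_t is the limit in
   probability of the Ito Riemann sums, i.e. the Ito integral
   A_t = 1/2 int_0^t (W1 dW2 - W2 dW1). *)
Definition is_levy_area {d : measure_display} {T : measurableType d} {R : realType}
    (P : probability T R) (W1 W2 A : R -> T -> R) : Prop :=
  [/\ (forall t, measurable_fun setT (A t)),
      (forall w, {within `[0, +oo[, continuous (fun t => A t w)}) &
      (forall t, 0 <= t -> forall eps : R, 0 < eps ->
         (fun m : nat => P [set w | eps < `|levy_sum W1 W2 m t w - A t w|])
           @ \oo --> 0%E) ].

Definition hnorm {T : Type} {R : realType} (W1 W2 A : R -> T -> R) (s : R) (w : T) : R :=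
  (((W1 s w ^+ 2 + W2 s w ^+ 2) ^+ 2 + A s w ^+ 2) `^ (4^-1)).

Definition running_max {T : Type} {R : realType} (W1 W2 A : R -> T -> R) (t : R) (w : T) : R :=
  sup [set hnorm W1 W2 A s w | s in `[0, t]].

Definition phi {R : realType} (t : R) : R := Num.sqrt (ln (ln t) / t).

Definition chung_liminf {T : Type} {R : realType} (W1 W2 A : R -> T -> R) (w : T) : \bar R :=
  limf_einf (fun t : R => (phi t * running_max W1 W2 A t w)%:E) (+oo : set_system R).

Definition c_const {R : realType} (l1 l2 : R) : R :=
  inf [set l2 / Num.sqrt (1 - x) + l1 * Num.sqrt (1 - x) / (4 * x) | x in `]0, 1[].

(* Main.v *)
Require Import Defs.
From HB Require Import structures.
From mathcomp Require Import all_boot all_order all_algebra.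
From mathcomp Require Import all_classical all_reals all_analysis.
From mathcomp Require Import measurable_realfun ring lra.
Set Implicit Arguments. Unset Strict Implicit. Unset Printing Implicit Defensive.
Import Order.TTheory GRing.Theory Num.Theory.
Import numFieldNormedType.Exports.
Local Open Scope classical_set_scope.
Local Open Scope ring_scope.

(* No stochastic calculus is needed: everything is read off the dyadic Euler chain
   (V, B) -> (V + Z, B + omega(V, Z) / 2) with Gaussian steps Z, whose area converges almost
   surely, at all dyadic times, to the given Levy area.  Let J be the function with
   J(|v|^2) = J_0(|v|) and z0 its first zero, so that lambda1 2 = z0 / 2 and
   lambda1 1 = pi^2 / 8 (eigenfunctions J(z0 |v|^2) and cos(pi v / 2), maximum principle).
   Up to errors that vanish with the mesh, J(z0 |v|^2 / al^2) cos(pi z / (2 be)) is a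
   subsolution for the chain killed outside the cylinder {|v| < al, |z| < be}, with rate
   z0 / (2 al^2) + pi^2 al^2 / (32 be^2); this bounds from below the probability of staying
   there.  With be^2 = y r^2, al^4 = (1 - y) r^2 the cylinder lies in the homogeneous ball of
   radius sqrt r and the rate is 1 / r times the function minimised in c_const.  In the same
   way J bounds from above the probability that W stays in a disk.  Borel-Cantelli along a
   geometric sequence then gives the lower bound on the liminf; the upper bound follows from
   the second Borel-Cantelli lemma on the independent blocks between the times (k!)^3,
   translated back to the origin by the quasi-triangle inequality.  The events
   {liminf <= a} are almost surely tail events, so the liminf is constant by the
   zero-one law. *)

(** * Independence of generated sigma-algebras *)

(** Both bounds lose something definite. The lower one forgets the area: a path in the homogeneous
    ball projects into a disk. The upper one replaces the ball by inscribed cylinders and, on a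
    cylinder, the variable rate [kap / 2 + l^2 |v|^2 / 8] by its largest value; the infimum in
    [c_const] picks the best cylinder. The obstacle is that Gaussian steps are unbounded, while a
    ground state cut off at the boundary has no uniform Taylor expansion across it. Hence the lower
    bound uses [(f - eps)^+], supported away from the boundary, and the upper bound the ground state
    of a slightly larger disk; steps that are not small are charged to the fourth moment. A cubic
    remainder is traded for [eta |Z|^2 + C |Z|^4], so a step of variance h costs [(2 eta + C' h) h]:
    over a horizon t this sums to [2 eta t] plus a term vanishing with the mesh, and eta is free.
    The times [(k!)^3] are so sparse that the path before a block is negligible on the scale of the
    block, with summable failures; yet their iterated logarithm is only [ln k] to first order, so
    survival in a block keeps probability at least a constant over k. *)

Section independence.
Context {d : measure_display} {T : measurableType d} {R : realType}.
Variable P : probability T R.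

Definition indep_sys (C D : set (set T)) :=
  forall A B, C A -> D B -> P (A `&` B) = (P A * P B)%E.

Lemma indep_sysC C D : indep_sys C D -> indep_sys D C.
Proof. by move=> h A B DA CB; rewrite setIC muleC; exact: h. Qed.

Lemma sub_sigma_measurable (C : set (set T)) :
  C `<=` measurable -> <<s C >> `<=` measurable.
Proof. by move=> Cm; apply: smallest_sub => //; exact: sigma_algebra_measurable. Qed.

(** For fixed B in D the measures [A |-> P (A & B)] and [P B * P A] agree on a pi-system, hence on
    the sigma-algebra it generates. The statement is one-sided because the zero-one law applies it
    with D reduced to a single event. *)
Lemma indep_sigmal C D : C `<=` measurable -> D `<=` measurable ->
  setI_closed C -> C setT -> indep_sys C D -> indep_sys <<s C >> D.
Proof.
move=> Cm Dm CI CT CD A B sA DB.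
have mB := Dm _ DB.
have Bfin : P B \is a fin_num by exact: fin_num_measure.
have r0 : 0 <= fine (P B) by exact: fine_ge0.
have := @g_sigma_algebra_measure_unique d R T C Cm (fun _ => setT) (fun _ => CT)
  _ (mrestr P mB) (mscale (NngNum r0) P) CI _ _ A sA.
move=> h; transitivity (mrestr P mB A) => //; rewrite h.
- transitivity ((fine (P B))%:E * P A)%E; first by [].
  by rewrite fineK// muleC.
- by rewrite bigcup_const.
- move=> E CE; transitivity (P E * P B)%E; first exact: CD.
  transitivity ((fine (P B))%:E * P E)%E; last by [].
  by rewrite fineK// muleC.
- move=> _; apply: (@le_lt_trans _ _ (P (setT `&` B))) => //.
  by rewrite setTI ltey_eq Bfin.
Qed.

Lemma indep_sigma C D : C `<=` measurable -> D `<=` measurable ->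
  setI_closed C -> C setT -> setI_closed D -> D setT ->
  indep_sys C D -> indep_sys <<s C >> <<s D >>.
Proof.
move=> Cm Dm CI CT DI DT CD.
have mC := sub_sigma_measurable Cm.
by apply/indep_sigmal => //; [exact: sub_sigma_measurable|
  apply/indep_sysC/indep_sigmal => //; exact: indep_sysC].
Qed.

(** Phrased on [g_sigma_algebraType] so that the closure lemmas for [measurable_fun] apply directly
    to adapted variables. *)
Definition adapted (C : set (set T)) (U : T -> R) :=
  @measurable_fun _ _ (g_sigma_algebraType C) R setT U.

Lemma adapted_preimage C U (B : set R) : adapted C U -> measurable B ->
  <<s C >> (U @^-1` B).
Proof. by move=> aU mB; have := aU measurableT B mB; rewrite setTI. Qed.

Lemma adapted_measurable C U : C `<=` measurable -> adapted C U ->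
  measurable_fun setT U.
Proof.
move=> Cm aU _ B mB; rewrite setTI.
exact: (sub_sigma_measurable Cm (adapted_preimage aU mB)).
Qed.

Lemma sub_adapted C C' U : C `<=` <<s C' >> -> adapted C U -> adapted C' U.
Proof.
move=> CC' aU _ B mB; rewrite setTI.
have : <<s C >> `<=` <<s C' >>.
  by apply: smallest_sub => //; exact: smallest_sigma_algebra.
by apply; exact: adapted_preimage.
Qed.

Local Notation Mean U := (Rintegral P setT U).

(** By uniqueness of product measures the law of the pair (U, V) is the product of the two laws;
    Tonelli then gives integrability of the product and Fubini its value. *)
Lemma indep_mfun_integral (U V : {mfun T >-> R}) :
  (forall A B : set R, measurable A -> measurable B ->
    P (U @^-1` A `&` V @^-1` B) = (P (U @^-1` A) * P (V @^-1` B))%E) ->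
  P.-integrable setT (EFin \o U) -> P.-integrable setT (EFin \o V) ->
  P.-integrable setT (EFin \o (fun w => U w * V w)) /\
  Mean (fun w => U w * V w) = Mean U * Mean V.
Proof.
move=> iUV iU iV.
have mUV : measurable_fun setT (fun w => (U w, V w)) by exact/measurable_fun_pairP.
pose UV : {mfun T >-> (R * R)%type} := mfun_Sub (mem_set mUV).
pose dU := distribution P U; pose dV := distribution P V.
pose dUV := distribution P UV.
have dE X : measurable X -> (dU \x dV)%E X = dUV X.
  by apply: product_measure_unique => A B mA mB; rewrite /dUV /distribution /= /pushforward/= -iUV.
pose f (z : R * R) := (z.1 * z.2)%:E.
have mf : measurable_fun [set: (R * R)%type] f.
  by apply/measurable_EFinP/measurable_funM; [exact: measurable_fst|exact: measurable_snd].
have mid : measurable_fun [set: R] (EFin : R -> \bar R) by exact/measurable_EFinP.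
have Fin (X : {mfun T >-> R}) : P.-integrable setT (EFin \o X) ->
    (distribution P X).-integrable setT EFin.
  by move=> iX; apply: integrable_pushforward.
have intE (X : {mfun T >-> R}) : P.-integrable setT (EFin \o X) ->
    (\int[distribution P X]_x x%:E)%E = (Mean X)%:E.
  move=> iX; rewrite integral_distribution//= /Rintegral fineK//.
  exact: integrable_fin_num.
have if12 : (dU \x dV)%E.-integrable setT f.
  apply/integrable12ltyP => //.
  have absV : (\int[dV]_y `|y%:E| < +oo)%E by have /integrableP[] := Fin _ iV.
  have absU : (\int[dU]_y `|y%:E| < +oo)%E by have /integrableP[] := Fin _ iU.
  rewrite (_ : (\int[_]_x _)%E = (\int[dU]_x (`|x%:E| * \int[dV]_y `|y%:E|))%E).
    rewrite ge0_integralZr//; last 2 first.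
    - exact: measurableT_comp.
    - exact: integral_ge0.
    by rewrite lte_mul_pinfty// ?integral_ge0// ge0_fin_numE// integral_ge0.
  apply: eq_integral => x _; rewrite -ge0_integralZl//; last exact: measurableT_comp.
  by apply: eq_integral => y _; rewrite /f /= normrM EFinM.
have ifUV : dUV.-integrable setT f.
  move: if12 => /integrableP[_ h]; apply/integrableP; split => //.
  by rewrite (eq_measure_integral (dU \x dV)%E)//; move=> A mA _; exact/esym/dE.
have iUVP : P.-integrable setT (EFin \o (fun w => U w * V w)).
  move: ifUV => /integrableP[_ h]; apply/integrableP; split.
    by apply/measurable_EFinP/measurable_funM.
  rewrite ge0_integral_distribution// in h; first exact: measurableT_comp.
split => //; apply: EFin_inj.
rewrite EFinM -!intE// /Rintegral fineK; last exact: integrable_fin_num.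
rewrite (_ : (\int[P]_x _)%E = (\int[dUV]_z f z)%E); last by rewrite integral_distribution.
rewrite (eq_measure_integral (dU \x dV)%E); last by move=> A mA _; exact/esym/dE.
rewrite -integral12_prod_meas1//= /fubini_F /f /=.
under eq_integral do (under eq_integral do rewrite EFinM; rewrite integralZl//; [|exact: Fin]).
rewrite (intE V)//.
by rewrite integralZr//; exact: Fin.
Qed.

Lemma indep_integral (C D : set (set T)) (U V : T -> R) :
  C `<=` measurable -> D `<=` measurable -> indep_sys <<s C >> <<s D >> ->
  adapted C U -> adapted D V ->
  P.-integrable setT (EFin \o U) -> P.-integrable setT (EFin \o V) ->
  P.-integrable setT (EFin \o (fun w => U w * V w)) /\
  Mean (fun w => U w * V w) = Mean U * Mean V.
Proof.
move=> Cm Dm CD aU aV iU iV.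
have mU := adapted_measurable Cm aU.
have mV := adapted_measurable Dm aV.
pose U' : {mfun T >-> R} := mfun_Sub (mem_set mU).
pose V' : {mfun T >-> R} := mfun_Sub (mem_set mV).
apply: (@indep_mfun_integral U' V') => // A B mA mB.
by apply: CD; exact: adapted_preimage.
Qed.
End independence.

(** * Gaussian moments *)

Section density.
Context {d : measure_display} {T : measurableType d} {R : realType}.
Variables mu nu : {measure set T -> \bar R}.
Import HBNNSimple.

(** The hypothesis is the claim for indicators; simple functions follow by linearity and f by
    monotone convergence. It serves to turn integrals against [normal_prob] into Lebesgue integrals
    against the density. *)
Lemma ge0_integral_density (g0 : T -> R) : (forall x, 0 <= g0 x) ->
  measurable_fun setT g0 ->
  (forall A, measurable A -> nu A = \int[mu]_(x in A) (g0 x)%:E)%E ->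
  forall f : T -> \bar R, (forall x, 0 <= f x)%E -> measurable_fun setT f ->
  (\int[nu]_x f x = \int[mu]_x (f x * (g0 x)%:E))%E.
Proof.
move=> g00 mg0 nuE f f0 mf; set g := fun x => (g0 x)%:E.
have gpos x : (0 <= g x)%E by rewrite lee_fin.
have mg : measurable_fun setT g by apply/measurable_EFinP.
have mE := @measurableT _ T.
pose h := nnsfun_approx mE mf.
have -> : (\int[nu]_x f x = limn (fun n => \int[nu]_x (EFin \o h n) x))%E.
  have fE x : f x = limn (fun n => (EFin \o h n) x).
    by apply/esym/cvg_lim => //; exact: cvg_nnsfun_approx.
  under eq_integral do rewrite fE.
  apply: monotone_convergence => //.
  - by move=> n; exact/measurable_EFinP.
  - by move=> n x Ex //=; rewrite lee_fin.
  - by move=> x Ex a b ab; rewrite lee_fin; exact/lefP/nd_nnsfun_approx.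
have -> : (\int[mu]_x (f x * g x) = limn (fun n => \int[mu]_x ((EFin \o h n) x * g x)))%E.
  have fg x : (f x * g x = limn (fun n => (EFin \o h n) x * g x))%E.
    by apply/esym/cvg_lim => //; apply: cvgeZr => //; exact: cvg_nnsfun_approx.
  under eq_integral do rewrite fg.
  apply: monotone_convergence => [//| | |].
  - by move=> n; apply/emeasurable_funM => //; exact/measurable_EFinP.
  - by move=> n x Ex /=; rewrite mule_ge0 ?lee_fin.
  - by move=> x Ex a b ab/=; rewrite lee_wpmul2r ?lee_fin//; exact/lefP/nd_nnsfun_approx.
apply: congr_lim; apply/funext => n.
transitivity (\int[nu]_x (\sum_(y \in range (h n)) (y * \1_(h n @^-1` [set y]) x)%:E))%E.
  by apply: eq_integral => t tE; rewrite /= fimfunE -fsumEFin.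
have indich k r : measurable_fun [set: T] (fun x => (r * \1_(h k @^-1` [set r]) x)%:E).
  by apply: (measurable_comp measurableT) => //; exact: measurable_funM.
rewrite ge0_integral_fsum//; last by move=> k y Ey; exact: nnfun_muleindic_ge0.
transitivity (\int[mu]_x (\sum_(y \in range (h n))
    (y * \1_(h n @^-1` [set y]) x)%:E * g x))%E; last first.
  under [RHS]eq_integral => x xE.
    rewrite /= (fimfunE (h n) x) -fsumEFin// ge0_mule_fsuml; last first.
      by move=> y; exact: nnfun_muleindic_ge0.
    over.
  by [].
rewrite ge0_integral_fsum//; last 2 first.
  - by move=> y; apply: emeasurable_funM.
  - by move=> k y Ey; rewrite mule_ge0// ?nnfun_muleindic_ge0.
apply: eq_fsbigr => r rhn.
under [LHS]eq_integral do rewrite EFinM.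
rewrite integralZl_indic_nnsfun => //.
under [RHS]eq_integral do rewrite EFinM -muleA.
rewrite ge0_integralZl//.
- under [X in _ = (_ * X)%E]eq_integral do rewrite muleC.
  rewrite [in RHS](eq_integral (g \_ (h n @^-1` [set r]))); last first.
    by move=> x xE; rewrite epatch_indic.
  by rewrite -integral_mkcond/= integral_indic// setIT nuE//; exact: measurable_sfunP.
- by apply: emeasurable_funM => //; exact/measurable_EFinP.
- by move=> t Et; rewrite mule_ge0 ?lee_fin.
- by move: rhn; rewrite inE => -[t _ <-]; rewrite lee_fin.
Qed.

End density.

Section gaussian_moments.
Context {R : realType}.
Local Notation mu := (@lebesgue_measure R).

Lemma integral_normal_prob (m s : R) (f : R -> \bar R) :
  (forall x, 0 <= f x)%E -> measurable_fun setT f ->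
  (\int[normal_prob m s]_x f x = \int[mu]_x (f x * (normal_pdf m s x)%:E))%E.
Proof.
move=> f0 mf; apply: ge0_integral_density => //.
- by move=> x; exact: normal_pdf_ge0.
- exact: measurable_normal_pdf.
Qed.

(* Completing the square: exponential tilting turns the centred Gaussian into a shifted one. *)
Lemma normal_mgf (s a : R) : 0 < s ->
  (\int[normal_prob 0 s]_x (expR (a * x))%:E = (expR (a ^+ 2 * s ^+ 2 / 2))%:E)%E.
Proof.
move=> s0; rewrite integral_normal_prob//; last first.
  by apply/measurable_EFinP/measurableT_comp => //; exact: measurable_funM.
have sn : s != 0 by rewrite gt_eqF.
transitivity (\int[mu]_x ((expR (a ^+ 2 * s ^+ 2 / 2))%:E * (normal_pdf (a * s ^+ 2) s x)%:E))%E; last first.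
  rewrite ge0_integralZl//=.
  - by rewrite integral_normal_pdf mule1.
  - by apply/measurable_EFinP; exact: measurable_normal_pdf.
  - by move=> x _; rewrite lee_fin normal_pdf_ge0.
suff E (x : R) : expR (a * x) * normal_pdf 0 s x =
    expR (a ^+ 2 * s ^+ 2 / 2) * normal_pdf (a * s ^+ 2) s x.
  by apply: eq_integral => /= x _; rewrite -!EFinM E.
rewrite /normal_pdf (negbTE sn) /normal_fun mulrCA [RHS]mulrCA; congr (_ * _).
rewrite -!expRD; congr expR.
by field; rewrite sn.
Qed.

(* Tilting by [expR (a x^2)] rescales the variance. *)
Lemma normal_sqr_mgf (s a : R) : 0 < s -> 2 * a * s ^+ 2 < 1 ->
  (\int[normal_prob 0 s]_x (expR (a * x ^+ 2))%:E =
   (Num.sqrt (1 - 2 * a * s ^+ 2))^-1%:E)%E.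
Proof.
move=> s0 a1; rewrite integral_normal_prob//; last first.
  apply/measurable_EFinP/measurableT_comp => //.
  by apply: measurable_funM => //; exact: measurable_funX.
set q := 1 - 2 * a * s ^+ 2.
have q0 : 0 < q by rewrite subr_gt0.
pose r := Num.sqrt q; have r0 : 0 < r by rewrite sqrtr_gt0.
have r2 : r ^+ 2 = q by rewrite sqr_sqrtr// ltW.
have sn : s != 0 by rewrite gt_eqF.
have rn : r != 0 by rewrite gt_eqF.
transitivity (\int[mu]_x ((r^-1)%:E * (normal_pdf 0 (s / r) x)%:E))%E; last first.
  rewrite ge0_integralZl//=.
  - by rewrite integral_normal_pdf mule1.
  - by apply/measurable_EFinP; exact: measurable_normal_pdf.
  - by move=> x _; rewrite lee_fin normal_pdf_ge0.
  - by rewrite lee_fin invr_ge0 ltW.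
suff E (x : R) : expR (a * x ^+ 2) * normal_pdf 0 s x = r^-1 * normal_pdf 0 (s / r) x.
  by apply: eq_integral => /= x _; rewrite -!EFinM E.
have srn : s / r != 0 by rewrite mulf_neq0// invr_eq0.
rewrite /normal_pdf (negbTE sn) (negbTE srn) /normal_fun mulrCA [RHS]mulrA; congr (_ * _).
  rewrite /normal_peak -invfM; congr (_^-1).
  have {1}-> : r = Num.sqrt (r ^+ 2) by rewrite sqrtr_sqr gtr0_norm.
  rewrite -sqrtrM ?sqr_ge0//.
  by congr Num.sqrt; field; rewrite rn.
rewrite -!expRD; congr expR.
have -> : a = (1 - r ^+ 2) / (2 * s ^+ 2) by rewrite r2 /q; field; rewrite sn.
by field; rewrite sn rn.
Qed.

Lemma exprn_le_expR (p : nat) (x : R) : 0 <= x -> x ^+ p <= p%:R ^+ p * expR x.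
Proof.
case: p => [|p] x0; first by rewrite !expr0 mul1r -[leLHS]expR0 ler_expR.
have p0 : 0 < p.+1%:R :> R by rewrite ltr0n.
have -> : expR x = expR (x / p.+1%:R) ^+ p.+1.
  by rewrite -expRM_natl; congr expR; field; rewrite gt_eqF.
have h : x <= p.+1%:R * expR (x / p.+1%:R).
  rewrite -ler_pdivrMl// mulrC.
  by apply: le_trans (expR_ge1Dx _); rewrite lerDr.
rewrite -exprMn; apply: lerXn2r => //; by rewrite nnegrE// mulr_ge0// expR_ge0.
Qed.

Lemma integrable_normal_expR (s a : R) : 0 < s ->
  (normal_prob 0 s).-integrable setT (EFin \o (fun x => expR (a * x))).
Proof.
move=> s0; apply/integrableP; split.
  by apply/measurable_EFinP/measurableT_comp => //; exact: measurable_funM.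
under eq_integral do rewrite /= ger0_norm ?expR_ge0//.
by rewrite normal_mgf// ltry.
Qed.

(** [|x / s|^p] is at most [p^p] times [expR (x / s) + expR (- x / s)], and each exponential has
    mean [expR (1 / 2)]. The constant is far from sharp; only the scaling in s matters. *)
Lemma normal_abs_moment_ub (s : R) (p : nat) : 0 < s ->
  (\int[normal_prob 0 s]_x (`|x| ^+ p)%:E <=
    (2 * expR (1 / 2) * p%:R ^+ p * s ^+ p)%:E)%E.
Proof.
move=> s0.
pose g (x : R) := p%:R ^+ p * s ^+ p * (expR (s^-1 * x) + expR (- s^-1 * x)).
have sn : s != 0 by rewrite gt_eqF.
have mg (b : R) : measurable_fun setT (fun x : R => expR (b * x)).
  by apply/measurableT_comp => //; exact: measurable_funM.
have mgE (b : R) : measurable_fun setT (fun x : R => (expR (b * x))%:E).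
  exact/measurable_EFinP.
have mgg : measurable_fun setT g.
  by apply: measurable_funM => //; apply: measurable_funD; exact: mg.
have c0 : 0 <= p%:R ^+ p * s ^+ p :> R by rewrite mulr_ge0// exprn_ge0// ltW.
apply: (@le_trans _ _ (\int[normal_prob 0 s]_x (g x)%:E)%E).
  apply: ge0_le_integral => //.
  - by apply/measurable_EFinP; apply: measurable_funX; exact: normr_measurable.
  - exact/measurable_EFinP.
  - move=> x _; rewrite lee_fin /g.
    have -> : `|x| ^+ p = s ^+ p * (`|x| / s) ^+ p.
      by rewrite -exprMn mulrCA divff// mulr1.
    rewrite [p%:R ^+ p * _]mulrC -mulrA ler_pM2l ?exprn_gt0//.
    apply: (le_trans (exprn_le_expR p _)); first by rewrite divr_ge0// ltW.
    rewrite ler_wpM2l ?exprn_ge0//.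
    have [x0|x0] := leP 0 x.
      by rewrite ger0_norm// mulrC lerDl expR_ge0.
    by rewrite ltr0_norm// mulNr mulrC mulNr lerDr expR_ge0.
rewrite /g; under eq_integral do rewrite EFinM EFinD.
rewrite ge0_integralZl//; last 2 first.
- by apply: emeasurable_funD; exact: mgE.
- by move=> x _; rewrite adde_ge0// lee_fin expR_ge0.
rewrite ge0_integralD//; [|exact: mgE|exact: mgE].
rewrite !normal_mgf// -EFinD -EFinM lee_fin sqrrN exprVn mulVf ?expf_neq0//.
by rewrite le_eqVlt; apply/orP; left; apply/eqP; ring.
Qed.

Lemma integrable_normal_moment (s : R) (p : nat) : 0 < s ->
  (normal_prob 0 s).-integrable setT (EFin \o (fun x => x ^+ p)).
Proof.
move=> s0; apply/integrableP; split.
  by apply/measurable_EFinP; exact: measurable_funX.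
under eq_integral do rewrite /= normrX.
by apply: le_lt_trans (normal_abs_moment_ub p s0) _; rewrite ltry.
Qed.

(** Dividing by small x of either sign compares the slopes in both directions. Mean and variance of
    the Gaussian are read off their exponential transforms in this way, from one-sided bounds
    alone. *)
Lemma tangent_eq (a b C r : R) : 0 < r ->
  (forall x, `|x| <= r -> a * x <= b * x + C * x ^+ 2) -> a = b.
Proof.
move=> r0 h; apply/eqP; rewrite eq_le; apply/andP.
have key (x : R) : 0 < x -> x <= r -> `|a - b| <= C * x.
  move=> x0 xr; have := h x; have := h (- x).
  rewrite normrN gtr0_norm// => /(_ xr) h1 /(_ xr) h2.
  rewrite ler_norml; apply/andP; split; rewrite -(ler_pM2r x0); nra.
suff : `|a - b| <= 0 by rewrite normr_le0 subr_eq0 => /eqP ->.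
apply/ler_addgt0Pr => e e0; rewrite add0r.
have [C0|C0] := leP C 0.
  by apply: (le_trans (key r r0 _)) => //; nra.
pose x := Num.min r (e / C).
have x0 : 0 < x by rewrite lt_min r0 divr_gt0.
apply: (le_trans (key x x0 _)); first by rewrite ge_min lexx.
by rewrite mulrC -ler_pdivlMr// ge_min lexx orbT.
Qed.

(** Integrates [1 + y <= expR y]: this is the half of a first order expansion of the transform that
    [tangent_eq] consumes. *)
Lemma mean_expR_ub d (T : measurableType d) (nu : probability T R) (f : T -> R) (a K : R) :
  nu.-integrable setT (EFin \o f) ->
  nu.-integrable setT (EFin \o (fun x => expR (a * f x))) ->
  (\int[nu]_x (expR (a * f x))%:E = K%:E)%E ->
  1 + (\int[nu]_x f x) * a <= K.
Proof.
move=> if_ ie eK.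
have -> : K = \int[nu]_x expR (a * f x) by rewrite /Rintegral eK.
have i1 : nu.-integrable setT (EFin \o cst (1 : R)) by exact: finite_measure_integrable_cst.
have iaf : nu.-integrable setT (EFin \o (fun x => a * f x)).
  by apply: eq_integrable (integrableZl measurableT a if_) => // x _; rewrite EFinM.
have <- : \int[nu]_x (1 + a * f x) = 1 + (\int[nu]_x f x) * a.
  rewrite RintegralD// RintegralZl// Rintegral_cst// mul1r [a * _]mulrC.
  by congr (_ + _); exact: (congr1 fine (probability_setT nu)).
apply: le_Rintegral => //.
  by apply: eq_integrable (integrableD measurableT i1 iaf) => // x _; rewrite EFinD.
by move=> x _; exact: expR_ge1Dx.
Qed.

Lemma normal_mean (s : R) : 0 < s -> \int[normal_prob 0 s]_x x = 0.
Proof.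
move=> s0; set m := Rintegral _ _ _.
have im := integrable_normal_moment 1 s0.
apply: (@tangent_eq m 0 (s ^+ 2) s^-1); first by rewrite invr_gt0.
move=> x xs; rewrite mul0r add0r.
have s2 : 0 < s ^+ 2 by rewrite exprn_gt0.
have x1 : x ^+ 2 * s ^+ 2 <= 1.
  rewrite -exprMn -real_normK ?num_real// normrM (gtr0_norm s0).
  have x1 : `|x| * s <= 1 by rewrite -ler_pdivlMr// mul1r.
  by rewrite exprn_ile1// mulr_ge0// ltW.
have : 1 + m * x <= expR (x ^+ 2 * s ^+ 2 / 2).
  apply: (@mean_expR_ub _ _ (normal_prob 0 s) id) => //.
  - exact: integrable_normal_expR.
  - exact: normal_mgf.
move=> h; have : expR (x ^+ 2 * s ^+ 2 / 2) <= 1 + x ^+ 2 * s ^+ 2.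
  set y := x ^+ 2 * s ^+ 2 in x1 *.
  have y0 : 0 <= y by rewrite mulr_ge0 ?sqr_ge0.
  have := expR_ge1Dx (- (y / 2)); rewrite expRN => h2.
  have e0 := expR_gt0 (y / 2).
  rewrite -(ler_pV2 _ _) ?inE ?unitfE ?gt_eqF//=; [|lra|lra].
  apply: le_trans h2.
  rewrite -[leLHS]mul1r ler_pdivrMr; [nra|lra].
by move: h; nra.
Qed.

(** With [y = 2 a s^2] the transform of the square is [(1 - y)^(-1/2)], which is at most
    [1 + y / 2 + 2 y^2] for [|y| <= 1 / 2]. The constant [8 s^4] and the radius [1 / (4 s^2)] given
    to [tangent_eq] are this bound in terms of a. *)
Lemma normal_variance (s : R) : 0 < s -> \int[normal_prob 0 s]_x (x ^+ 2) = s ^+ 2.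
Proof.
move=> s0; set m := Rintegral _ _ _.
have im := integrable_normal_moment 2 s0.
have s2 : 0 < s ^+ 2 by rewrite exprn_gt0.
apply: (@tangent_eq m (s ^+ 2) (8 * s ^+ 4) (4 * s ^+ 2)^-1).
  by rewrite invr_gt0 mulr_gt0.
move=> a ha.
have ha' : - (1 / 4) <= a * s ^+ 2 <= 1 / 4.
  rewrite -ler_norml normrM (gtr0_norm s2) -ler_pdivlMr//.
  by apply: (le_trans ha); rewrite invfM mul1r.
set y := 2 * a * s ^+ 2.
have y1 : - (1 / 2) <= y <= 1 / 2 by rewrite /y; lra.
have q0 : 0 < 1 - y by lra.
have y1' : y < 1 by lra.
have : 1 + m * a <= (Num.sqrt (1 - y))^-1.
  apply: (@mean_expR_ub _ _ (normal_prob 0 s) (fun x => x ^+ 2)) => //; last exact: normal_sqr_mgf.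
  apply/integrableP; split.
    apply/measurable_EFinP/measurableT_comp => //.
    by apply: measurable_funM => //; exact: measurable_funX.
  under eq_integral do rewrite /= ger0_norm ?expR_ge0//.
  by rewrite normal_sqr_mgf// ltry.
move=> h; have : (Num.sqrt (1 - y))^-1 <= 1 + y / 2 + 2 * y ^+ 2.
  have t0 : 0 < 1 + y / 2 + 2 * y ^+ 2 by nra.
  have r0 : 0 < Num.sqrt (1 - y) by rewrite sqrtr_gt0.
  rewrite -[leLHS]mul1r ler_pdivrMr// -(@ler_pXn2r _ 2)//; last 2 first.
  - by rewrite nnegrE.
  - by rewrite nnegrE; apply/ltW/mulr_gt0.
  rewrite expr1n exprMn sqr_sqrtr; last exact: ltW.
  rewrite -subr_ge0.
  have -> : (1 + y / 2 + 2 * y ^+ 2) ^+ 2 * (1 - y) - 1 =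
    y ^+ 2 * (13 / 4 - 9 / 4 * y + 2 * y ^+ 2 - 4 * y ^+ 3) by field.
  by rewrite mulr_ge0 ?sqr_ge0//; nra.
by move: h; rewrite /y; nra.
Qed.
End gaussian_moments.

(** * Expectations of variables with moments of all orders *)

Section moments.
Context {d : measure_display} {T : measurableType d} {R : realType}.
Variable P : probability T R.
Implicit Types U V : T -> R.

Definition mean U : R := Rintegral P setT U.

(** A class stable under sums and products, so that every polynomial in the Gaussian increments is
    integrable without tracking degrees. *)
Definition all_moments U := measurable_fun setT U /\
  forall p, P.-integrable setT (EFin \o (fun w => `|U w| ^+ p)).

Lemma all_momentsW V : measurable_fun setT V ->
  (forall p : nat, exists C : R, exists g : T -> R,
    [/\ 0 <= C, P.-integrable setT (EFin \o g) & forall w, `|V w| ^+ p <= C * g w]) ->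
  all_moments V.
Proof.
move=> mV h; split => // p; have [C [g [C0 ig Vg]]] := h p.
have ig' : P.-integrable setT (EFin \o (fun w => C * g w)).
  by apply: eq_integrable (integrableZl measurableT C ig) => // w _; rewrite EFinM.
apply: le_integrable ig' => //.
  by apply/measurable_EFinP/measurable_funX/measurableT_comp.
by move=> w _; rewrite !abse_EFin lee_fin ger0_norm ?exprn_ge0// (le_trans (Vg w))// ler_norm.
Qed.

Lemma all_moments_integrable U : all_moments U -> P.-integrable setT (EFin \o U).
Proof.
move=> [mU /(_ 1%N) iU]; apply: le_integrable iU => //; first exact/measurable_EFinP.
by move=> w _; rewrite !abse_EFin lee_fin expr1 normr_id.
Qed.

Lemma all_moments_bounded U C : measurable_fun setT U -> (forall w, `|U w| <= C) ->
  all_moments U.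
Proof.
move=> mU UC; apply: all_momentsW => // p; exists (`|C| ^+ p), (cst 1); split.
- by rewrite exprn_ge0.
- exact: finite_measure_integrable_cst.
- move=> w; rewrite mulr1 lerXn2r ?nnegrE//.
  by rewrite (le_trans (UC w))// ler_norm.
Qed.

Lemma all_moments_cst (c : R) : all_moments (cst c).
Proof. exact: (@all_moments_bounded _ `|c|). Qed.

Lemma all_momentsM U V : all_moments U -> all_moments V -> all_moments (fun w => U w * V w).
Proof.
move=> [mU iU] [mV iV]; apply: all_momentsW; first exact: measurable_funM.
move=> p; exists 1, (fun w => `|U w| ^+ (p + p) + `|V w| ^+ (p + p)); split => //.
- by apply: eq_integrable (integrableD measurableT (iU _) (iV _)) => // w _; rewrite EFinD.
- move=> w; rewrite normrM exprMn !exprD mul1r.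
  set u := `|U w| ^+ p; set v := `|V w| ^+ p.
  by have := sqr_ge0 (u - v); have := sqr_ge0 (u + v); nra.
Qed.

Lemma powD_le (p : nat) (u v : R) : 0 <= u -> 0 <= v ->
  (u + v) ^+ p <= 2 ^+ p * (u ^+ p + v ^+ p).
Proof.
wlog uv : u v / u <= v => [H|] u0 v0.
  have /orP[/H|/H] := le_total u v; first exact.
  by rewrite [v + u]addrC [v ^+ p + _]addrC; exact.
rewrite (@le_trans _ _ ((2 * v) ^+ p))//.
  by rewrite lerXn2r ?nnegrE ?addr_ge0 ?mulr_ge0//; lra.
by rewrite exprMn ler_wpM2l ?exprn_ge0// lerDr exprn_ge0.
Qed.

Lemma all_momentsD U V : all_moments U -> all_moments V -> all_moments (fun w => U w + V w).
Proof.
move=> [mU iU] [mV iV]; apply: all_momentsW; first exact: measurable_funD.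
move=> p; exists (2 ^+ p), (fun w => `|U w| ^+ p + `|V w| ^+ p); split.
- by rewrite exprn_ge0.
- by apply: eq_integrable (integrableD measurableT (iU p) (iV p)) => // w _; rewrite EFinD.
- move=> w; apply: le_trans (powD_le p (normr_ge0 _) (normr_ge0 _)).
  by rewrite lerXn2r ?nnegrE// ?addr_ge0// ler_normD.
Qed.

Lemma all_momentsZ (c : R) U : all_moments U -> all_moments (fun w => c * U w).
Proof. by move=> mU; apply: all_momentsM => //; exact: all_moments_cst. Qed.

Lemma all_momentsN U : all_moments U -> all_moments (fun w => - U w).
Proof.
move=> mU; rewrite (_ : (fun _ => _) = (fun w => -1 * U w)); first exact: all_momentsZ.
by apply/funext => w; rewrite mulN1r.
Qed.

Lemma all_momentsB U V : all_moments U -> all_moments V -> all_moments (fun w => U w - V w).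
Proof. by move=> mU mV; apply: all_momentsD => //; exact: all_momentsN. Qed.

Lemma all_momentsX U n : all_moments U -> all_moments (fun w => U w ^+ n).
Proof.
move=> mU; elim: n => [|n ih]; first exact: all_moments_cst.
rewrite (_ : (fun _ => _) = (fun w => U w * U w ^+ n)); first exact: all_momentsM.
by apply/funext => w; rewrite exprS.
Qed.

Lemma all_moments_sum (m n : nat) (U : nat -> T -> R) :
  (forall i, (m <= i < n)%N -> all_moments (U i)) ->
  all_moments (fun w => \sum_(m <= i < n) U i w).
Proof.
have [nm|mn] := leqP n m.
  move=> _; rewrite (_ : (fun _ => _) = cst 0); first exact: all_moments_cst.
  by apply/funext => w; rewrite big_geq.
elim: n mn => // n ih mn hU.
move: mn; rewrite ltnS leq_eqVlt => /predU1P[mn|mn].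
  rewrite (_ : (fun _ => _) = U n); first by apply: hU; rewrite mn leqnn ltnSn.
  by apply/funext => w; rewrite mn big_nat1.
rewrite (_ : (fun _ => _) = (fun w => \sum_(m <= i < n) U i w + U n w)).
  apply: all_momentsD; last by apply: hU; rewrite ltnSn (ltnW mn).
  by apply: ih => // i /andP[mi ni]; apply: hU; rewrite mi ltnS ltnW.
by apply/funext => w; rewrite big_nat_recr//= ltnW.
Qed.

Lemma meanD U V : all_moments U -> all_moments V ->
  mean (fun w => U w + V w) = mean U + mean V.
Proof. by move=> mU mV; rewrite /mean RintegralD//; exact: all_moments_integrable. Qed.

Lemma meanZ (c : R) U : all_moments U -> mean (fun w => c * U w) = c * mean U.
Proof. by move=> mU; rewrite /mean RintegralZl//; exact: all_moments_integrable. Qed.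

Lemma meanB U V : all_moments U -> all_moments V ->
  mean (fun w => U w - V w) = mean U - mean V.
Proof. by move=> mU mV; rewrite /mean RintegralB//; exact: all_moments_integrable. Qed.

Lemma mean_cst (c : R) : mean (cst c) = c.
Proof.
rewrite /mean Rintegral_cst//.
by rewrite (_ : fine (P setT) = 1) ?mulr1//; exact: (congr1 fine (probability_setT P)).
Qed.

Lemma mean_le U V : all_moments U -> all_moments V -> (forall w, U w <= V w) ->
  mean U <= mean V.
Proof. by move=> mU mV UV; apply: le_Rintegral => //; exact: all_moments_integrable. Qed.

Lemma mean_ge0 U : (forall w, 0 <= U w) -> 0 <= mean U.
Proof. by move=> U0; exact: Rintegral_ge0. Qed.

Lemma mean_ext U V : (forall w, U w = V w) -> mean U = mean V.
Proof. by move=> UV; congr mean; exact/funext. Qed.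

Lemma mean_indic (A : set T) : measurable A -> mean (\1_A) = fine (P A).
Proof. by move=> mA; rewrite /mean /Rintegral integral_indic// setIT. Qed.

Lemma all_moments_indic (A : set T) : measurable A -> all_moments (\1_A).
Proof.
move=> mA; apply: (@all_moments_bounded _ 1); first exact: measurable_indic.
by move=> w; rewrite indicE; case: (_ \in _); rewrite ?normr1 ?normr0.
Qed.

Lemma markov_mean U (c : R) : all_moments U -> (forall w, 0 <= U w) -> 0 < c ->
  c * fine (P [set w | c <= U w]) <= mean U.
Proof.
move=> mU U0 c0.
have mE : measurable [set w | c <= U w].
  rewrite -[X in measurable X]setTI; apply: (@measurable_fun_le _ _ _ _ (cst c)) => //.
  by case: mU.
rewrite -mean_indic// -meanZ; last exact: all_moments_indic.
apply: mean_le => //; first by apply: all_momentsZ; exact: all_moments_indic.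
move=> w; rewrite indicE; case: (boolP (w \in _)) => [|_]; last by rewrite mulr0.
by rewrite inE /= mulr1.
Qed.

Lemma meanM_indep (C D : set (set T)) U V :
  C `<=` measurable -> D `<=` measurable -> indep_sys P <<s C >> <<s D >> ->
  adapted C U -> adapted D V -> all_moments U -> all_moments V ->
  mean (fun w => U w * V w) = mean U * mean V.
Proof.
move=> Cm Dm CD aU aV mU mV.
by have [] := @indep_integral _ _ _ P C D U V Cm Dm CD aU aV
  (all_moments_integrable mU) (all_moments_integrable mV).
Qed.

Lemma ge0_law_integral d' (S : measurableType d') (U : T -> S) (nu : {measure set S -> \bar R})
    (f : S -> \bar R) : measurable_fun setT U ->
  (forall B, measurable B -> P (U @^-1` B) = nu B) ->
  measurable_fun setT f -> (forall x, 0 <= f x)%E ->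
  (\int[P]_w f (U w) = \int[nu]_x f x)%E.
Proof.
move=> mU lU mf f0; transitivity (\int[pushforward P U]_x f x)%E.
  by rewrite ge0_integral_pushforward.
by apply: eq_measure_integral => A mA _; exact: lU.
Qed.

Lemma law_integral d' (S : measurableType d') (U : T -> S) (nu : {measure set S -> \bar R})
    (f : S -> \bar R) : measurable_fun setT U ->
  (forall B, measurable B -> P (U @^-1` B) = nu B) ->
  measurable_fun setT f -> P.-integrable setT (f \o U) ->
  (\int[P]_w f (U w) = \int[nu]_x f x)%E.
Proof.
move=> mU lU mf f0; transitivity (\int[pushforward P U]_x f x)%E.
  by rewrite integral_pushforward.
by apply: eq_measure_integral => A mA _; exact: lU.
Qed.

(** The parameter s is the standard deviation, as in [normal_prob]. *)
Definition gauss_law (U : T -> R) (s : R) := measurable_fun setT U /\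
  forall B : set R, measurable B -> P (U @^-1` B) = normal_prob 0 s B.

Lemma gauss_law_integral U s (f : R -> R) : gauss_law U s ->
  measurable_fun setT f -> (forall x, 0 <= f x) ->
  (\int[P]_w (f (U w))%:E = \int[normal_prob 0 s]_x (f x)%:E)%E.
Proof.
move=> [mU lU] mf f0.
have mf' : measurable_fun setT (EFin \o f) by exact/measurable_EFinP.
exact: (@ge0_law_integral _ (measurableTypeR R) U (normal_prob 0 s) (EFin \o f) mU lU mf' f0).
Qed.

Lemma gauss_law_all_moments U s : 0 < s -> gauss_law U s -> all_moments U.
Proof.
move=> s0 lU; split; first by case: lU.
move=> p; apply/integrableP; split.
  by apply/measurable_EFinP/measurable_funX/measurableT_comp => //; case: lU.
under eq_integral do rewrite /= ger0_norm ?exprn_ge0//.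
have := @gauss_law_integral U s (fun x => `|x| ^+ p) lU.
move=> ->; last 2 first.
- by apply: measurable_funX; exact: normr_measurable.
- by move=> x; rewrite exprn_ge0.
by apply: le_lt_trans (normal_abs_moment_ub p s0) _; rewrite ltry.
Qed.

Lemma gauss_law_mean U s (f : R -> R) : 0 < s -> gauss_law U s -> measurable_fun setT f ->
  all_moments (fun w => f (U w)) ->
  mean (fun w => f (U w)) = \int[normal_prob 0 s]_x f x.
Proof.
move=> s0 [mU lU] mf iU; rewrite /mean /Rintegral; congr fine.
have mf' : measurable_fun setT (EFin \o f) by exact/measurable_EFinP.
exact: (@law_integral _ (measurableTypeR R) U (normal_prob 0 s) (EFin \o f) mU lU mf'
  (all_moments_integrable iU)).
Qed.

Lemma gauss_law_mean1 U s : 0 < s -> gauss_law U s -> mean U = 0.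
Proof.
move=> s0 lU; rewrite -(normal_mean s0); apply: (@gauss_law_mean _ _ id) => //.
exact: gauss_law_all_moments lU.
Qed.

Lemma gauss_law_mean2 U s : 0 < s -> gauss_law U s -> mean (fun w => U w ^+ 2) = s ^+ 2.
Proof.
move=> s0 lU; rewrite -(normal_variance s0).
apply: (@gauss_law_mean _ _ (fun x => x ^+ 2)) => //.
by apply: all_momentsX; exact: gauss_law_all_moments lU.
Qed.

Lemma gauss_law_mean4 U s : 0 < s -> gauss_law U s ->
  mean (fun w => U w ^+ 4) <= 2 * expR (1 / 2) * 4 ^+ 4 * s ^+ 4.
Proof.
move=> s0 lU.
have m4 : all_moments (fun w => U w ^+ 4).
  by apply: all_momentsX; exact: gauss_law_all_moments lU.
rewrite -lee_fin /mean /Rintegral fineK; last first.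
  by apply: integrable_fin_num => //; exact: all_moments_integrable.
have e (x : R) : x ^+ 4 = `|x| ^+ 4 by rewrite -normrX ger0_norm// exprn_even_ge0.
under eq_integral do rewrite e.
have := @gauss_law_integral U s (fun x => `|x| ^+ 4) lU.
move=> ->; last 2 first.
- by apply: measurable_funX; exact: normr_measurable.
- by move=> x; rewrite exprn_ge0.
exact: normal_abs_moment_ub.
Qed.

End moments.

(** * Dyadic increments of the Brownian motion *)

Section dyadic_grid.
Context {d : measure_display} {T : measurableType d} {R : realType}.
Variables (P : probability T R) (W1 W2 : R -> T -> R).
Hypothesis bm : is_BM2 P W1 W2.

Definition dya (q i : nat) : R := i%:R / 2 ^+ q.

Definition incr (W : R -> T -> R) (q i : nat) (w : T) : R :=
  W (dya q i.+1) w - W (dya q i) w.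

(** Pi-system of rectangles in the increments of the cells m, ..., n - 1 of level q. The cells below
    m are kept with trivial sides, so that the product rule of [is_BM2] on the grid started at time
    0 applies whatever m is. *)
Definition rect (q m n : nat) : set (set T) :=
  [set E | exists A B : nat -> set R,
    [/\ forall k, measurable (A k) /\ measurable (B k),
        forall k, (k < m)%N -> A k = setT /\ B k = setT &
        E = \bigcap_(k in [set k | (k < n)%N])
              ([set w | A k (incr W1 q k w)] `&` [set w | B k (incr W2 q k w)])]].

Lemma dya_ge0 q i : 0 <= dya q i.
Proof. by rewrite divr_ge0// exprn_ge0. Qed.

Lemma dyaS q i : dya q i.+1 - dya q i = (2 ^+ q)^-1.
Proof. by rewrite /dya -mulrBl -addn1 natrD addrC addKr mul1r. Qed.

Lemma dya_lt q i j : (i < j)%N -> dya q i < dya q j.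
Proof. by move=> ij; rewrite /dya ltr_pM2r ?invr_gt0 ?exprn_gt0// ltr_nat. Qed.

Lemma dya_refine q m i : dya (q + m) (i * 2 ^ m) = dya q i.
Proof.
rewrite /dya exprD natrM natrX -mulrA; congr (_ * _).
by rewrite invfM mulrCA mulfV ?mulr1// expf_neq0.
Qed.

Let mW1 t : measurable_fun setT (W1 t). Proof. by case: bm => /(_ t)[]. Qed.
Let mW2 t : measurable_fun setT (W2 t). Proof. by case: bm => /(_ t)[]. Qed.

Lemma measurable_incr1 q i : measurable_fun setT (incr W1 q i).
Proof. exact: measurable_funB. Qed.
Lemma measurable_incr2 q i : measurable_fun setT (incr W2 q i).
Proof. exact: measurable_funB. Qed.

Let pre_meas (U : T -> R) (B : set R) : measurable_fun setT U -> measurable B ->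
  measurable [set w | B (U w)].
Proof. by move=> mU mB; have := mU measurableT B mB; rewrite setTI. Qed.

Lemma rect_measurable q m n : rect q m n `<=` measurable.
Proof.
move=> _ [A [B [mAB _ ->]]]; apply: bigcap_measurableType.
move=> k _; have [mA mB] := mAB k.
by apply: measurableI; apply: pre_meas => //; [exact: measurable_incr1|exact: measurable_incr2].
Qed.

Local Notation gam q := (normal_prob 0 (Num.sqrt (2 ^+ q)^-1) : set R -> \bar R).

Lemma rect_prob q n (A B : nat -> set R) :
  (forall k, measurable (A k) /\ measurable (B k)) ->
  P (\bigcap_(k in [set k | (k < n)%N])
      ([set w | A k (incr W1 q k w)] `&` [set w | B k (incr W2 q k w)])) =
  (\prod_(0 <= k < n) (gam q (A k) * gam q (B k)))%E.
Proof.
move=> mAB; case: bm => _ _ _ h; rewrite big_mkord.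
apply: etrans (h n (dya q) (dya_ge0 q 0) (fun k _ => dya_lt q (ltnSn k)) A B mAB) _.
by apply: eq_bigr => k _; rewrite dyaS.
Qed.

Lemma gamT q : gam q setT = 1%E.
Proof. exact: probability_setT. Qed.

Lemma rect_setT q m n : rect q m n setT.
Proof.
exists (fun _ => setT), (fun _ => setT); split => //.
by apply/esym; rewrite -subTset => w _ k _.
Qed.

Lemma rect_setI q m n : setI_closed (rect q m n).
Proof.
move=> _ _ [A [B [mAB tAB ->]]] [A' [B' [mAB' tAB' ->]]].
exists (fun k => A k `&` A' k), (fun k => B k `&` B' k); split.
- by move=> k; have [? ?] := mAB k; have [? ?] := mAB' k; split; exact: measurableI.
- by move=> k km; have [-> ->] := tAB k km; have [-> ->] := tAB' k km; rewrite !setTI.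
- rewrite -bigcapI; apply: eq_bigcapr => k _.
  by apply/seteqP; split => w /=; tauto.
Qed.

Lemma sub_rect q m n m' n' : (m' <= m)%N -> (n <= n')%N -> rect q m n `<=` rect q m' n'.
Proof.
move=> mm nn _ [A [B [mAB tAB ->]]].
exists (fun k => if (k < n)%N then A k else setT), (fun k => if (k < n)%N then B k else setT).
split.
- by move=> k; case: ifP.
- by move=> k km; have [-> ->] := tAB k (leq_trans km mm); rewrite if_same.
- apply/seteqP; split => w h k /=.
    by case: ifP => // kn _; exact: h.
  by move=> kn; have := h k (leq_trans kn nn); rewrite /= kn.
Qed.

(** Both rectangles are sides of one rectangle, obtained by splicing the two families at index n;
    the product rule for it splits there. *)
Lemma rect_indep q m n l : (n <= l)%N -> indep_sys P (rect q m n) (rect q n l).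
Proof.
move=> nl _ _ [A [B [mAB tAB ->]]] [A' [B' [mAB' tAB' ->]]].
pose A2 k := if (k < n)%N then A k else A' k.
pose B2 k := if (k < n)%N then B k else B' k.
have mAB2 k : measurable (A2 k) /\ measurable (B2 k) by rewrite /A2 /B2; case: ifP.
rewrite (_ : _ `&` _ = \bigcap_(k in [set k | (k < l)%N])
      ([set w | A2 k (incr W1 q k w)] `&` [set w | B2 k (incr W2 q k w)])); last first.
  apply/seteqP; split => w.
    move=> [h1 h2] k /= kl; rewrite /A2 /B2; case: ifP => kn; first exact: h1.
    exact: h2.
  move=> h; split => k /= kn.
    by have := h k (leq_trans kn nl); rewrite /A2 /B2 /= kn.
  have := h k kn; rewrite /A2 /B2 /=; case: ifP => // kn' _.
  by have [-> ->] := tAB' k kn'.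
rewrite !rect_prob// (@big_cat_nat _ _ _ n 0%N l)//= [X in (_ = _ * X)%E](@big_cat_nat _ _ _ n 0%N l)//=.
congr (_ * _)%E.
  rewrite !big_nat; apply: eq_bigr => k /andP[_ kn].
  by rewrite /A2 /B2 kn.
rewrite [X in (_ = X * _)%E]big_nat [X in (_ = X * _)%E]big1 ?mul1e.
  rewrite !big_nat; apply: eq_bigr => k /andP[nk _].
  by rewrite /A2 /B2 ltnNge nk.
by move=> k /andP[_ kn]; have [-> ->] := tAB' k kn; rewrite gamT mule1.
Qed.

Lemma sigma_rect_indep q m n l : (n <= l)%N ->
  indep_sys P <<s rect q m n >> <<s rect q n l >>.
Proof.
move=> nl; apply: indep_sigma; by [exact: rect_measurable|exact: rect_setI|
  exact: rect_setT|exact: rect_indep].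
Qed.

Lemma adapted_incr1 q m n k : (m <= k < n)%N -> adapted (rect q m n) (incr W1 q k).
Proof.
move=> /andP[mk kn] _ B mB; rewrite setTI; apply: sub_sigma_algebra.
exists (fun j => if j == k then B else setT), (fun _ => setT); split.
- by move=> j; case: ifP.
- by move=> j jm; rewrite ltn_eqF// (leq_trans jm).
- apply/seteqP; split => w.
    by move=> Bw j /= jn; split => //; case: eqP => // ->.
  by move=> /(_ k kn) /= []; rewrite eqxx.
Qed.

Lemma adapted_incr2 q m n k : (m <= k < n)%N -> adapted (rect q m n) (incr W2 q k).
Proof.
move=> /andP[mk kn] _ B mB; rewrite setTI; apply: sub_sigma_algebra.
exists (fun _ => setT), (fun j => if j == k then B else setT); split.
- by move=> j; case: ifP.
- by move=> j jm; rewrite ltn_eqF// (leq_trans jm).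
- apply/seteqP; split => w.
    by move=> Bw j /= jn; split => //; case: eqP => // ->.
  by move=> /(_ k kn) /= []; rewrite eqxx.
Qed.

Lemma incr_refine W q k w :
  incr W q k w = incr W q.+1 (2 * k) w + incr W q.+1 (2 * k).+1 w.
Proof.
rewrite /incr; have e j : dya q j = dya q.+1 (2 * j).
  by rewrite -addn1 -(dya_refine q 1) expn1 mulnC.
by rewrite !e mulnS add2n; ring.
Qed.

(** A level-q increment is the sum of two increments of level q + 1. This is what allows events
    observed on different grids to be compared on a common finer one. *)
Lemma rect_refine q m n : rect q m n `<=` <<s rect q.+1 (2 * m) (2 * n) >>.
Proof.
move=> _ [A [B [mAB tAB ->]]].
apply: (@bigcap_measurableType _ (g_sigma_algebraType (rect q.+1 (2 * m) (2 * n)))).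
move=> k /= kn; have [mA mB] := mAB k.
have [km|mk] := ltnP k m.
  have [-> ->] := tAB k km.
  rewrite (_ : _ `&` _ = setT); first exact: measurableT.
  by apply/seteqP; split.
have l1 : (2 * m <= 2 * k < 2 * n)%N by rewrite leq_pmul2l// ltn_pmul2l// mk kn.
have l2 : (2 * m <= (2 * k).+1 < 2 * n)%N.
  rewrite leqW ?leq_pmul2l//=.
  by rewrite (@leq_trans (2 * k.+1))// ?leq_pmul2l// mulnS add2n.
have a1 : adapted (rect q.+1 (2 * m) (2 * n)) (incr W1 q k).
  rewrite (_ : incr W1 q k = (fun w => incr W1 q.+1 (2 * k) w + incr W1 q.+1 (2 * k).+1 w)).
    by apply: measurable_funD; exact: adapted_incr1.
  by apply/funext => w; exact: incr_refine.
have a2 : adapted (rect q.+1 (2 * m) (2 * n)) (incr W2 q k).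
  rewrite (_ : incr W2 q k = (fun w => incr W2 q.+1 (2 * k) w + incr W2 q.+1 (2 * k).+1 w)).
    by apply: measurable_funD; exact: adapted_incr2.
  by apply/funext => w; exact: incr_refine.
by apply: measurableI; [exact: (adapted_preimage a1)|exact: (adapted_preimage a2)].
Qed.

Lemma sigma_rect_refine q r m n :
  <<s rect q m n >> `<=` <<s rect (q + r) (2 ^ r * m) (2 ^ r * n) >>.
Proof.
elim: r => [|r ih]; first by rewrite addn0 !mul1n.
rewrite addnS !expnS -!mulnA; apply: (subset_trans ih).
by apply: smallest_sub; [exact: smallest_sigma_algebra|exact: rect_refine].
Qed.

Lemma sqrt_step_gt0 (q : nat) : 0 < Num.sqrt (2 ^+ q)^-1 :> R.
Proof. by rewrite sqrtr_gt0 invr_gt0 exprn_gt0. Qed.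

Lemma incr_law1 q i : gauss_law P (incr W1 q i) (Num.sqrt (2 ^+ q)^-1).
Proof.
split; first exact: measurable_incr1.
move=> B mB.
have := @rect_prob q i.+1 (fun k => if k == i then B else setT) (fun _ => setT).
rewrite big_nat_recr//= eqxx gamT mule1 big_nat big1 ?mul1e.
  move=> <-; last by move=> k; case: ifP.
  congr (P _); apply/seteqP; split => w /=.
    by move=> Bw k /= _; split => //; case: eqP => // ->.
  by move=> /(_ i (ltnSn i)) /= []; rewrite eqxx.
by move=> k /andP[_ ki]; rewrite ltn_eqF// gamT mule1.
Qed.

Lemma incr_law2 q i : gauss_law P (incr W2 q i) (Num.sqrt (2 ^+ q)^-1).
Proof.
split; first exact: measurable_incr2.
move=> B mB.
have := @rect_prob q i.+1 (fun _ => setT) (fun k => if k == i then B else setT).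
rewrite big_nat_recr//= eqxx gamT mul1e big_nat big1 ?mul1e.
  move=> <-; last by move=> k; case: ifP.
  congr (P _); apply/seteqP; split => w /=.
    by move=> Bw k /= _; split => //; case: eqP => // ->.
  by move=> /(_ i (ltnSn i)) /= []; rewrite eqxx.
by move=> k /andP[_ ki]; rewrite ltn_eqF// gamT mule1.
Qed.

(** The Borel preimages under each coordinate form pi-systems [C1] and [C2], on which the product
    rule for a single cell factors; the mean of the product is then a product of zero means. *)
Lemma incr_mean12 q i : mean P (fun w => incr W1 q i w * incr W2 q i w) = 0.
Proof.
pose C1 := [set incr W1 q i @^-1` B | B in [set B : set R | measurable B]].
pose C2 := [set incr W2 q i @^-1` B | B in [set B : set R | measurable B]].
have C1m : C1 `<=` measurable.
  by move=> _ [B mB <-]; apply: pre_meas => //; exact: measurable_incr1.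
have C2m : C2 `<=` measurable.
  by move=> _ [B mB <-]; apply: pre_meas => //; exact: measurable_incr2.
rewrite (@meanM_indep _ _ _ P C1 C2)//.
- by rewrite (gauss_law_mean1 (sqrt_step_gt0 q) (incr_law1 q i)) mul0r.
- apply: indep_sigma => //.
  + move=> _ _ [B mB <-] [B' mB' <-]; exists (B `&` B') => //; exact: measurableI.
  + by exists setT => //; exact: measurableT.
  + move=> _ _ [B mB <-] [B' mB' <-]; exists (B `&` B') => //; exact: measurableI.
  + by exists setT => //; exact: measurableT.
  + move=> _ _ [B mB <-] [B' mB' <-].
    have [_ ->//] := incr_law1 q i; have [_ ->//] := incr_law2 q i.
    have := @rect_prob q i.+1 (fun k => if k == i then B else setT) (fun k => if k == i then B' else setT).
    rewrite big_nat_recr//= eqxx big_nat big1 ?mul1e.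
      move=> <-; last by move=> k; case: ifP.
      congr (P _); apply/seteqP; split => w /=.
        by move=> [Bw Bw'] k /= _; case: eqP => // ->.
      by move=> /(_ i (ltnSn i)) /= []; rewrite eqxx.
    by move=> k /andP[_ ki]; rewrite ltn_eqF// gamT mule1.
- by move=> _ B mB; rewrite setTI; apply: sub_sigma_algebra; exists B.
- by move=> _ B mB; rewrite setTI; apply: sub_sigma_algebra; exists B.
- exact: gauss_law_all_moments (sqrt_step_gt0 q) (incr_law1 q i).
- exact: gauss_law_all_moments (sqrt_step_gt0 q) (incr_law2 q i).
Qed.

(** The constant of [normal_abs_moment_ub] for p = 4. *)
Definition gconst : R := 2 * expR (1 / 2) * 4 ^+ 4.

Lemma incr_moments1 q i : [/\ all_moments P (incr W1 q i), mean P (incr W1 q i) = 0,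
  mean P (fun w => incr W1 q i w ^+ 2) = (2 ^+ q)^-1 &
  mean P (fun w => incr W1 q i w ^+ 4) <= gconst * (2 ^+ q)^-1 ^+ 2].
Proof.
have s0 := sqrt_step_gt0 q; have l := incr_law1 q i.
have e : Num.sqrt (2 ^+ q)^-1 ^+ 2 = (2 ^+ q)^-1 :> R by rewrite sqr_sqrtr// invr_ge0 exprn_ge0.
split; [exact: gauss_law_all_moments l|exact: gauss_law_mean1 l| |].
- by rewrite (gauss_law_mean2 s0 l).
- by rewrite -e -exprM; exact: gauss_law_mean4.
Qed.

Lemma incr_moments2 q i : [/\ all_moments P (incr W2 q i), mean P (incr W2 q i) = 0,
  mean P (fun w => incr W2 q i w ^+ 2) = (2 ^+ q)^-1 &
  mean P (fun w => incr W2 q i w ^+ 4) <= gconst * (2 ^+ q)^-1 ^+ 2].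
Proof.
have s0 := sqrt_step_gt0 q; have l := incr_law2 q i.
have e : Num.sqrt (2 ^+ q)^-1 ^+ 2 = (2 ^+ q)^-1 :> R by rewrite sqr_sqrtr// invr_ge0 exprn_ge0.
split; [exact: gauss_law_all_moments l|exact: gauss_law_mean1 l| |].
- by rewrite (gauss_law_mean2 s0 l).
- by rewrite -e -exprM; exact: gauss_law_mean4.
Qed.
End dyadic_grid.

(** * The Euler chain of the Levy area *)

Section euler_chain.
Context {d : measure_display} {T : measurableType d} {R : realType}.
Variables (P : probability T R) (W1 W2 : R -> T -> R).
Hypothesis bm : is_BM2 P W1 W2.

Local Notation mean := (mean P).
Local Notation all_moments := (all_moments P).
Local Notation rect := (rect W1 W2).
Local Notation Z1 := (incr W1).
Local Notation Z2 := (incr W2).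
Local Notation step q := ((2 ^+ q)^-1 : R).

Definition disp (W : R -> T -> R) (q m i : nat) (w : T) : R :=
  W (dya q i) w - W (dya q m) w.

(* Euler scheme of level [q] for the Levy area accumulated from time [m / 2^q] on. *)
Definition earea (q m i : nat) (w : T) : R :=
  \sum_(m <= l < i) 2^-1 * (disp W1 q m l w * Z2 q l w - disp W2 q m l w * Z1 q l w).

Lemma step_gt0 q : 0 < step q.
Proof. by rewrite invr_gt0 exprn_gt0. Qed.

Lemma dispS W q m i w : disp W q m i.+1 w = disp W q m i w + incr W q i w.
Proof. by rewrite /disp /incr; ring. Qed.

Lemma disp0 W q m w : disp W q m m w = 0.
Proof. by rewrite /disp subrr. Qed.

Lemma disp_sum W q m i w : (m <= i)%N -> disp W q m i w = \sum_(m <= l < i) incr W q l w.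
Proof.
move=> mi; rewrite -(subnKC mi); elim: (i - m)%N => [|k ih].
  by rewrite addn0 disp0 big_geq.
by rewrite addnS dispS ih big_nat_recr//= leq_addr.
Qed.

Lemma eareaS q m i w : (m <= i)%N -> earea q m i.+1 w = earea q m i w +
  2^-1 * (disp W1 q m i w * Z2 q i w - disp W2 q m i w * Z1 q i w).
Proof. by move=> mi; rewrite /earea big_nat_recr. Qed.

Lemma earea0 q m w : earea q m m w = 0.
Proof. by rewrite /earea big_geq. Qed.

Lemma adapted_le q m n m' n' (U : T -> R) : (m' <= m)%N -> (n <= n')%N ->
  adapted (rect q m n) U -> adapted (rect q m' n') U.
Proof.
move=> mm nn; apply: sub_adapted => E rE; apply: sub_sigma_algebra.
exact: sub_rect rE.
Qed.

Lemma adapted_sum (C : set (set T)) (m n : nat) (U : nat -> T -> R) :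
  (forall i, (m <= i < n)%N -> adapted C (U i)) ->
  adapted C (fun w => \sum_(m <= i < n) U i w).
Proof.
have [nm|mn] := leqP n m.
  move=> _; rewrite (_ : (fun _ => _) = cst 0); first exact: measurable_cst.
  by apply/funext => w; rewrite big_geq.
elim: n mn => // n ih mn hU.
move: mn; rewrite ltnS leq_eqVlt => /predU1P[mn|mn].
  rewrite (_ : (fun _ => _) = U n); first by apply: hU; rewrite mn leqnn ltnSn.
  by apply/funext => w; rewrite mn big_nat1.
rewrite (_ : (fun _ => _) = (fun w => \sum_(m <= i < n) U i w + U n w)).
  apply: measurable_funD; last by apply: hU; rewrite ltnSn (ltnW mn).
  by apply: ih => // i /andP[mi ni]; apply: hU; rewrite mi ltnS ltnW.
by apply/funext => w; rewrite big_nat_recr//= ltnW.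
Qed.

Lemma adapted_disp1 q m i : (m <= i)%N -> adapted (rect q m i) (disp W1 q m i).
Proof.
move=> mi; rewrite (_ : disp _ _ _ _ = (fun w => \sum_(m <= l < i) Z1 q l w)).
  by apply: adapted_sum => l ml; exact: adapted_incr1.
by apply/funext => w; exact: disp_sum.
Qed.

Lemma adapted_disp2 q m i : (m <= i)%N -> adapted (rect q m i) (disp W2 q m i).
Proof.
move=> mi; rewrite (_ : disp _ _ _ _ = (fun w => \sum_(m <= l < i) Z2 q l w)).
  by apply: adapted_sum => l ml; exact: adapted_incr2.
by apply/funext => w; exact: disp_sum.
Qed.

Lemma adapted_earea q m i : adapted (rect q m i) (earea q m i).
Proof.
apply: adapted_sum => l /andP[ml li].
have li' := ltnW li.
apply: measurable_funM => //; apply: measurable_funB; apply: measurable_funM.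
- by apply: (adapted_le (leqnn m) li'); exact: adapted_disp1.
- by apply: adapted_incr2; rewrite ml li.
- by apply: (adapted_le (leqnn m) li'); exact: adapted_disp2.
- by apply: adapted_incr1; rewrite ml li.
Qed.

Lemma all_moments_incr1 q i : all_moments (Z1 q i).
Proof. by case: (incr_moments1 bm q i). Qed.
Lemma all_moments_incr2 q i : all_moments (Z2 q i).
Proof. by case: (incr_moments2 bm q i). Qed.

Lemma all_moments_disp1 q m i : (m <= i)%N -> all_moments (disp W1 q m i).
Proof.
move=> mi; rewrite (_ : disp _ _ _ _ = (fun w => \sum_(m <= l < i) Z1 q l w)).
  by apply: all_moments_sum => l _; exact: all_moments_incr1.
by apply/funext => w; exact: disp_sum.
Qed.

Lemma all_moments_disp2 q m i : (m <= i)%N -> all_moments (disp W2 q m i).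
Proof.
move=> mi; rewrite (_ : disp _ _ _ _ = (fun w => \sum_(m <= l < i) Z2 q l w)).
  by apply: all_moments_sum => l _; exact: all_moments_incr2.
by apply/funext => w; exact: disp_sum.
Qed.

Lemma all_moments_earea q m i : all_moments (earea q m i).
Proof.
apply: all_moments_sum => l /andP[ml li].
apply: all_momentsZ; apply: all_momentsB; apply: all_momentsM.
- exact: all_moments_disp1.
- exact: all_moments_incr2.
- exact: all_moments_disp2.
- exact: all_moments_incr1.
Qed.

Section one_step.
Variables (q n : nat).
Local Notation F := (rect q 0 n).
Local Notation z1 := (Z1 q n).
Local Notation z2 := (Z2 q n).

Let indep (U V : T -> R) : adapted F U -> adapted (rect q n n.+1) V ->
  all_moments U -> all_moments V -> mean (fun w => U w * V w) = mean U * mean V.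
Proof.
move=> aU aV mU mV; apply: (@meanM_indep _ _ _ P F (rect q n n.+1)) => //.
- exact: (rect_measurable bm).
- exact: (rect_measurable bm).
- by apply: (sigma_rect_indep bm).
Qed.

Let a1 : adapted (rect q n n.+1) z1. Proof. by apply: adapted_incr1; rewrite leqnn ltnSn. Qed.
Let a2 : adapted (rect q n n.+1) z2. Proof. by apply: adapted_incr2; rewrite leqnn ltnSn. Qed.
Let m1 := all_moments_incr1 q n.
Let m2 := all_moments_incr2 q n.

(** Takes the place of a conditional expectation given the first n cells: with adapted coefficients
    the linear and mixed terms of a quadratic polynomial in the new increment average to zero, and
    each square contributes the variance of a cell. *)
Lemma step_mean (U0 U1 U2 U11 U12 U22 : T -> R) :
  all_moments U0 ->
  adapted F U1 -> all_moments U1 -> adapted F U2 -> all_moments U2 ->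
  adapted F U11 -> all_moments U11 -> adapted F U12 -> all_moments U12 ->
  adapted F U22 -> all_moments U22 ->
  mean (fun w => U0 w + U1 w * z1 w + U2 w * z2 w + U11 w * z1 w ^+ 2 +
    U12 w * (z1 w * z2 w) + U22 w * z2 w ^+ 2) = mean U0 + step q * (mean U11 + mean U22).
Proof.
move=> m0 aU1 mU1 aU2 mU2 aU11 mU11 aU12 mU12 aU22 mU22.
have m11 : all_moments (fun w => z1 w ^+ 2) by exact: all_momentsX.
have m22 : all_moments (fun w => z2 w ^+ 2) by exact: all_momentsX.
have m12 : all_moments (fun w => z1 w * z2 w) by exact: all_momentsM.
have M1 : all_moments (fun w => U1 w * z1 w) by exact: all_momentsM.
have M2 : all_moments (fun w => U2 w * z2 w) by exact: all_momentsM.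
have M11 : all_moments (fun w => U11 w * z1 w ^+ 2) by exact: all_momentsM.
have M12 : all_moments (fun w => U12 w * (z1 w * z2 w)) by exact: all_momentsM.
have M22 : all_moments (fun w => U22 w * z2 w ^+ 2) by exact: all_momentsM.
have A11 : adapted (rect q n n.+1) (fun w => z1 w ^+ 2) by exact: measurable_funX.
have A22 : adapted (rect q n n.+1) (fun w => z2 w ^+ 2) by exact: measurable_funX.
have A12 : adapted (rect q n n.+1) (fun w => z1 w * z2 w) by exact: measurable_funM.
have D1 := all_momentsD m0 M1; have D2 := all_momentsD D1 M2.
have D3 := all_momentsD D2 M11; have D4 := all_momentsD D3 M12.
rewrite (meanD D4 M22) (meanD D3 M12) (meanD D2 M11) (meanD D1 M2) (meanD m0 M1).
rewrite (indep aU1 a1 mU1 m1) (indep aU2 a2 mU2 m2) (indep aU11 A11 mU11 m11).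
rewrite (indep aU12 A12 mU12 m12) (indep aU22 A22 mU22 m22).
have [_ -> -> _] := incr_moments1 bm q n; have [_ -> -> _] := incr_moments2 bm q n.
by rewrite (incr_mean12 bm); ring.
Qed.

Lemma step_mean4 (U : T -> R) : adapted F U -> (forall w, 0 <= U w <= 1) ->
  mean (fun w => U w * (z1 w ^+ 2 + z2 w ^+ 2) ^+ 2) <= 4 * gconst * step q ^+ 2.
Proof.
move=> aU U01.
have mU : all_moments U.
  apply: (@all_moments_bounded _ _ _ P U 1).
    by apply: adapted_measurable aU; exact: (rect_measurable bm).
  by move=> w; have /andP[? ?] := U01 w; rewrite ger0_norm.
have m14 : all_moments (fun w => z1 w ^+ 4) by exact: all_momentsX.
have m24 : all_moments (fun w => z2 w ^+ 4) by exact: all_momentsX.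
apply: (@le_trans _ _ (mean (fun w => 2 * z1 w ^+ 4 + 2 * z2 w ^+ 4))).
  apply: mean_le.
  - apply: all_momentsM => //; apply: all_momentsX; apply: all_momentsD; exact: all_momentsX.
  - by apply: all_momentsD; exact: all_momentsZ.
  - move=> w; have /andP[u0 u1] := U01 w.
    have -> : 2 * z1 w ^+ 4 + 2 * z2 w ^+ 4 =
      (z1 w ^+ 2 + z2 w ^+ 2) ^+ 2 + (z1 w ^+ 2 - z2 w ^+ 2) ^+ 2 by ring.
    have := sqr_ge0 (z1 w ^+ 2 + z2 w ^+ 2); have := sqr_ge0 (z1 w ^+ 2 - z2 w ^+ 2).
    by nra.
rewrite meanD; [|exact: all_momentsZ|exact: all_momentsZ].
rewrite !meanZ//.
have [_ _ _] := incr_moments1 bm q n; have [_ _ _] := incr_moments2 bm q n; lra.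
Qed.
End one_step.

Lemma mean_disp1 q m i : (m <= i)%N ->
  mean (fun w => disp W1 q m i w ^+ 2) = (i - m)%:R * step q.
Proof.
move=> mi; rewrite -(subnKC mi) addKn; elim: (i - m)%N => [|k ih].
  rewrite addn0 mul0r -[RHS](mean_cst P 0); apply: mean_ext => w.
  by rewrite disp0 expr0n.
have mk : (m <= m + k)%N by exact: leq_addr.
have md := all_moments_disp1 q mk.
have ad : adapted (rect q 0 (m + k)) (disp W1 q m (m + k)).
  by apply: (adapted_le (leq0n m) (leqnn _)); exact: adapted_disp1.
rewrite addnS (@mean_ext _ _ _ P _ (fun w => disp W1 q m (m + k) w ^+ 2 +
  2 * disp W1 q m (m + k) w * Z1 q (m + k) w + cst 0 w * Z2 q (m + k) w +
  cst 1 w * Z1 q (m + k) w ^+ 2 + cst 0 w * (Z1 q (m + k) w * Z2 q (m + k) w) +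
  cst 0 w * Z2 q (m + k) w ^+ 2)); last by move=> w; rewrite dispS /cst; ring.
rewrite (@step_mean q (m + k) _ (fun w => 2 * disp W1 q m (m + k) w)) ?ih ?mean_cst;
  try exact: all_moments_cst; try exact: measurable_cst.
- by rewrite -[k.+1]addn1 natrD; ring.
- exact: all_momentsX.
- exact: measurable_funM.
- exact: all_momentsZ.
Qed.

Lemma mean_disp2 q m i : (m <= i)%N ->
  mean (fun w => disp W2 q m i w ^+ 2) = (i - m)%:R * step q.
Proof.
move=> mi; rewrite -(subnKC mi) addKn; elim: (i - m)%N => [|k ih].
  rewrite addn0 mul0r -[RHS](mean_cst P 0); apply: mean_ext => w.
  by rewrite disp0 expr0n.
have mk : (m <= m + k)%N by exact: leq_addr.
have md := all_moments_disp2 q mk.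
have ad : adapted (rect q 0 (m + k)) (disp W2 q m (m + k)).
  by apply: (adapted_le (leq0n m) (leqnn _)); exact: adapted_disp2.
rewrite addnS (@mean_ext _ _ _ P _ (fun w => disp W2 q m (m + k) w ^+ 2 +
  cst 0 w * Z1 q (m + k) w + 2 * disp W2 q m (m + k) w * Z2 q (m + k) w +
  cst 0 w * Z1 q (m + k) w ^+ 2 + cst 0 w * (Z1 q (m + k) w * Z2 q (m + k) w) +
  cst 1 w * Z2 q (m + k) w ^+ 2)); last by move=> w; rewrite dispS /cst; ring.
rewrite (@step_mean q (m + k) _ (cst 0) (fun w => 2 * disp W2 q m (m + k) w)) ?ih ?mean_cst;
  try exact: all_moments_cst; try exact: measurable_cst.
- by rewrite -[k.+1]addn1 natrD; ring.
- exact: all_momentsX.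
- exact: measurable_funM.
- exact: all_momentsZ.
Qed.

(* Difference between the level-[q] Euler sum and the one whose integrand is frozen at the left
   end of each block of [j] cells. *)
Definition freeze_err (q j n : nat) (w : T) : R :=
  \sum_(0 <= l < n) 2^-1 * (disp W1 q (l - l %% j) l w * Z2 q l w
                             - disp W2 q (l - l %% j) l w * Z1 q l w).

(** The summands are orthogonal. Each displacement covers fewer than j cells, so it has second
    moment at most [j h] per coordinate, and each summand adds at most [j h^2 / 2], h being the
    step. *)
Lemma freeze_err_mean q j n : (0 < j)%N ->
  all_moments (freeze_err q j n) /\
  mean (fun w => freeze_err q j n w ^+ 2) <= 2^-1 * n%:R * j%:R * step q ^+ 2.
Proof.
move=> j0.
have mE k : all_moments (freeze_err q j k).
  apply: all_moments_sum => l _; apply: all_momentsZ.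
  apply: all_momentsB; apply: all_momentsM; by [exact: all_moments_incr1|exact: all_moments_incr2|
    apply: all_moments_disp1; exact: leq_subr|apply: all_moments_disp2; exact: leq_subr].
split => //; elim: n => [|n ih].
  rewrite mulr0 !mul0r -[leRHS](mean_cst P 0).
  by rewrite le_eqVlt (@mean_ext _ _ _ P _ (cst 0)) ?eqxx// => w; rewrite /freeze_err big_geq// expr0n.
have aE : adapted (rect q 0 n) (freeze_err q j n).
  apply: adapted_sum => l /andP[_ ln]; apply: measurable_funM => //.
  apply: measurable_funB; apply: measurable_funM.
  - by apply: (adapted_le (leq0n _) (ltnW ln)); apply: adapted_disp1; exact: leq_subr.
  - by apply: adapted_incr2.
  - by apply: (adapted_le (leq0n _) (ltnW ln)); apply: adapted_disp2; exact: leq_subr.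
  - by apply: adapted_incr1.
set m := (n - n %% j)%N.
have mn : (m <= n)%N by exact: leq_subr.
have a1 : adapted (rect q 0 n) (disp W1 q m n).
  by apply: (adapted_le (leq0n _) (leqnn n)); exact: adapted_disp1.
have a2 : adapted (rect q 0 n) (disp W2 q m n).
  by apply: (adapted_le (leq0n _) (leqnn n)); exact: adapted_disp2.
have m1 := all_moments_disp1 q mn; have m2 := all_moments_disp2 q mn.
(* The square at n + 1 is sorted as a quadratic polynomial in the newest increment, the shape
   required by [step_mean]. *)
rewrite (@mean_ext _ _ _ P _ (fun w => freeze_err q j n w ^+ 2 +
  (-1 * (freeze_err q j n w * disp W2 q m n w)) * Z1 q n w +
  (freeze_err q j n w * disp W1 q m n w) * Z2 q n w +
  (4^-1 * disp W2 q m n w ^+ 2) * Z1 q n w ^+ 2 +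
  (- 2^-1 * (disp W1 q m n w * disp W2 q m n w)) * (Z1 q n w * Z2 q n w) +
  (4^-1 * disp W1 q m n w ^+ 2) * Z2 q n w ^+ 2)); last first.
  by move=> w; rewrite /freeze_err big_nat_recr//= -/(freeze_err q j n w) -/m; field.
rewrite (@step_mean q n (fun w => freeze_err q j n w ^+ 2)
  (fun w => -1 * (freeze_err q j n w * disp W2 q m n w))
  (fun w => freeze_err q j n w * disp W1 q m n w)
  (fun w => 4^-1 * disp W2 q m n w ^+ 2)
  (fun w => - 2^-1 * (disp W1 q m n w * disp W2 q m n w))
  (fun w => 4^-1 * disp W1 q m n w ^+ 2));
  try by do ?[apply: all_momentsZ|apply: all_momentsM|apply: all_momentsX];
  try by do ?[apply: measurable_funM => //|apply: measurable_funX => //].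
rewrite !meanZ; [|exact: all_momentsX|exact: all_momentsX].
rewrite mean_disp1// mean_disp2// (_ : n - m = n %% j)%N; last first.
  by rewrite /m subKn// leq_mod.
have : (n %% j)%:R <= j%:R :> R by rewrite ler_nat ltnW// ltn_pmod.
have := step_gt0 q; move: ih; rewrite -[n.+1]addn1 natrD.
set h := step q; set a := (n %% j)%:R; set b := j%:R; set c := n%:R.
by move=> ih h0 ab; have : 0 <= (b - a) * h ^+ 2 by [rewrite mulr_ge0 ?subr_ge0 ?sqr_ge0]; nra.
Qed.

End euler_chain.

Ltac moments := repeat first [ assumption | apply: all_moments_cst | apply: all_momentsD
  | apply: all_momentsB | apply: all_momentsN | apply: all_momentsX | apply: all_momentsM ].

Ltac adapt := repeat first [ assumption | apply: measurable_cst | apply: measurable_funB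
  | apply: measurable_funD | apply: measurable_funX | apply: measurable_funM ].

(** * The Euler chain killed on leaving a region *)

Section killed_chain.
Context {d : measure_display} {T : measurableType d} {R : realType}.
Variables (P : probability T R) (W1 W2 : R -> T -> R).
Hypothesis bm : is_BM2 P W1 W2.

Local Notation mean := (mean P).
Local Notation all_moments := (all_moments P).
Local Notation rect := (rect W1 W2).
Local Notation Z1 := (incr W1).
Local Notation Z2 := (incr W2).
Local Notation step q := ((2 ^+ q)^-1 : R).
Local Notation V1 := (disp W1).
Local Notation V2 := (disp W2).
Local Notation B := (earea W1 W2).

Lemma adapted_state q m i d' (S : measurableType d') (f : R * R * R -> S) : (m <= i)%N ->
  measurable_fun setT f ->
  @measurable_fun _ _ (g_sigma_algebraType (rect q m i)) S setT
    (fun w => f (V1 q m i w, V2 q m i w, B q m i w)).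
Proof.
move=> mi mf; apply: (measurableT_comp mf).
apply: measurable_fun_pair; first apply: measurable_fun_pair.
- exact: adapted_disp1.
- exact: adapted_disp2.
- exact: adapted_earea.
Qed.

(** Same as [step_mean], with the result kept under a single mean so that it can be compared
    pointwise. *)
Lemma step_mean_eq q n (U0 U1 U2 U11 U12 U22 : T -> R) :
  all_moments U0 ->
  adapted (rect q 0 n) U1 -> all_moments U1 -> adapted (rect q 0 n) U2 -> all_moments U2 ->
  adapted (rect q 0 n) U11 -> all_moments U11 -> adapted (rect q 0 n) U12 -> all_moments U12 ->
  adapted (rect q 0 n) U22 -> all_moments U22 ->
  mean (fun w => U0 w + U1 w * Z1 q n w + U2 w * Z2 q n w + U11 w * Z1 q n w ^+ 2 +
    U12 w * (Z1 q n w * Z2 q n w) + U22 w * Z2 q n w ^+ 2) =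
  mean (fun w => U0 w + step q * (U11 w + U22 w)).
Proof.
move=> m0 a1 m1 a2 m2 a11 m11 a12 m12 a22 m22.
rewrite (step_mean bm m0 a1 m1 a2 m2 a11 m11 a12 m12 a22 m22).
have mD := all_momentsD m11 m22.
by rewrite (meanD m0 (all_momentsZ (step q) mD)) (meanZ _ mD) (meanD m11 m22).
Qed.

Section region.
Variable S : R * R * R -> bool.
Hypothesis mS : measurable_fun setT S.

Definition alive (q m i : nat) (w : T) : R :=
  \prod_(m <= l < i.+1) (S (V1 q m l w, V2 q m l w, B q m l w))%:R.

Definition alive_set (q m i : nat) : set T :=
  [set w | forall l, (m <= l <= i)%N -> S (V1 q m l w, V2 q m l w, B q m l w)].

Lemma aliveS q m i w : (m <= i.+1)%N ->
  alive q m i.+1 w = alive q m i w * (S (V1 q m i.+1 w, V2 q m i.+1 w, B q m i.+1 w))%:R.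
Proof. by move=> mi; rewrite /alive big_nat_recr. Qed.

Lemma alive_indic q m i w : alive q m i w = \1_(alive_set q m i) w.
Proof.
rewrite indicE; case: (boolP (w \in _)) => [|/negP].
  rewrite inE => h; rewrite /alive big_nat big1// => l; rewrite ltnS => ml.
  by rewrite h.
rewrite inE /alive_set /= => /existsNP[l] /not_implyP[/andP[ml li]] /negP nS.
apply/eqP; rewrite prodf_seq_eq0; apply/hasP; exists l.
  by rewrite mem_index_iota ml ltnS.
by rewrite (negbTE nS) /= eqxx.
Qed.

Lemma alive01 q m i w : 0 <= alive q m i w <= 1.
Proof. by rewrite alive_indic indicE; case: (_ \in _); rewrite ?lexx ?ler01. Qed.

Lemma alive_cases q m i w : alive q m i w = 0 \/
  (alive q m i w = 1 /\ forall l, (m <= l <= i)%N -> S (V1 q m l w, V2 q m l w, B q m l w)).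
Proof.
rewrite alive_indic indicE; case: (boolP (w \in _)) => [|_]; last by left.
by rewrite inE; right.
Qed.

Lemma adapted_alive q m i : adapted (rect q m i) (alive q m i).
Proof.
rewrite (_ : alive q m i = (fun w => \prod_(m <= l < i.+1)
  (S (V1 q m l w, V2 q m l w, B q m l w))%:R)) //.
have h n : (n <= i.+1)%N -> adapted (rect q m i) (fun w => \prod_(m <= l < n)
    (S (V1 q m l w, V2 q m l w, B q m l w))%:R : R).
  elim: n => [|n ih] ni.
    rewrite (_ : (fun _ => _) = cst 1); first exact: measurable_cst.
    by apply/funext => w; rewrite big_geq.
  have [nm|mn] := ltnP n m.
    rewrite (_ : (fun _ => _) = cst 1); first exact: measurable_cst.
    by apply/funext => w; rewrite big_geq.
  rewrite (_ : (fun _ => _) = (fun w => (\prod_(m <= l < n)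
    (S (V1 q m l w, V2 q m l w, B q m l w))%:R) *
    (if S (V1 q m n w, V2 q m n w, B q m n w) then 1 else 0))); last first.
    by apply/funext => w; rewrite big_nat_recr//=; case: (S _).
  apply: measurable_funM; first by apply: ih; exact: ltnW.
  have ni' : (n <= i)%N by [].
  apply: (adapted_le (leqnn m) ni').
  apply: measurable_fun_ifT; [|exact: measurable_cst|exact: measurable_cst].
  exact: adapted_state.
exact: h.
Qed.

Lemma adapted_alive0 q m i : adapted (rect q 0 i) (alive q m i).
Proof. by apply: (adapted_le (leq0n m) (leqnn i)); exact: adapted_alive. Qed.

Lemma alive_set_sigma q m i : <<s rect q m i >> (alive_set q m i).
Proof.
have -> : alive_set q m i = alive q m i @^-1` [set 1].
  apply/seteqP; split => w /=; rewrite alive_indic indicE.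
    by move=> h; rewrite mem_set.
  by case: (boolP (w \in _)) => [|_ /eqP]; [rewrite inE|rewrite eq_sym oner_eq0].
by apply: adapted_preimage; [exact: adapted_alive|exact: measurable_set1].
Qed.

Lemma measurable_alive_set q m i : measurable (alive_set q m i).
Proof.
have h := @alive_set_sigma q m i; have h2 := @rect_measurable _ _ _ _ _ _ bm q m i.
exact: (sub_sigma_measurable h2 h).
Qed.

Lemma mean_alive q m i : mean (alive q m i) = fine (P (alive_set q m i)).
Proof.
rewrite -mean_indic; last exact: measurable_alive_set.
by apply: mean_ext => w; exact: alive_indic.
Qed.

Lemma all_moments_alive q m i : all_moments (alive q m i).
Proof.
apply: (@all_moments_bounded _ _ _ P _ 1).
  by apply: adapted_measurable (@adapted_alive q m i); exact: (rect_measurable bm).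
by move=> w; have /andP[h0 h1] := alive01 q m i w; rewrite ger0_norm.
Qed.
End region.

(** Fourth power of the homogeneous norm; working with it keeps all estimates polynomial. *)
Definition hq (x : R * R * R) : R := (x.1.1 ^+ 2 + x.1.2 ^+ 2) ^+ 2 + x.2 ^+ 2.

Lemma measurable_hq : measurable_fun setT hq.
Proof.
apply: measurable_funD; apply: measurable_funX; last exact: measurable_snd.
apply: measurable_funD; apply: measurable_funX;
  (apply: measurableT_comp; last exact: measurable_fst).
- exact: measurable_fst.
- exact: measurable_snd.
Qed.

Definition hball (x : R) (y : R * R * R) : bool := hq y <= x.

Lemma measurable_hball x : measurable_fun setT (hball x).
Proof. by apply: measurable_fun_ler => //; exact: measurable_hq. Qed.

(* Doob-type maximal inequality: the function [G] below is a supermartingale along the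
   Euler chain, and it is at least 1 outside of the ball. *)
Lemma euler_maximal (q m n : nat) (c : R) : 0 < c -> (m <= n)%N ->
  1 - (c ^+ 2 * ((n - m)%:R * step q) ^+ 2 / 4 + 2 * c * ((n - m)%:R * step q)) <=
  fine (P (alive_set (hball (2 / c ^+ 2)) q m n)).
Proof.
move=> c0 mn; set S := hball (2 / c ^+ 2).
have mS : measurable_fun setT S := measurable_hball (2 / c ^+ 2).
set h := step q; have h0 : 0 < h := step_gt0 q.
pose rem i := (n%:R - i%:R) * h.
(* The parts multiplied by [c ^+ 2] and c dominate the conditional means at time i of the final
   [B^2] and of the final [|V|^2]. Initially G equals the error term of the claim. *)
pose G i w := c ^+ 2 * (B q m i w ^+ 2 + 4^-1 * rem i * (V1 q m i w ^+ 2 + V2 q m i w ^+ 2)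
   + 4^-1 * rem i ^+ 2) + c * (V1 q m i w ^+ 2 + V2 q m i w ^+ 2 + 2 * rem i).
pose Y i := alive S q m i.
have mY i : all_moments (Y i) by exact: all_moments_alive.
have mG i : (m <= i)%N -> all_moments (G i).
  move=> mi; have m1 := all_moments_disp1 bm q mi; have m2 := all_moments_disp2 bm q mi.
  have m3 := all_moments_earea bm q m i.
  by rewrite /G; moments.
(* The mean of [Y G + 1 - Y] does not increase: when the chain is killed, a value of G that is at
   least 1 is exchanged for 1. *)
suff key i : (m <= i <= n)%N -> mean (fun w => Y i w * G i w) + 1 - mean (Y i) <=
    c ^+ 2 * (rem m) ^+ 2 / 4 + 2 * c * rem m.
  have mn' : (m <= n <= n)%N by rewrite mn leqnn.
  have := key n mn'; rewrite /Y mean_alive// -/S.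
  have -> : (n - m)%:R * h = rem m by rewrite natrB.
  have : 0 <= mean (fun w => alive S q m n w * G n w).
    apply: mean_ge0 => w; have /andP[a0 _] := alive01 S q m n w.
    rewrite mulr_ge0// /G /rem subrr mul0r expr0n /= !mulr0 !mul0r !addr0.
    by rewrite addr_ge0// mulr_ge0// ?sqr_ge0// ?addr_ge0 ?sqr_ge0// ltW.
  by lra.
move=> /andP[mi]; rewrite -(subnKC mi); elim: (i - m)%N => [|k ih].
  rewrite addn0 => _; have -> : mean (Y m) = 1.
    rewrite -[RHS](mean_cst P 1); apply: mean_ext => w.
    have e : hq (0, 0, 0) = 0 by rewrite /hq /=; ring.
    by rewrite /Y /alive big_nat1 disp0 disp0 earea0 /S /hball e divr_ge0// sqr_ge0.
  rewrite addrK.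
  rewrite (@le_trans _ _ (mean (cst (c ^+ 2 * (rem m) ^+ 2 / 4 + 2 * c * rem m))))//.
    2: by rewrite mean_cst.
  apply: mean_le; [by apply: all_momentsM => //; exact: mG|exact: all_moments_cst|].
  move=> w; have /andP[a0 a1] := alive01 S q m m w.
  rewrite /G /cst disp0 disp0 earea0 !expr0n /= !addr0 !mulr0 !add0r.
  have r0 : 0 <= rem m by apply: mulr_ge0; [rewrite subr_ge0 ler_nat|exact: ltW].
  have := mulr_ge0 (sqr_ge0 c) (sqr_ge0 (rem m)); have := mulr_ge0 (ltW c0) r0.
  by rewrite /Y; nra.
rewrite addnS => kn; have {}ih := ih (ltnW kn).
set j := (m + k)%N in kn ih *; have mj : (m <= j)%N by rewrite leq_addr.
apply: le_trans ih.
pose r' := rem j.+1; pose kk := c ^+ 2 * r' / 4 + c.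
have rE : rem j = r' + h by rewrite /r' /rem -[in RHS]addn1 natrD; ring.
have r'0 : 0 <= r' by apply: mulr_ge0; [rewrite subr_ge0 ler_nat|exact: ltW].
apply: (@le_trans _ _ (mean (fun w => Y j w * G j.+1 w) + 1 - mean (Y j))).
  have mj1 : (m <= j.+1)%N by exact: leqW.
  have mYG := all_momentsM (mY j.+1) (mG _ mj1).
  have mYG' := all_momentsM (mY j) (mG _ mj1).
  suff : mean (fun w => Y j.+1 w * G j.+1 w) - mean (Y j.+1) <=
         mean (fun w => Y j w * G j.+1 w) - mean (Y j) by lra.
  rewrite -(meanB mYG (mY j.+1)) -(meanB mYG' (mY j)).
  apply: mean_le; [exact: all_momentsB|exact: all_momentsB|].
  move=> w; rewrite /Y aliveS//.
  have /andP[a0 _] := alive01 S q m j w.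
  case Sw : (S _) => /=; rewrite ?mulr1// mulr0 mul0r subrr -{2}[alive _ _ _ _ w]mulr1 -mulrBr.
  rewrite mulr_ge0// subr_ge0.
  move: Sw; rewrite /S /hball /hq /= => /negbT; rewrite -ltNge => Sw.
  rewrite /G -/r'; set a := V1 q m j.+1 w ^+ 2 + V2 q m j.+1 w ^+ 2 in Sw *.
  have a_ge0 : 0 <= a by rewrite addr_ge0 ?sqr_ge0.
  set z := B q m j.+1 w in Sw *.
  have Sw' : 2 < (c * a) ^+ 2 + c ^+ 2 * z ^+ 2.
    by move: Sw; rewrite ltr_pdivrMr ?exprn_gt0// [_ * c ^+ 2]mulrDl exprMn [c ^+ 2 * a ^+ 2]mulrC [c ^+ 2 * z ^+ 2]mulrC.
  have e1 : 0 <= c ^+ 2 * (4^-1 * r' * a + 4^-1 * r' ^+ 2) + c * (2 * r').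
    have := mulr_ge0 (sqr_ge0 c) (mulr_ge0 r'0 a_ge0).
    have := mulr_ge0 (sqr_ge0 c) (sqr_ge0 r'); have := mulr_ge0 (ltW c0) r'0.
    lra.
  (* Outside the ball [(c a)^2 + c^2 z^2 > 2], so one of [c a] and [c^2 z^2] exceeds 1; this is
     where the radius [2 / c ^+ 2] comes from. *)
  suff : 1 <= c ^+ 2 * z ^+ 2 + c * a by lra.
  have ca : 0 <= c * a by rewrite mulr_ge0// ltW.
  have cz : 0 <= c ^+ 2 * z ^+ 2 by rewrite mulr_ge0 ?sqr_ge0.
  by nra.
rewrite lerD2r lerD2r.
have aY : adapted (rect q 0 j) (Y j) by exact: adapted_alive0.
have a1 : adapted (rect q 0 j) (V1 q m j).
  by apply: (adapted_le (leq0n m) (leqnn j)); exact: adapted_disp1.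
have a2 : adapted (rect q 0 j) (V2 q m j).
  by apply: (adapted_le (leq0n m) (leqnn j)); exact: adapted_disp2.
have a3 : adapted (rect q 0 j) (B q m j).
  by apply: (adapted_le (leq0n m) (leqnn j)); exact: adapted_earea.
have m1 := all_moments_disp1 bm q mj; have m2 := all_moments_disp2 bm q mj.
have m3 := all_moments_earea bm q m j.
pose U0 w := Y j w * (c ^+ 2 * B q m j w ^+ 2 + kk * (V1 q m j w ^+ 2 + V2 q m j w ^+ 2)
   + (c ^+ 2 * r' ^+ 2 / 4 + 2 * c * r')).
pose U1 w := Y j w * (- c ^+ 2 * (B q m j w * V2 q m j w) + 2 * kk * V1 q m j w).
pose U2 w := Y j w * (c ^+ 2 * (B q m j w * V1 q m j w) + 2 * kk * V2 q m j w).
pose U11 w := Y j w * (c ^+ 2 / 4 * V2 q m j w ^+ 2 + kk).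
pose U12 w := Y j w * (- (c ^+ 2 / 2) * (V1 q m j w * V2 q m j w)).
pose U22 w := Y j w * (c ^+ 2 / 4 * V1 q m j w ^+ 2 + kk).
rewrite (@mean_ext _ _ _ P _ (fun w => U0 w + U1 w * Z1 q j w + U2 w * Z2 q j w +
   U11 w * Z1 q j w ^+ 2 + U12 w * (Z1 q j w * Z2 q j w) + U22 w * Z2 q j w ^+ 2)); last first.
  move=> w; rewrite /G -/r' !dispS eareaS// /U0 /U1 /U2 /U11 /U12 /U22 /kk.
  by field.
have mYj := mY j.
rewrite step_mean_eq; [|by moments|by adapt|by moments|by adapt|by moments|by adapt|by moments
  |by adapt|by moments|by adapt|by moments].
apply: mean_le.
- by rewrite /U0 /U11 /U22; moments.
- by apply: all_momentsM => //; exact: mG.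
move=> w; have /andP[y0 _] := alive01 S q m j w.
rewrite /U0 /U11 /U22 /G rE -subr_ge0.
set u1 := V1 q m j w; set u2 := V2 q m j w; set u3 := B q m j w.
rewrite (_ : _ - _ = Y j w * (c ^+ 2 * h ^+ 2 / 4)); last by rewrite /kk -/h; field.
by rewrite mulr_ge0// divr_ge0// mulr_ge0// sqr_ge0.
Qed.

End killed_chain.

(** * The function J_0 (sqrt s) *)

Section bessel.
Context {R : realType}.

(* Coefficients of the [k]-th derivative of [s |-> J_0 (sqrt s)]. *)
Definition bcoef (k i : nat) : R :=
  (-1) ^+ (i + k) / (4 ^+ (i + k) * i`!%:R * (i + k)`!%:R).

Definition bessel (k : nat) (x : R) : R := limn (pseries (bcoef k) x).

Lemma factr_neq0 (i : nat) : i`!%:R != 0 :> R.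
Proof. by rewrite pnatr_eq0 -lt0n fact_gt0. Qed.

Lemma bcoef_diffs k : pseries_diffs (bcoef k) = bcoef k.+1.
Proof.
apply/funext => i; rewrite /pseries_diffs /bcoef addSn addnS factS natrM.
have : i.+1%:R != 0 :> R by rewrite pnatr_eq0.
move: (i.+1%:R : R) => a a0.
have := factr_neq0 i; move: (i`!%:R : R) => b b0.
have := factr_neq0 (i + k).+1; move: ((i + k).+1`!%:R : R) => c c0.
have : 4 ^+ (i + k).+1 != 0 :> R by rewrite expf_neq0.
move: (4 ^+ (i + k).+1 : R) ((-1) ^+ (i + k).+1 : R) => e f e0.
by field; rewrite a0 b0 c0 e0.
Qed.

Lemma bcoef_norm k i : `|bcoef k i| <= (i`!%:R)^-1.
Proof.
rewrite /bcoef normrM normrX normrN1 expr1n mul1r ger0_norm ?invr_ge0 ?mulr_ge0 ?exprn_ge0//.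
rewrite lef_pV2 ?posrE ?mulr_gt0 ?exprn_gt0 ?ltr0n ?fact_gt0//.
rewrite mulrAC ler_peMl// ?ler0n//.
rewrite mulr_ege1// ?exprn_ege1// ?ler1n ?fact_gt0//.
Qed.

Lemma bessel_cvg k x : cvgn (pseries (bcoef k) x).
Proof.
apply: normed_cvg; apply: series_le_cvg (is_cvg_series_exp_coeff `|x|) => i /=.
- by rewrite normr_ge0.
- by rewrite /exp_coeff mulr_ge0 ?invr_ge0 ?exprn_ge0.
- rewrite normrM normrX mulrC /exp_coeff ler_wpM2l ?exprn_ge0//.
  exact: bcoef_norm.
Qed.

Lemma bessel_derive k x : is_derive x (1 : R) (bessel k) (bessel k.+1 x).
Proof.
rewrite /bessel -bcoef_diffs; apply: (@pseries_snd_diffs _ _ (`|x| + 1)).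
- exact: bessel_cvg.
- by rewrite bcoef_diffs; exact: bessel_cvg.
- by rewrite !bcoef_diffs; exact: bessel_cvg.
- by rewrite [ltRHS]ger0_norm ?addr_ge0// ltrDl.
Qed.

Lemma bessel_continuous k : continuous (bessel k).
Proof.
move=> x; apply: differentiable_continuous; apply/derivable1_diffP.
by have [] := bessel_derive k x.
Qed.

Lemma bessel_norm k x : `|bessel k x| <= expR `|x|.
Proof.
have c := @bessel_cvg k x.
have c' : (fun n => `|pseries (bcoef k) x n|) @ \oo --> `|bessel k x| by exact: cvg_norm.
rewrite -(cvg_lim _ c')//; apply: limr_le; first exact: cvgP c'.
apply: nearW => n; rewrite /pseries /series /=.
apply: (le_trans (ler_norm_sum _ _ _)).
apply: (@le_trans _ _ (series (exp_coeff `|x|) n)).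
  rewrite /series /=; apply: ler_sum => i _.
  rewrite normrM normrX mulrC /exp_coeff ler_wpM2l ?exprn_ge0//.
  exact: bcoef_norm.
apply: nondecreasing_cvgn_le; last exact: is_cvg_series_exp_coeff.
by apply: nondecreasing_series => i _ _; rewrite /exp_coeff mulr_ge0 ?invr_ge0 ?exprn_ge0.
Qed.

(** Bessel's equation written in the variable s of [J_0 (sqrt s)]. It is exact between partial sums,
    provided the series for [bessel 0] and [bessel 1] are taken one term further than the one for
    [bessel 2]; the limit follows. *)
Lemma bessel_ode x : 4 * (x * bessel 2 x + bessel 1 x) = - bessel 0 x.
Proof.
have c0 : (fun n => pseries (bcoef 0) x n.+1) @ \oo --> bessel 0 x.
  by rewrite (cvg_shiftS (pseries (bcoef 0) x)); exact: bessel_cvg.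
have c1 : (fun n => pseries (bcoef 1) x n.+1) @ \oo --> bessel 1 x.
  by rewrite (cvg_shiftS (pseries (bcoef 1) x)); exact: bessel_cvg.
have c2 : pseries (bcoef 2) x @ \oo --> bessel 2 x by exact: bessel_cvg.
have c3 : (fun n => 4 * (x * pseries (bcoef 2) x n + pseries (bcoef 1) x n.+1)) @ \oo -->
    4 * (x * bessel 2 x + bessel 1 x).
  by apply: cvgMr; apply: cvgD => //; exact: cvgMr.
have c4 : (fun n => - pseries (bcoef 0) x n.+1) @ \oo --> - bessel 0 x by exact: cvgN.
suff e : (fun n => 4 * (x * pseries (bcoef 2) x n + pseries (bcoef 1) x n.+1)) =
    (fun n => - pseries (bcoef 0) x n.+1).
  by rewrite e in c3; exact: (cvg_unique _ c3 c4).
apply/funext => n; rewrite /pseries /series /=.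
elim: n => [|n ih].
  by rewrite big_geq// !big_nat1 /bcoef /= (_ : 0`! = 1)%N// (_ : 1`! = 1)%N//; field.
rewrite (@big_nat_recr _ _ _ n 0%N (fun k => bcoef 2 k * x ^+ k))//=.
rewrite (@big_nat_recr _ _ _ n.+1 0%N (fun k => bcoef 1 k * x ^+ k))//=.
rewrite (@big_nat_recr _ _ _ n.+1 0%N (fun k => bcoef 0 k * x ^+ k))//=.
move: ih; set s2 := \sum_(0 <= k < n) _; set s1 := \sum_(0 <= k < n.+1) _.
set s0 := \sum_(0 <= k < n.+1) _ => ih.
suff e : 4 * (x * (bcoef 2 n * x ^+ n) + bcoef 1 n.+1 * x ^+ n.+1) = - (bcoef 0 n.+1 * x ^+ n.+1).
  by rewrite opprD -ih -e; ring.
rewrite /bcoef addn0 addn1 addn2 !factS !natrM.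
have e2 : n.+2%:R = n.+1%:R + 1 :> R by rewrite natr1.
have : n.+2%:R != 0 :> R by rewrite pnatr_eq0.
rewrite e2.
have : n.+1%:R != 0 :> R by rewrite pnatr_eq0.
move: (n.+1%:R : R) => a a0 a1.
have := factr_neq0 n; move: (n`!%:R : R) => b b0.
rewrite !exprS.
have : 4 ^+ n != 0 :> R by rewrite expf_neq0.
move: (4 ^+ n : R) ((-1) ^+ n : R) (x ^+ n) => e f y e0.
by field; rewrite a0 b0 a1 e0.
Qed.

Lemma bessel0 : bessel 0 0 = 1.
Proof.
rewrite /bessel; apply/cvg_lim => //; rewrite -(cvg_shiftS (pseries (bcoef 0) 0)).
rewrite (_ : (fun n => _) = cst 1); first exact: cvg_cst.
apply/funext => n; rewrite /pseries /series /= big_nat_recl//= big1 ?addr0.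
  by rewrite /bcoef /= (_ : 0`! = 1)%N//; field.
by move=> i _; rewrite exprS mul0r mulr0.
Qed.

(** The series at 8 has terms [(-2)^i / i!^2]. Its first five terms add up to about -0.19, and the
    others are dominated by a geometric series with sum 1/50. The point 8 merely has to lie beyond
    the first zero, about 5.78. *)
Lemma bessel_neg : bessel 0 8 < 0.
Proof.
have t j : `|bcoef 0 (j + 5) * 8 ^+ (j + 5)| <= (1 / 100) * 2^-1 ^+ j.
  have tE i : `|bcoef 0 i * 8 ^+ i| = 2 ^+ i / i`!%:R ^+ 2.
    rewrite /bcoef addn0 !normrM normrX normrN1 expr1n mul1r normfV !normrM !normrX !normr_nat.
    have -> : (8 : R) ^+ i = 4 ^+ i * 2 ^+ i by rewrite -exprMn; congr (_ ^+ _); ring.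
    by field; rewrite factr_neq0 expf_neq0.
  rewrite tE; elim: j => [|j ih].
    rewrite add0n expr0 (_ : 5`! = 120)%N//; lra.
  rewrite addSn exprS factS natrM exprMn invfM [2^-1 ^+ _]exprS.
  have -> : 2 * 2 ^+ (j + 5) * ((j + 5).+1%:R ^- 2 / (j + 5)`!%:R ^+ 2) =
    (2 * (j + 5).+1%:R ^- 2) * (2 ^+ (j + 5) / (j + 5)`!%:R ^+ 2) :> R by ring.
  rewrite [leRHS]mulrCA; apply: ler_pM => //; rewrite ?divr_ge0 ?exprn_ge0//.
  rewrite ler_pdivrMr ?exprn_gt0// mulrC ler_pdivlMr// -natrX -!natrM ler_nat.
  by rewrite (@leq_trans (6 ^ 2))// leq_sqr ltnS leq_addl.
have s5 : pseries (bcoef 0) 8 5 <= - (1 / 10).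
  rewrite /pseries /series /= !big_nat_recr//= big_geq// /bcoef /=.
  by rewrite (_ : 0`! = 1)%N// (_ : 1`! = 1)%N// (_ : 2`! = 2)%N// (_ : 3`! = 6)%N// (_ : 4`! = 24)%N//; lra.
have sn (n : nat) : pseries (bcoef 0) 8 (n + 5)%N <= - (1 / 10) + (1 / 100) * (2 - 2 * 2^-1 ^+ n).
  elim: n => [|n ih]; first by rewrite add0n expr0; lra.
  rewrite addSn /pseries /series /= big_nat_recr//=.
  have := ler_norm (bcoef 0 (n + 5) * 8 ^+ (n + 5)); have := t n.
  move: ih; rewrite /pseries /series /= exprS.
  by set X := \sum_(_ <= _ < _) _; set e := 2^-1 ^+ n; set Y := bcoef _ _ * _; lra.
have c : pseries (bcoef 0) 8 @ \oo --> bessel 0 8 by exact: bessel_cvg.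
suff : bessel 0 8 <= - (1 / 20) by lra.
rewrite -(cvg_lim _ c)//; apply: limr_le; first exact: cvgP c.
near=> n; have -> : n = (n - 5 + 5)%N by rewrite subnK//; near: n; exact: nbhs_infty_ge.
apply: (le_trans (sn _)).
by have : 0 <= 2^-1 ^+ (n - 5) :> R by [rewrite exprn_ge0]; lra.
Unshelve. all: by end_near. Qed.

(** The point is the square of the first positive zero of J_0. Taking the infimum of the set where
    the function is at most 0 yields positivity before it for free; continuity and the value 1 at
    the origin do the rest. *)
Lemma first_zero : exists s : R, [/\ 0 < s, bessel 0 s = 0 &
  forall x, 0 <= x -> x < s -> 0 < bessel 0 x].
Proof.
pose Zs := [set x : R | 0 <= x /\ bessel 0 x <= 0].
have Z8 : Zs 8 by split; [lra|exact: ltW bessel_neg].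
have lbZ : has_lbound Zs by exists 0 => x [].
have infZ : has_inf Zs by split => //; exists 8.
pose s := inf Zs.
have s0 : 0 <= s by apply: lb_le_inf; [exists 8|move=> x []].
have pos x : 0 <= x -> x < s -> 0 < bessel 0 x.
  move=> x0 xs; rewrite ltNge; apply/negP => h.
  by have := ge_inf lbZ (conj x0 h : Zs x); rewrite leNgt xs.
have cont (x e : R) : 0 < e -> exists2 dl : R, 0 < dl & forall y, `|x - y| < dl -> `|bessel 0 x - bessel 0 y| < e.
  move=> e0; have /cvgrPdist_lt/(_ e e0) := @bessel_continuous 0 x.
  by move=> /nbhs_ballP[dl /= dl0 h]; exists dl => // y xy; apply: h.
have le0 : bessel 0 s <= 0.
  rewrite leNgt; apply/negP => h; have [dl dl0 hd] := cont s _ h.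
  have [x Zx xs] := inf_adherent dl0 infZ.
  have sx : s <= x by apply: ge_inf.
  have : `|s - x| < dl by rewrite distrC ger0_norm ?subr_ge0// ltrBlDl.
  by move=> /hd; case: Zx => _ x0; rewrite ltr_norml; lra.
have sn0 : s != 0.
  by apply/eqP => e; move: le0; rewrite e bessel0; lra.
have sgt0 : 0 < s by rewrite lt_neqAle eq_sym sn0.
exists s; split => //; apply/eqP; rewrite eq_le le0 /= leNgt; apply/negP => h.
have nh : 0 < - bessel 0 s by lra.
have [dl dl0 hd] := cont s _ nh.
pose y := s - Num.min (s / 2) (dl / 2).
have m0 : 0 < Num.min (s / 2) (dl / 2) by rewrite lt_min !divr_gt0.
have y0 : 0 <= y by rewrite /y subr_ge0 ge_min; apply/orP; left; lra.
have ys : y < s by rewrite /y; lra.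
have : `|s - y| < dl.
  rewrite /y opprB addrC subrK gtr0_norm//.
  by rewrite gt_min; apply/orP; right; lra.
by move=> /hd; have := pos y y0 ys; rewrite ltr_norml; lra.
Qed.

End bessel.

(** * Second order expansion of the ground states *)

Section taylor.
Context {R : realType}.

Lemma mvt_ineq (f f' : R -> R) (x y B : R) :
  (forall u, is_derive u (1 : R) f (f' u)) ->
  (forall u, `|u - x| <= `|y - x| -> `|f' u| <= B) ->
  `|f y - f x| <= B * `|y - x|.
Proof.
move=> df hB.
have cont (a b : R) : {within `[a, b], continuous f}.
  apply: continuous_subspaceT => u; apply: differentiable_continuous.
  by apply/derivable1_diffP; have [] := df u.
have [xy|yx] := leP x y.
  have [c] := MVT_segment xy (fun u _ => df u) (cont x y).
  rewrite in_itv /= => /andP[xc cy] ->; rewrite normrM ler_wpM2r// hB//.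
  by rewrite !ger0_norm ?subr_ge0// lerB.
have [c] := MVT_segment (ltW yx) (fun u _ => df u) (cont y x).
rewrite in_itv /= => /andP[yc cx] e; rewrite distrC e normrM [`|x - y|]distrC ler_wpM2r// hB//.
by rewrite !ler0_norm ?subr_le0// ?opprB ?lerB// ltW.
Qed.

(** The mean value inequality is used three times: for f2, for f1 minus its tangent, and for f minus
    its quadratic part. Hence the constant K in place of K / 6. *)
Lemma taylor2 (f f1 f2 f3 : R -> R) (x y K : R) :
  (forall u, is_derive u (1 : R) f (f1 u)) ->
  (forall u, is_derive u (1 : R) f1 (f2 u)) ->
  (forall u, is_derive u (1 : R) f2 (f3 u)) ->
  (forall u, `|u - x| <= `|y - x| -> `|f3 u| <= K) ->
  `|f y - f x - f1 x * (y - x) - 2^-1 * f2 x * (y - x) ^+ 2| <= K * `|y - x| ^+ 3.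
Proof.
move=> d1 d2 d3 hK; set D := `|y - x|.
have D0 : 0 <= D by exact: normr_ge0.
have K0 : 0 <= K by apply: le_trans (hK x _); rewrite ?subrr ?normr0.
have b2 u : `|u - x| <= D -> `|f2 u - f2 x| <= K * D.
  move=> uD; apply: (@le_trans _ _ (K * `|u - x|)); last by rewrite ler_wpM2l.
  by apply: mvt_ineq d3 _ => t tu; apply: hK; exact: le_trans uD.
pose g u := f1 u - f2 x * u.
have dg u : is_derive u (1 : R) g (f2 u - f2 x).
  by apply: is_derive_eq; rewrite /GRing.scale /= mulr1; ring.
have b1 u : `|u - x| <= D -> `|g u - g x| <= K * D ^+ 2.
  move=> uD; apply: (@le_trans _ _ (K * D * `|u - x|)).
    by apply: mvt_ineq dg _ => t tu; apply: b2; exact: le_trans uD.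
  by rewrite expr2 mulrA ler_wpM2l// mulr_ge0.
pose r u := f u - f1 x * u - 2^-1 * f2 x * (u - x) ^+ 2.
have dr u : is_derive u (1 : R) r (g u - g x).
  apply: is_derive_eq.
  by rewrite /g /GRing.scale /= mulr1 subr0; field.
have := mvt_ineq dr b1; rewrite -/D [in X in _ <= X]exprS.
rewrite (_ : r y - r x = f y - f x - f1 x * (y - x) - 2^-1 * f2 x * (y - x) ^+ 2).
  by move=> h; apply: (le_trans h); rewrite le_eqVlt; apply/orP; left; apply/eqP; ring.
by rewrite /r; ring.
Qed.
End taylor.

(** * Orders of magnitude, uniform over a domain *)

Section bounded_order.
Context {R : realType} {I : Type}.
Variables (dom : I -> Prop) (r : I -> R).
Hypothesis r01 : forall i, dom i -> 0 <= r i <= 1.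

(** A Landau symbol over a set of parameters instead of a filter, since the constant must be the
    same for all states of the chain. The assumption r <= 1 makes it possible to lower the order. *)
Definition bO (k : nat) (f : I -> R) :=
  exists2 C : R, 0 <= C & forall i, dom i -> `|f i| <= C * r i ^+ k.

Lemma bOD k f g : bO k f -> bO k g -> bO k (fun i => f i + g i).
Proof.
move=> [C C0 hC] [D D0 hD]; exists (C + D); first exact: addr_ge0.
move=> i di; rewrite mulrDl; apply: (le_trans (ler_normD _ _)).
by apply: lerD; [exact: hC|exact: hD].
Qed.

Lemma bON k f : bO k f -> bO k (fun i => - f i).
Proof. by move=> [C C0 hC]; exists C => // i di; rewrite normrN; exact: hC. Qed.

Lemma bOB k f g : bO k f -> bO k g -> bO k (fun i => f i - g i).
Proof. by move=> hf hg; apply: bOD => //; exact: bON. Qed.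

Lemma bOM k j f g : bO k f -> bO j g -> bO (k + j) (fun i => f i * g i).
Proof.
move=> [C C0 hC] [D D0 hD]; exists (C * D); first exact: mulr_ge0.
move=> i di; rewrite normrM exprD mulrACA.
by apply: ler_pM => //; [exact: hC|exact: hD].
Qed.

Lemma bOZ k (c : R) f : bO k f -> bO k (fun i => c * f i).
Proof.
move=> [C C0 hC]; exists (`|c| * C); first exact: mulr_ge0.
by move=> i di; rewrite normrM -mulrA ler_wpM2l//; exact: hC.
Qed.

Lemma bOW k j f : (j <= k)%N -> bO k f -> bO j f.
Proof.
move=> jk [C C0 hC]; exists C => // i di; apply: (le_trans (hC i di)).
have /andP[r0 r1] := r01 di.
by rewrite ler_wpM2l// -(subnKC jk) exprD ler_piMr ?exprn_ge0// exprn_ile1.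
Qed.

Lemma bO_bounded (B : R) f : (forall i, dom i -> `|f i| <= B) -> bO 0 f.
Proof.
move=> hB; exists `|B| => // i di; rewrite expr0 mulr1.
by rewrite (le_trans (hB i di))// ler_norm.
Qed.

Lemma bO_cst (c : R) : bO 0 (fun=> c).
Proof. exact: (@bO_bounded `|c|). Qed.
End bounded_order.

(** * Expansion of the product ground state along one step *)

Section step_expansion.
Context {R : realType}.
Variables (kap l M : R).
Hypothesis kap0 : 0 <= kap.

Local Notation nv2 x := (x.1.1 ^+ 2 + x.1.2 ^+ 2).

(** Separated product of the ground states of a disk and of an interval. For l = 0 only the radial
    factor is left, which is the case used for disks. *)
Definition bF (x : R * R * R) : R := bessel 0 (kap * nv2 x) * cos (l * x.2).

(* Coefficients of the second order expansion of [bF] along the horizontal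
   displacement [(a, b, (v1 b - v2 a) / 2)]. *)
Definition cL1 (x : R * R * R) : R :=
  2 * kap * x.1.1 * bessel 1 (kap * nv2 x) * cos (l * x.2)
  + 2^-1 * l * x.1.2 * bessel 0 (kap * nv2 x) * sin (l * x.2).
Definition cL2 (x : R * R * R) : R :=
  2 * kap * x.1.2 * bessel 1 (kap * nv2 x) * cos (l * x.2)
  - 2^-1 * l * x.1.1 * bessel 0 (kap * nv2 x) * sin (l * x.2).
Definition cQ11 (x : R * R * R) : R :=
  kap * bessel 1 (kap * nv2 x) * cos (l * x.2)
  + 2 * kap ^+ 2 * x.1.1 ^+ 2 * bessel 2 (kap * nv2 x) * cos (l * x.2)
  + kap * l * x.1.1 * x.1.2 * bessel 1 (kap * nv2 x) * sin (l * x.2)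
  - 8^-1 * l ^+ 2 * x.1.2 ^+ 2 * bessel 0 (kap * nv2 x) * cos (l * x.2).
Definition cQ22 (x : R * R * R) : R :=
  kap * bessel 1 (kap * nv2 x) * cos (l * x.2)
  + 2 * kap ^+ 2 * x.1.2 ^+ 2 * bessel 2 (kap * nv2 x) * cos (l * x.2)
  - kap * l * x.1.1 * x.1.2 * bessel 1 (kap * nv2 x) * sin (l * x.2)
  - 8^-1 * l ^+ 2 * x.1.1 ^+ 2 * bessel 0 (kap * nv2 x) * cos (l * x.2).
Definition cQ12 (x : R * R * R) : R :=
  4 * kap ^+ 2 * x.1.1 * x.1.2 * bessel 2 (kap * nv2 x) * cos (l * x.2)
  - kap * l * (x.1.1 ^+ 2 - x.1.2 ^+ 2) * bessel 1 (kap * nv2 x) * sin (l * x.2)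
  + 4^-1 * l ^+ 2 * x.1.1 * x.1.2 * bessel 0 (kap * nv2 x) * cos (l * x.2).

Definition bT (x : R * R * R) (a b : R) : R :=
  bF x + cL1 x * a + cL2 x * b + cQ11 x * a ^+ 2 + cQ12 x * (a * b) + cQ22 x * b ^+ 2.

(** Right multiplication by the horizontal element (a, b, 0) of the Heisenberg group, that is one
    step of the Euler chain. *)
Definition hstep (x : R * R * R) (a b : R) : R * R * R :=
  (x.1.1 + a, x.1.2 + b, x.2 + 2^-1 * (x.1.1 * b - x.1.2 * a)).

(* Half the sub-Laplacian of [bF]; the Bessel equation makes it a multiple of [bF]. *)
Lemma trace_eq x : cQ11 x + cQ22 x = - (kap / 2 + l ^+ 2 * nv2 x / 8) * bF x.
Proof.
have := bessel_ode (kap * nv2 x); rewrite /cQ11 /cQ22 /bF.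
set g0 := bessel 0 _; set g1 := bessel 1 _; set g2 := bessel 2 _ => e.
have -> : g0 = - (4 * (kap * nv2 x * g2 + g1)) by rewrite e opprK.
by field.
Qed.

(** An index consists of a state and a displacement. The vertical coordinate is left unbounded by
    [dom]: it enters only through sine and cosine. *)
Let I : Type := ((R * R * R) * (R * R))%type.
Let dom (i : I) : Prop := nv2 i.1 <= M /\ i.2.1 ^+ 2 + i.2.2 ^+ 2 <= 1.
Let r (i : I) : R := Num.sqrt (i.2.1 ^+ 2 + i.2.2 ^+ 2).

Let r01 i : dom i -> 0 <= r i <= 1.
Proof. by move=> [_ h]; rewrite sqrtr_ge0 /= -[leRHS]sqrtr1 ler_wsqrtr. Qed.

Let bO := (@bO R I dom r).

Let abs_le (a b c : R) : a ^+ 2 + b ^+ 2 <= c -> `|a| <= Num.sqrt c.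
Proof.
by move=> h; rewrite -sqrtr_sqr ler_wsqrtr// (le_trans _ h)// lerDl sqr_ge0.
Qed.

Let bOa : bO 1 (fun i => i.2.1).
Proof. by exists 1 => // i _; rewrite mul1r expr1; exact: abs_le. Qed.
Let bOb : bO 1 (fun i => i.2.2).
Proof. by exists 1 => // i _; rewrite mul1r expr1; apply: (@abs_le _ i.2.1); rewrite addrC. Qed.
Let bOv1 : bO 0 (fun i => i.1.1.1).
Proof. by apply: (@bO_bounded _ _ _ _ (Num.sqrt M)) => i [h _]; exact: abs_le h. Qed.
Let bOv2 : bO 0 (fun i => i.1.1.2).
Proof.
apply: (@bO_bounded _ _ _ _ (Num.sqrt M)) => i [h _].
by apply: (@abs_le _ i.1.1.1); rewrite addrC.
Qed.

Let bOg k : bO 0 (fun i => bessel k (kap * nv2 i.1)).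
Proof.
apply: (@bO_bounded _ _ _ _ (expR (kap * M))) => i [h _].
apply: (le_trans (bessel_norm _ _)); rewrite ler_expR ger0_norm; first by rewrite ler_wpM2l.
by rewrite mulr_ge0// addr_ge0// sqr_ge0.
Qed.
Let bOc : bO 0 (fun i => cos (l * i.1.2)).
Proof. by apply: (@bO_bounded _ _ _ _ 1) => i _; exact: cos_max. Qed.
Let bOs : bO 0 (fun i => sin (l * i.1.2)).
Proof. by apply: (@bO_bounded _ _ _ _ 1) => i _; exact: sin_max. Qed.

(** [De] and [de] are the increments of the arguments [kap |v|^2] and [l z] during a step; [De1] and
    [De2] are the parts of [De] of order one and two. *)
Let De1 (i : I) := kap * (2 * (i.1.1.1 * i.2.1 + i.1.1.2 * i.2.2)).
Let De2 (i : I) := kap * (i.2.1 ^+ 2 + i.2.2 ^+ 2).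
Let De (i : I) := De1 i + De2 i.
Let de (i : I) := l * (2^-1 * (i.1.1.1 * i.2.2 - i.1.1.2 * i.2.1)).

Let bODe1 : bO 1 De1.
Proof.
apply: bOZ; apply: bOZ; apply: bOD; [exact: (bOM bOv1 bOa)|exact: (bOM bOv2 bOb)].
Qed.
Let bODe2 : bO 2 De2.
Proof. apply: bOZ; apply: bOD; [exact: (bOM bOa bOa)|exact: (bOM bOb bOb)]. Qed.
Let bODe : bO 1 De.
Proof. by apply: bOD => //; exact: (bOW r01 _ bODe2). Qed.
Let bOde : bO 1 de.
Proof.
apply: bOZ; apply: bOZ; apply: bOB; [exact: (bOM bOv1 bOb)|exact: (bOM bOv2 bOa)].
Qed.

Let R1 (i : I) := bessel 0 (kap * nv2 i.1 + De i) - bessel 0 (kap * nv2 i.1)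
  - bessel 1 (kap * nv2 i.1) * De i - 2^-1 * bessel 2 (kap * nv2 i.1) * De i ^+ 2.
Let R2 (i : I) := cos (l * i.1.2 + de i) - cos (l * i.1.2)
  - (- sin (l * i.1.2)) * de i - 2^-1 * (- cos (l * i.1.2)) * de i ^+ 2.

Let bOR1 : bO 3 R1.
Proof.
have [C C0 hC] := bODe.
exists (expR (kap * M + C) * C ^+ 3).
  by rewrite mulr_ge0 ?expR_ge0 ?exprn_ge0.
move=> i di; have := hC i di; rewrite expr1 => hD.
have /andP[ri0 ri1] := r01 di.
have DC : `|De i| <= C by apply: (le_trans hD); rewrite ler_piMr.
set s := kap * nv2 i.1.
have s0 : 0 <= s by rewrite mulr_ge0// addr_ge0// sqr_ge0.
have sM : s <= kap * M by rewrite ler_wpM2l//; case: di.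
have := @taylor2 _ (bessel 0) (bessel 1) (bessel 2) (bessel 3) s (s + De i) (expR (kap * M + C))
  (bessel_derive 0) (bessel_derive 1) (bessel_derive 2).
rewrite [s + De i]addrC addrK => h; rewrite /R1 -/s [s + De i]addrC; apply: (le_trans (h _)).
  move=> u uD; apply: (le_trans (bessel_norm _ _)); rewrite ler_expR.
  have -> : u = s + (u - s) by ring.
  apply: (le_trans (ler_normD _ _)); rewrite (ger0_norm s0).
  by apply: lerD => //; exact: le_trans DC.
by rewrite -mulrA ler_wpM2l ?expR_ge0// -exprMn lerXn2r ?nnegrE ?mulr_ge0.
Qed.

Let bOR2 : bO 3 R2.
Proof.
have [C C0 hC] := bOde.
exists (C ^+ 3); first by rewrite exprn_ge0.
move=> i di; have := hC i di; rewrite expr1 => hD.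
have /andP[ri0 ri1] := r01 di.
set y := l * i.1.2.
have dc u : is_derive u (1 : R) cos (- sin u) by exact: is_derive_cos.
have ds u : is_derive u (1 : R) (fun t => - sin t) (- cos u).
  by apply: is_derive_eq; rewrite /GRing.scale /= ?mulr1.
have dc' u : is_derive u (1 : R) (fun t => - cos t) (sin u).
  by apply: is_derive_eq; rewrite ?opprK.
have := @taylor2 _ cos (fun t => - sin t) (fun t => - cos t) sin y (y + de i) 1 dc ds dc'.
rewrite [y + de i]addrC addrK => h; rewrite /R2 -/y [y + de i]addrC; apply: (le_trans (h _)).
  by move=> u _; exact: sin_max.
by rewrite mul1r -exprMn lerXn2r ?nnegrE ?mulr_ge0.
Qed.

Lemma step_expansion : exists2 C : R, 0 <= C &
  forall x a b, nv2 x <= M -> a ^+ 2 + b ^+ 2 <= 1 ->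
  `|bF (hstep x a b) - bT x a b| <= C * Num.sqrt (a ^+ 2 + b ^+ 2) ^+ 3.
Proof.
pose g k (i : I) := bessel k (kap * nv2 i.1).
pose c (i : I) := cos (l * i.1.2); pose s (i : I) := sin (l * i.1.2).
have bOc' : bO 0 (fun i => cos (l * i.1.2 + de i)).
  by apply: (@bO_bounded _ _ _ _ 1) => i _; exact: cos_max.
suff [C C0 hC] : bO 3 (fun i => bF (hstep i.1 i.2.1 i.2.2) - bT i.1 i.2.1 i.2.2).
  by exists C => // x a b xM ab; have := hC (x, (a, b)) (conj xM ab).
have e1 : bO (3 + 0) (fun i => R1 i * cos (l * i.1.2 + de i)) by exact: bOM.
have e20 : bO 0 (fun i => g 0%N i + g 1%N i * De i + 2^-1 * (g 2%N i * (De i * De i))).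
  apply: bOD; first apply: bOD; first exact: bOg.
    by apply: (@bOW _ _ _ _ r01 (0 + 1) 0) => //; apply: bOM => //; exact: bOg.
  by apply: bOZ; apply: (@bOW _ _ _ _ r01 (0 + (1 + 1)) 0) => //; apply: bOM; [exact: bOg|exact: bOM].
have e2 : bO (0 + 3) (fun i => (g 0%N i + g 1%N i * De i + 2^-1 * (g 2%N i * (De i * De i))) * R2 i).
  exact: bOM.
have bg k : bO 0 (g k) by exact: bOg.
have bc : bO 0 c by exact: bOc.
have bs : bO 0 s by exact: bOs.
have e3 : bO (0 + 0 + 3) (fun i => g 2%N i * c i * (2 * (De1 i * De2 i) + De2 i * De2 i)).
  have e31 : bO 3 (fun i => 2 * (De1 i * De2 i) + De2 i * De2 i).
    apply: bOD; first by apply: bOZ; exact: (bOM bODe1 bODe2).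
    exact: (bOW r01 _ (bOM bODe2 bODe2)).
  exact: (bOM (bOM (bg 2%N) bc) e31).
have e4 : bO (0 + 0 + (2 + 1)) (fun i => g 1%N i * s i * (De2 i * de i)).
  exact: (bOM (bOM (bg 1%N) bs) (bOM bODe2 bOde)).
have e5 : bO (0 + 0 + (1 + (1 + 1))) (fun i => g 1%N i * c i * (De i * (de i * de i))).
  exact: (bOM (bOM (bg 1%N) bc) (bOM bODe (bOM bOde bOde))).
have e6 : bO (0 + 0 + ((1 + 1) + 1)) (fun i => g 2%N i * s i * (De i * De i * de i)).
  exact: (bOM (bOM (bg 2%N) bs) (bOM (bOM bODe bODe) bOde)).
have e7 : bO 3 (fun i => g 2%N i * c i * (De i * De i * (de i * de i))).
  exact: (bOW r01 _ (bOM (bOM (bg 2%N) bc) (bOM (bOM bODe bODe) (bOM bOde bOde)))).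
(* Once the two Taylor polynomials are multiplied and the terms of order at most two are removed as
   [bT], what is left is the two remainders and products of total order at least three. *)
have E i : bF (hstep i.1 i.2.1 i.2.2) - bT i.1 i.2.1 i.2.2 =
   R1 i * cos (l * i.1.2 + de i)
   + (g 0%N i + g 1%N i * De i + 2^-1 * (g 2%N i * (De i * De i))) * R2 i
   + 2^-1 * (g 2%N i * c i * (2 * (De1 i * De2 i) + De2 i * De2 i))
   - g 1%N i * s i * (De2 i * de i)
   - 2^-1 * (g 1%N i * c i * (De i * (de i * de i)))
   - 2^-1 * (g 2%N i * s i * (De i * De i * de i))
   - 4^-1 * (g 2%N i * c i * (De i * De i * (de i * de i))).
  have h1 : bF (hstep i.1 i.2.1 i.2.2) = bessel 0 (kap * nv2 i.1 + De i) * cos (l * i.1.2 + de i).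
    by rewrite /bF /hstep /=; congr (bessel 0 _ * cos _); rewrite /De /De1 /De2 /de; ring.
  rewrite h1.
  have -> : bessel 0 (kap * nv2 i.1 + De i) = R1 i + (g 0%N i + g 1%N i * De i + 2^-1 * (g 2%N i * (De i * De i))).
    by rewrite /R1 /g; ring.
  rewrite mulrDl -!addrA; congr (_ + _).
  have -> : cos (l * i.1.2 + de i) = R2 i + (c i - s i * de i - 2^-1 * (c i * (de i * de i))).
    by rewrite /R2 /c /s; ring.
  rewrite mulrDr -!addrA; congr (_ + _).
  rewrite /bT /bF /cL1 /cL2 /cQ11 /cQ12 /cQ22 -/(g 0%N i) -/(g 1%N i) -/(g 2%N i) -/(c i) -/(s i).
  by rewrite /De /De1 /De2 /de; field.
have : bO 3 (fun i => R1 i * cos (l * i.1.2 + de i)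
   + (g 0%N i + g 1%N i * De i + 2^-1 * (g 2%N i * (De i * De i))) * R2 i
   + 2^-1 * (g 2%N i * c i * (2 * (De1 i * De2 i) + De2 i * De2 i))
   - g 1%N i * s i * (De2 i * de i)
   - 2^-1 * (g 1%N i * c i * (De i * (de i * de i)))
   - 2^-1 * (g 2%N i * s i * (De i * De i * de i))
   - 4^-1 * (g 2%N i * c i * (De i * De i * (de i * de i)))).
  apply: bOB; last by apply: bOZ; exact: e7.
  apply: bOB; last by apply: bOZ; exact: e6.
  apply: bOB; last by apply: bOZ; exact: e5.
  apply: bOB; last exact: e4.
  apply: bOD; last by apply: bOZ; exact: e3.
  by apply: bOD; [exact: e1|exact: e2].
by move=> [C C0 hC]; exists C => // i di; rewrite E; exact: hC.
Qed.

Let mul0 f g : bO 0 f -> bO 0 g -> bO 0 (fun i => f i * g i).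
Proof. by move=> hf hg; exact: (bOM hf hg). Qed.
Let cc0 (k : R) : bO 0 (fun=> k). Proof. exact: bO_cst. Qed.
Let sq0 f : bO 0 f -> bO 0 (fun i => f i ^+ 2).
Proof. by move=> hf; exact: (bOM hf hf). Qed.

Ltac bo := repeat first [exact: cc0 | exact: bOv1 | exact: bOv2 | exact: bOg | exact: bOc
  | exact: bOs | apply: bOB | apply: bOD | apply: sq0 | apply: mul0].

Lemma coef_bounded : exists2 K : R, 0 <= K & forall x, nv2 x <= M ->
  [/\ `|bF x| <= K, `|cL1 x| <= K, `|cL2 x| <= K & [/\ `|cQ11 x| <= K, `|cQ12 x| <= K & `|cQ22 x| <= K]].
Proof.
have pk (f : R * R * R -> R) : bO 0 (fun i => f i.1) -> exists2 K : R, 0 <= K &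
    forall x, nv2 x <= M -> `|f x| <= K.
  move=> [K K0 hK]; exists K => // x xM.
  by have := hK (x, (0, 0)); rewrite expr0 mulr1; apply; split => //=; rewrite !expr0n addr0.
have [K1 K10 h1] : exists2 K : R, 0 <= K & forall x, nv2 x <= M -> `|bF x| <= K.
  by apply: pk; rewrite /bF; bo.
have [K2 K20 h2] : exists2 K : R, 0 <= K & forall x, nv2 x <= M -> `|cL1 x| <= K.
  by apply: pk; rewrite /cL1; bo.
have [K3 K30 h3] : exists2 K : R, 0 <= K & forall x, nv2 x <= M -> `|cL2 x| <= K.
  by apply: pk; rewrite /cL2; bo.
have [K4 K40 h4] : exists2 K : R, 0 <= K & forall x, nv2 x <= M -> `|cQ11 x| <= K.
  by apply: pk; rewrite /cQ11; bo.
have [K5 K50 h5] : exists2 K : R, 0 <= K & forall x, nv2 x <= M -> `|cQ12 x| <= K.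
  by apply: pk; rewrite /cQ12; bo.
have [K6 K60 h6] : exists2 K : R, 0 <= K & forall x, nv2 x <= M -> `|cQ22 x| <= K.
  by apply: pk; rewrite /cQ22; bo.
exists (K1 + K2 + K3 + K4 + K5 + K6); first by rewrite !addr_ge0.
move=> x xM; have := h1 x xM; have := h2 x xM; have := h3 x xM.
have := h4 x xM; have := h5 x xM; have := h6 x xM.
by split; [lra|lra|lra|split; lra].
Qed.
End step_expansion.

(** * One-step inequalities for the cut-off ground states *)

Section step_inequalities.
Context {R : realType}.
Local Notation nv2 x := (x.1.1 ^+ 2 + x.1.2 ^+ 2).

(** The difference of the two sides is a square. A cubic error alone would call for a third absolute
    moment; in this form it costs [2 eta h] and a fourth moment of order [h^2], h being the step. *)
Lemma cubic_absorb (C eta n : R) : 0 < eta -> 0 <= n ->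
  C * Num.sqrt n ^+ 3 <= eta * n + C ^+ 2 / (4 * eta) * n ^+ 2.
Proof.
move=> e0 n0; set r := Num.sqrt n.
have rn : n = r ^+ 2 by rewrite sqr_sqrtr.
rewrite rn -subr_ge0.
have -> : eta * r ^+ 2 + C ^+ 2 / (4 * eta) * (r ^+ 2) ^+ 2 - C * r ^+ 3 =
  r ^+ 2 * (2 * eta - C * r) ^+ 2 / (4 * eta) by field; rewrite gt_eqF.
by apply: divr_ge0; [rewrite mulr_ge0 ?sqr_ge0|rewrite mulr_ge0// ltW].
Qed.

(** Beyond displacement rho, constants and squares are all bounded by multiples of the fourth power.
    The extra 1 leaves room for any bounded cut-off function. *)
Lemma far_bound (kap l M rho : R) : 0 <= kap -> 0 < rho ->
  exists2 C : R, 0 <= C & forall x a b, nv2 x <= M -> rho < a ^+ 2 + b ^+ 2 ->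
    `|bT kap l x a b| + 1 <= C * (a ^+ 2 + b ^+ 2) ^+ 2.
Proof.
move=> k0 r0; have [K K0 hK] := @coef_bounded R kap l M k0.
exists ((2 * K + 1) / rho ^+ 2 + 3 * K / rho).
  apply: addr_ge0; apply: divr_ge0; rewrite ?sqr_ge0 ?mulr_ge0// ?(ltW r0)//.
  by rewrite addr_ge0// mulr_ge0.
move=> x a b xM; set n := a ^+ 2 + b ^+ 2 => rn.
have [h0 h1 h2 [h11 h12 h22]] := hK x xM.
have n0 : 0 < n by exact: lt_trans rn.
have aa : `|a| ^+ 2 = a ^+ 2 by rewrite real_normK ?num_real.
have bb : `|b| ^+ 2 = b ^+ 2 by rewrite real_normK ?num_real.
have : `|bT kap l x a b| <= 2 * K + 3 * K * n.
  have na := normr_ge0 a; have nb := normr_ge0 b.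
  apply: (@le_trans _ _ (K + K * `|a| + K * `|b| + K * `|a| ^+ 2 + K * (`|a| * `|b|) + K * `|b| ^+ 2)).
    rewrite /bT; do 5 (apply: (le_trans (ler_normD _ _)); apply: lerD; last first;
      [by rewrite normrM ?normrX ?normrM; apply: ler_wpM2r => //; rewrite ?mulr_ge0 ?exprn_ge0|]).
    exact: h0.
  have hn : n = `|a| ^+ 2 + `|b| ^+ 2 by rewrite aa bb.
  rewrite hn.
  have : `|a| + `|b| + `|a| ^+ 2 + `|a| * `|b| + `|b| ^+ 2 <= 1 + 3 * (`|a| ^+ 2 + `|b| ^+ 2).
    have := sqr_ge0 (`|a| - 2^-1); have := sqr_ge0 (`|b| - 2^-1); have := sqr_ge0 (`|a| - `|b|).
    nra.
  by move=> h; have := ler_wpM2l K0 h; lra.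
have e1 : 2 * K + 1 <= (2 * K + 1) / rho ^+ 2 * n ^+ 2.
  rewrite -mulrA ler_peMr ?addr_ge0 ?mulr_ge0//.
  by rewrite mulrC ler_pdivlMr ?exprn_gt0// mul1r lerXn2r ?nnegrE ?ltW.
have e2 : 3 * K * n <= 3 * K / rho * n ^+ 2.
  rewrite -!mulrA; do 2 rewrite ler_wpM2l//.
  by rewrite mulrC ler_pdivlMr// expr2 ler_pM2l// ltW.
by move=> h; rewrite mulrDl; lra.
Qed.

Lemma hstep_nv2 (x : R * R * R) (a b al : R) : 0 <= al -> nv2 x <= al ^+ 2 ->
  a ^+ 2 + b ^+ 2 <= 1 ->
  nv2 (hstep x a b) <= nv2 x + (2 * al + 1) * Num.sqrt (a ^+ 2 + b ^+ 2) /\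
  `|(hstep x a b).2 - x.2| <= al * Num.sqrt (a ^+ 2 + b ^+ 2).
Proof.
case: x => [[u v] z] al0 /= xal ab1; set n := a ^+ 2 + b ^+ 2; set r := Num.sqrt n.
have n0 : 0 <= n by rewrite addr_ge0 ?sqr_ge0.
have r0 : 0 <= r by exact: sqrtr_ge0.
have rn : r ^+ 2 = n by rewrite sqr_sqrtr.
have r1 : r <= 1 by rewrite -[leRHS]sqrtr1 ler_wsqrtr.
have cs (p q : R) : p ^+ 2 + q ^+ 2 <= al ^+ 2 -> `|p * a + q * b| <= al * r.
  move=> pq; rewrite -(@ler_pXn2r _ 2) ?nnegrE ?mulr_ge0//.
  rewrite real_normK ?num_real// exprMn rn.
  apply: (@le_trans _ _ ((p ^+ 2 + q ^+ 2) * n)); last by rewrite ler_wpM2r.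
  rewrite -subr_ge0 (_ : _ - _ = (p * b - q * a) ^+ 2) ?sqr_ge0//.
  by rewrite /n; ring.
have c1 := cs u v xal.
have c2 : `|- v * a + u * b| <= al * r by apply: cs; rewrite sqrrN addrC.
split; last first.
  rewrite [X in `|X|](_ : _ = 2^-1 * (- v * a + u * b)); last by ring.
  rewrite normrM gtr0_norm ?invr_gt0//.
  by have := normr_ge0 (- v * a + u * b); lra.
have -> : (u + a) ^+ 2 + (v + b) ^+ 2 = u ^+ 2 + v ^+ 2 + 2 * (u * a + v * b) + n by rewrite /n; ring.
rewrite -rn; have := ler_norm (u * a + v * b).
by have : r ^+ 2 <= r by [rewrite expr2 ler_piMr]; lra.
Qed.

Section ground_state.
Variable sz : R.
Hypotheses (sz0 : 0 < sz) (bz : bessel 0 sz = 0)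
  (bpos : forall x, 0 <= x -> x < sz -> 0 < bessel 0 x).

Section lower.
Variables al be : R.
Hypotheses (al0 : 0 < al) (be0 : 0 < be).
(** With these two frequencies [bF] vanishes on the lateral wall and on both ends of the
    cylinder. *)
Let kap := sz / al ^+ 2.
Let l := pi / (2 * be).

Definition cyl (x : R * R * R) : bool := (nv2 x < al ^+ 2) && (x.2 ^+ 2 < be ^+ 2).

Let kap0 : 0 < kap. Proof. by rewrite divr_gt0// exprn_gt0. Qed.
Let l0 : 0 < l. Proof. by rewrite divr_gt0 ?pi_gt0// mulr_gt0. Qed.

Lemma cyl_pos x : cyl x -> 0 < bessel 0 (kap * nv2 x) /\ 0 < cos (l * x.2).
Proof.
move=> /andP[xa xb]; split.
  apply: bpos; first by rewrite mulr_ge0 ?(ltW kap0)// addr_ge0 ?sqr_ge0.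
  rewrite /kap mulrAC ltr_pdivrMr ?exprn_gt0// ltr_pM2l//.
have xb' : `|x.2| < be.
  by rewrite -(@ltr_pXn2r _ 2)// ?nnegrE ?(ltW be0)// real_normK ?num_real.
apply: cos_gt0_pihalf; rewrite -ltr_norml normrM gtr0_norm//.
have -> : pi / 2 = l * be :> R by rewrite /l; field; rewrite gt_eqF.
by rewrite ltr_pM2l.
Qed.

(** The indicator is there because the oscillating factors can make [bF] positive again outside the
    cylinder. Subtracting eps keeps the support at a positive distance from the boundary. *)
Definition fplus (eps : R) (x : R * R * R) : R :=
  (cyl x)%:R * Num.max 0 (bF kap l x - eps).

(** Both factors vanish on the boundary and are Lipschitz, so a value of at least eps forces a
    distance from the walls ([m1]) and from the ends ([m2]). A step below t uses up at most half of
    each margin. *)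
Lemma cyl_margin (eps : R) : 0 < eps -> exists2 rho : R, 0 < rho <= 1 &
  forall x a b, cyl x -> eps <= bF kap l x -> a ^+ 2 + b ^+ 2 <= rho -> cyl (hstep x a b).
Proof.
(* K bounds [bessel 0] on [0, sz] and also its derivative on [0, 2 sz], the symmetric range around
   sz that [mvt_ineq] inspects. *)
move=> e0; pose K := expR (2 * sz); have K0 : 0 < K by exact: expR_gt0.
pose m1 := eps / (K * kap); pose m2 := eps / (K * l).
have m10 : 0 < m1 by rewrite divr_gt0// mulr_gt0.
have m20 : 0 < m2 by rewrite divr_gt0// mulr_gt0.
pose t := Num.min 1 (Num.min (m1 / (2 * (2 * al + 1))) (m2 / (2 * al))).
have a21 : 0 < 2 * al + 1 by have := al0; lra.
have t0 : 0 < t by rewrite !lt_min ltr01 !divr_gt0// mulr_gt0.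
have t1 : t <= 1 by rewrite ge_min lexx.
exists (t ^+ 2); first by rewrite exprn_gt0//= exprn_ile1// ltW.
move=> x a b cx ex abt.
have [g0 c0] := cyl_pos cx; move: (cx) => /andP[xa xb].
have s0 : 0 <= kap * nv2 x by rewrite mulr_ge0 ?(ltW kap0)// addr_ge0 ?sqr_ge0.
have ssz : kap * nv2 x <= sz.
  by rewrite /kap mulrAC ler_pdivrMr ?exprn_gt0// ler_pM2l// ltW.
have gK : bessel 0 (kap * nv2 x) <= K.
  by rewrite (le_trans (ler_norm _))// (le_trans (bessel_norm _ _))// ler_expR ger0_norm//; move: ssz sz0; lra.
have xb' : `|x.2| < be.
  by rewrite -(@ltr_pXn2r _ 2)// ?nnegrE ?(ltW be0)// real_normK ?num_real.
have mg1 : m1 <= al ^+ 2 - nv2 x.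
  have e1 : eps <= bessel 0 (kap * nv2 x).
    by apply: (le_trans ex); rewrite /bF ler_piMr ?(ltW g0)// (le_trans (ler_norm _))// cos_max.
  have : bessel 0 (kap * nv2 x) <= K * (sz - kap * nv2 x).
    suff : `|bessel 0 (kap * nv2 x) - bessel 0 sz| <= K * `|kap * nv2 x - sz|.
      by rewrite bz subr0 gtr0_norm// distrC ger0_norm ?subr_ge0.
    have eD : `|kap * nv2 x - sz| = sz - kap * nv2 x by rewrite distrC ger0_norm ?subr_ge0.
    apply: mvt_ineq (bessel_derive 0) _ => u; rewrite eD ler_norml => /andP[u1 u2].
    apply: (le_trans (bessel_norm _ _)); rewrite ler_expR ler_norml.
    by move: s0 ssz u1 u2; lra.
  move=> e2; have : eps <= K * (sz - kap * nv2 x) by exact: le_trans e2.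
  have -> : sz = kap * al ^+ 2 by rewrite /kap divfK// expf_neq0// gt_eqF.
  by rewrite -mulrBr mulrA mulrC -ler_pdivrMr// mulr_gt0.
have mg2 : m2 <= be - `|x.2|.
  have e1 : eps <= K * cos (l * x.2).
    by apply: (le_trans ex); rewrite /bF ler_wpM2r// ltW.
  have : cos (l * x.2) <= l * (be - `|x.2|).
    suff h : `|cos (l * `|x.2|) - cos (l * be)| <= 1 * `|l * `|x.2| - l * be|.
      move: h; have {1}-> : l * be = pi / 2 by rewrite /l; field; rewrite gt_eqF.
      rewrite cos_pihalf subr0 mul1r -mulrBr normrM (gtr0_norm l0) distrC [`|be - _|]ger0_norm; last first.
        by rewrite subr_ge0 ltW.
      have -> : cos (l * `|x.2|) = cos (l * x.2).
        by have [h|h] := leP 0 x.2; [rewrite ger0_norm|rewrite ltr0_norm// mulrN cosN].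
      by rewrite gtr0_norm.
    have dc (u : R) : is_derive u (1 : R) cos (- sin u) by exact: is_derive_cos.
    by apply: mvt_ineq dc _ => u _; rewrite normrN sin_max.
  move=> e2; have : eps <= K * (l * (be - `|x.2|)).
    by apply: (le_trans e1); rewrite ler_pM2l.
  by rewrite mulrA mulrC -ler_pdivrMr// mulr_gt0.
set n := a ^+ 2 + b ^+ 2 in abt *.
have rt : Num.sqrt n <= t by rewrite -[leRHS]gtr0_norm// -sqrtr_sqr ler_wsqrtr.
have n1 : n <= 1 by apply: (le_trans abt); rewrite exprn_ile1// ltW.
have [h1 h2] := hstep_nv2 (ltW al0) (ltW xa) n1.
have tm1 : (2 * al + 1) * t <= m1 / 2.
  have : t <= m1 / (2 * (2 * al + 1)) by rewrite !ge_min lexx !orbT.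
  rewrite ler_pdivlMr ?mulr_gt0//; lra.
have tm2 : al * t <= m2 / 2.
  have : t <= m2 / (2 * al) by rewrite !ge_min lexx !orbT.
  rewrite ler_pdivlMr ?mulr_gt0//; lra.
have k1 : (2 * al + 1) * Num.sqrt n <= (2 * al + 1) * t by rewrite ler_pM2l.
have k2 : al * Num.sqrt n <= al * t by rewrite ler_pM2l.
rewrite /cyl; apply/andP; split; first by move: h1 tm1 k1 mg1 m10; lra.
rewrite -[X in X < _]real_normK ?num_real// ltrXn2r// ?nnegrE ?(ltW be0)//.
have : `|(hstep x a b).2| <= `|(hstep x a b).2 - x.2| + `|x.2|.
  by rewrite -[X in `|X| <= _](subrK x.2) ler_normD.
by move: h2 tm2 k2 mg2 m20; lra.
Qed.

(** A small step stays in the cylinder by [cyl_margin], and the Taylor bound applies. For a large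
    step the left side is already negative by [far_bound], while the truncated function is
    nonnegative. *)
Lemma lower_step (eps eta : R) : 0 < eps -> 0 < eta -> exists2 C : R, 0 <= C &
  forall x a b, cyl x -> eps <= bF kap l x ->
  bT kap l x a b - eps - eta * (a ^+ 2 + b ^+ 2) - C * (a ^+ 2 + b ^+ 2) ^+ 2
    <= fplus eps (hstep x a b).
Proof.
move=> e0 eta0; have [rho /andP[rho0 rho1] hrho] := cyl_margin e0.
have [C1 C10 hC1] := @step_expansion R kap l (al ^+ 2) (ltW kap0).
have [C2 C20 hC2] := @far_bound kap l (al ^+ 2) _ (ltW kap0) rho0.
have D0 : 0 <= C1 ^+ 2 / (4 * eta) by rewrite divr_ge0 ?sqr_ge0// mulr_ge0// ltW.
exists (C1 ^+ 2 / (4 * eta) + C2); first exact: addr_ge0.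
move=> x a b cx ex; move: (cx) => /andP[xa xb].
set n := a ^+ 2 + b ^+ 2.
have n0 : 0 <= n by rewrite addr_ge0 ?sqr_ge0.
have q1 := mulr_ge0 D0 (sqr_ge0 n); have q2 := mulr_ge0 C20 (sqr_ge0 n).
have q3 := mulr_ge0 (ltW eta0) n0.
have [nr|rn] := leP n rho.
  have n1 : n <= 1 by exact: le_trans rho1.
  have c' := hrho x a b cx ex nr; rewrite /fplus c' mul1r.
  have := hC1 x a b (ltW xa) n1; rewrite ler_norml => /andP[h1 _].
  have h2 := cubic_absorb C1 eta0 n0.
  rewrite le_max; apply/orP; right.
  by rewrite mulrDl; move: h1 h2 q1 q2; rewrite -/n; lra.
have := hC2 x a b (ltW xa) rn; have := ler_norm (bT kap l x a b); rewrite -/n => h1 h2.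
apply: (@le_trans _ _ 0); first by rewrite mulrDl; lra.
by rewrite /fplus mulr_ge0// le_max lexx.
Qed.
End lower.

Section upper.
Variables e2 r2 : R.
Hypotheses (e20 : 0 < e2) (er : e2 < r2).
Let kap := sz / r2.
Let r20 : 0 < r2. Proof. exact: lt_trans er. Qed.
Let kap0 : 0 < kap. Proof. by rewrite divr_gt0. Qed.

(** Cut off at a squared radius r2 larger than the e2 at which the chain is killed: small steps from
    a living state do not reach the cut-off. *)
Definition fdisk (x : R * R * R) : R := ((nv2 x < r2)%R : bool)%:R * bF kap 0 x.

Lemma fdisk_ge0 x : 0 <= fdisk x.
Proof.
rewrite /fdisk; case: ltP => h; rewrite ?mul0r// mul1r /bF mul0r cos0 mulr1 ltW//.
apply: bpos; first by rewrite mulr_ge0 ?(ltW kap0)// addr_ge0 ?sqr_ge0.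
by rewrite /kap mulrAC ltr_pdivrMr// ltr_pM2l.
Qed.

Lemma fdisk_ub x : fdisk x <= expR sz.
Proof.
rewrite /fdisk; case: ltP => h; rewrite ?mul0r ?expR_ge0// mul1r /bF mul0r cos0 mulr1.
have s0 : 0 <= kap * nv2 x by rewrite mulr_ge0 ?(ltW kap0)// addr_ge0 ?sqr_ge0.
rewrite (le_trans (ler_norm _))// (le_trans (bessel_norm _ _))// ler_expR ger0_norm//.
by rewrite /kap mulrAC ler_pdivrMr// ler_pM2l// ltW.
Qed.

(** A step longer than t may cross the cut-off, but there the function is at most [expR sz], and
    [far_bound] makes [C2 n^2] at least 1; this explains the factor [1 + expR sz]. *)
Lemma upper_step (eta : R) : 0 < eta -> exists2 C : R, 0 <= C &
  forall x a b, nv2 x <= e2 ->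
  fdisk (hstep x a b) <= bT kap 0 x a b + eta * (a ^+ 2 + b ^+ 2) + C * (a ^+ 2 + b ^+ 2) ^+ 2.
Proof.
move=> eta0; pose al := Num.sqrt e2.
have al0 : 0 < al by rewrite sqrtr_gt0.
have ale : al ^+ 2 = e2 by rewrite sqr_sqrtr// ltW.
have a21 : 0 < 2 * al + 1 by lra.
have dr : 0 < r2 - e2 by rewrite subr_gt0.
pose t := Num.min 1 ((r2 - e2) / (2 * (2 * al + 1))).
have t0 : 0 < t by rewrite lt_min ltr01 divr_gt0// mulr_gt0.
have t1 : t <= 1 by rewrite ge_min lexx.
have t20 : 0 < t ^+ 2 by rewrite exprn_gt0.
have [C1 C10 hC1] := @step_expansion R kap 0 e2 (ltW kap0).
have [C2 C20 hC2] := @far_bound kap 0 e2 _ (ltW kap0) t20.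
have D0 : 0 <= C1 ^+ 2 / (4 * eta) by rewrite divr_ge0 ?sqr_ge0// mulr_ge0// ltW.
exists (C1 ^+ 2 / (4 * eta) + (1 + expR sz) * C2).
  by rewrite addr_ge0// mulr_ge0// addr_ge0// expR_ge0.
move=> x a b xe; set n := a ^+ 2 + b ^+ 2.
have n0 : 0 <= n by rewrite addr_ge0 ?sqr_ge0.
have q1 := mulr_ge0 D0 (sqr_ge0 n); have q2 := mulr_ge0 C20 (sqr_ge0 n).
have q3 := mulr_ge0 (ltW eta0) n0; have E0 := expR_gt0 sz.
have q4 := mulr_ge0 (ltW E0) q2.
have [nr|rn] := leP n (t ^+ 2).
  have n1 : n <= 1 by apply: (le_trans nr); rewrite exprn_ile1// ltW.
  have rt : Num.sqrt n <= t by rewrite -[leRHS]gtr0_norm// -sqrtr_sqr ler_wsqrtr.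
  have xal : nv2 x <= al ^+ 2 by rewrite ale.
  have [h1 _] := hstep_nv2 (ltW al0) xal n1.
  have k1 : (2 * al + 1) * Num.sqrt n <= (2 * al + 1) * t by rewrite ler_pM2l.
  have tm1 : (2 * al + 1) * t <= (r2 - e2) / 2.
    have : t <= (r2 - e2) / (2 * (2 * al + 1)) by rewrite ge_min lexx orbT.
    rewrite ler_pdivlMr ?mulr_gt0//; lra.
  have lt : nv2 (hstep x a b) < r2 by move: h1 k1 tm1 dr xe; rewrite -/n; lra.
  rewrite /fdisk lt mul1r.
  have := hC1 x a b xe n1; rewrite ler_norml => /andP[_ h2].
  have h3 := cubic_absorb C1 eta0 n0.
  rewrite mulrDl [_ * C2]mulrDl mul1r [(C2 + _) * _]mulrDl -[_ * C2 * _]mulrA.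
  by move: h2 h3 q1 q2 q4; rewrite -/n; lra.
have := hC2 x a b xe rn; have := ler_norm (- bT kap 0 x a b); rewrite normrN -/n => h1 h2.
have := fdisk_ub (hstep x a b).
have : expR sz * 1 <= expR sz * (C2 * n ^+ 2).
  by rewrite ler_pM2l//; have := normr_ge0 (bT kap 0 x a b); lra.
rewrite mulrDl [_ * C2]mulrDl mul1r [(C2 + _) * _]mulrDl -[_ * C2 * _]mulrA.
by lra.
Qed.
End upper.
End ground_state.
End step_inequalities.

(** * Survival probabilities of the Euler chain *)

Section coefficient_measurability.
Context {R : realType}.
Variables kap l : R.
Local Notation nv2 x := (x.1.1 ^+ 2 + x.1.2 ^+ 2).

Let mx1 : measurable_fun setT (fun x : R * R * R => x.1.1).
Proof. by apply: measurableT_comp; [exact: measurable_fst|exact: measurable_fst]. Qed.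
Let mx2 : measurable_fun setT (fun x : R * R * R => x.1.2).
Proof. by apply: measurableT_comp; [exact: measurable_snd|exact: measurable_fst]. Qed.
Let mx3 : measurable_fun setT (fun x : R * R * R => x.2).
Proof. exact: measurable_snd. Qed.

Lemma measurable_nv2 : measurable_fun setT (fun x : R * R * R => nv2 x).
Proof. by adapt. Qed.

Let mg k : measurable_fun setT (fun x : R * R * R => bessel k (kap * nv2 x)).
Proof.
apply: (measurableT_comp (_ : measurable_fun setT (bessel k))).
  by apply: continuous_measurable_fun; exact: bessel_continuous.
by adapt.
Qed.
Let mc : measurable_fun setT (fun x : R * R * R => cos (l * x.2)).
Proof.
apply: (measurableT_comp (_ : measurable_fun setT cos)); last by adapt.
by apply: continuous_measurable_fun; exact: continuous_cos.
Qed.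
Let ms : measurable_fun setT (fun x : R * R * R => sin (l * x.2)).
Proof.
apply: (measurableT_comp (_ : measurable_fun setT sin)); last by adapt.
by apply: continuous_measurable_fun; exact: continuous_sin.
Qed.

Lemma measurable_bF : measurable_fun setT (bF kap l).
Proof. by have m0 := mg 0; rewrite /bF; adapt. Qed.
Lemma measurable_cL1 : measurable_fun setT (cL1 kap l).
Proof. by have m0 := mg 0; have m1 := mg 1; rewrite /cL1; adapt. Qed.
Lemma measurable_cL2 : measurable_fun setT (cL2 kap l).
Proof. by have m0 := mg 0; have m1 := mg 1; rewrite /cL2; adapt. Qed.
Lemma measurable_cQ11 : measurable_fun setT (cQ11 kap l).
Proof. by have m0 := mg 0; have m1 := mg 1; have m2 := mg 2; rewrite /cQ11; adapt. Qed.
Lemma measurable_cQ12 : measurable_fun setT (cQ12 kap l).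
Proof. by have m0 := mg 0; have m1 := mg 1; have m2 := mg 2; rewrite /cQ12; adapt. Qed.
Lemma measurable_cQ22 : measurable_fun setT (cQ22 kap l).
Proof. by have m0 := mg 0; have m1 := mg 1; have m2 := mg 2; rewrite /cQ22; adapt. Qed.
End coefficient_measurability.

Section small_ball.
Context {d : measure_display} {T : measurableType d} {R : realType}.
Variables (P : probability T R) (W1 W2 : R -> T -> R).
Hypothesis bm : is_BM2 P W1 W2.

Local Notation mean := (mean P).
Local Notation all_moments := (all_moments P).
Local Notation rect := (rect W1 W2).
Local Notation Z1 := (incr W1).
Local Notation Z2 := (incr W2).
Local Notation step q := ((2 ^+ q)^-1 : R).
Local Notation nv2 x := (x.1.1 ^+ 2 + x.1.2 ^+ 2).
Local Notation alive := (alive W1 W2).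
Local Notation alive_set := (alive_set W1 W2).

Definition state (q m i : nat) (w : T) : R * R * R :=
  (disp W1 q m i w, disp W2 q m i w, earea W1 W2 q m i w).

Lemma stateS q m i w : (m <= i)%N ->
  state q m i.+1 w = hstep (state q m i w) (Z1 q i w) (Z2 q i w).
Proof. by move=> mi; rewrite /state !dispS eareaS. Qed.

Lemma state0 q m w : state q m m w = (0, 0, 0).
Proof. by rewrite /state !disp0 earea0. Qed.

Lemma alive_mul (S : R * R * R -> bool) (g : R * R * R -> R) (K : R) q m i :
  measurable_fun setT S -> measurable_fun setT g -> (m <= i)%N ->
  (forall x, S x -> `|g x| <= K) ->
  adapted (rect q 0 i) (fun w => alive S q m i w * g (state q m i w)) /\
  all_moments (fun w => alive S q m i w * g (state q m i w)).
Proof.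
move=> mS mg mi gK.
have aY : adapted (rect q 0 i) (fun w => alive S q m i w * g (state q m i w)).
  apply: measurable_funM; first exact: adapted_alive0.
  by apply: (adapted_le (leq0n m) (leqnn i)); exact: adapted_state.
split => //; apply: (@all_moments_bounded _ _ _ P _ `|K|).
  by apply: adapted_measurable aY; exact: (rect_measurable bm).
move=> w; have [->|[-> h]] := alive_cases W1 W2 S q m i w; first by rewrite mul0r normr0.
rewrite mul1r (le_trans (gK _ _)) ?ler_norm//.
by apply: h; rewrite mi leqnn.
Qed.

Lemma geometric_iter_ub (e : nat -> R) (rho c : R) (m n : nat) :
  0 <= rho -> rho <= 1 -> 0 <= c -> (m <= n)%N ->
  (forall i, (m <= i < n)%N -> e i.+1 <= rho * e i + c) ->
  e n <= rho ^+ (n - m) * e m + (n - m)%:R * c.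
Proof.
move=> r0 r1 c0 mn; rewrite -(subnKC mn) addKn; elim: (n - m)%N => [|k ih] h.
  by rewrite addn0 expr0 mul1r mul0r addr0.
rewrite addnS; have /h h1 : (m <= m + k < m + k.+1)%N by rewrite leq_addr addnS ltnSn.
apply: (le_trans h1).
have /ih h2 : forall i, (m <= i < m + k)%N -> e i.+1 <= rho * e i + c.
  by move=> i /andP[mi ik]; apply: h; rewrite mi addnS ltnS ltnW.
rewrite exprS -[k.+1]addn1 natrD mulrDl mul1r addrA lerD2r.
apply: (le_trans (ler_wpM2l r0 h2)); rewrite mulrDr mulrA lerD2l.
by rewrite ler_piMl// mulr_ge0.
Qed.

Lemma geometric_iter_lb (e : nat -> R) (rho c : R) (m n : nat) :
  0 <= rho -> rho <= 1 -> 0 <= c -> (m <= n)%N ->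
  (forall i, (m <= i < n)%N -> rho * e i - c <= e i.+1) ->
  rho ^+ (n - m) * e m - (n - m)%:R * c <= e n.
Proof.
move=> r0 r1 c0 mn h.
have := @geometric_iter_ub (fun i => - e i) rho c m n r0 r1 c0 mn.
move=> /(_ _)/wrap[]; last by rewrite mulrN; lra.
by move=> i /h; rewrite mulrN; lra.
Qed.

(** By [trace_eq] averaging one step multiplies [bF] by 1 minus the step times a rate, and turns the
    penalty [eta |Z|^2] into [2 eta h]. [S'] is an extra restriction on the current state: trivial
    for the disk, [eps <= bF] for the cylinder. The sign of eta is free, and the lower bound takes
    it negative. *)
Lemma mean_bT (S S' : R * R * R -> bool) (kap l M eta : R) q m i :
  measurable_fun setT S -> measurable_fun setT S' -> 0 <= kap ->
  (forall x, S x -> nv2 x <= M) -> (m <= i)%N ->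
  let V w := alive S q m i w * (S' (state q m i w))%:R in
  let F w := V w * (bT kap l (state q m i w) (Z1 q i w) (Z2 q i w)
      + eta * (Z1 q i w ^+ 2 + Z2 q i w ^+ 2)) in
  let G w := V w * (bF kap l (state q m i w) * (1 - step q * (kap / 2 + l ^+ 2 * nv2 (state q m i w) / 8))
      + 2 * eta * step q) in
  [/\ all_moments F, all_moments G & mean F = mean G].
Proof.
move=> mS mS' kap0 SM mi V F G.
have [K K0 hK] := coef_bounded l M kap0.
have mS'r : measurable_fun setT (fun x => (S' x)%:R : R).
  rewrite (_ : (fun _ => _) = (fun x => if S' x then 1 else 0)); last first.
    by apply/funext => x; case: (S' x).
  exact: measurable_fun_ifT.
have al (g : R * R * R -> R) : measurable_fun setT g -> (forall x, S x -> `|g x| <= K + `|eta|) ->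
    adapted (rect q 0 i) (fun w => V w * g (state q m i w)) /\
    all_moments (fun w => V w * g (state q m i w)).
  move=> mg hg; have [] := @alive_mul S (fun x => (S' x)%:R * g x) (K + `|eta|) q m i mS _ mi _.
  - exact: measurable_funM.
  - move=> x /hg h; case: (S' x); rewrite ?mul1r// mul0r normr0 addr_ge0//.
  by rewrite /V; move=> a b; split; [move: a|move: b]; congr (_ _); apply/funext => w; rewrite mulrA.
have e0 := normr_ge0 eta.
have b0 x : S x -> `|bF kap l x| <= K + `|eta| by move=> /SM/hK[? _ _ _]; lra.
have b1 x : S x -> `|cL1 kap l x| <= K + `|eta| by move=> /SM/hK[_ ? _ _]; lra.
have b2 x : S x -> `|cL2 kap l x| <= K + `|eta| by move=> /SM/hK[_ _ ? _]; lra.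
have b11 x : S x -> `|cQ11 kap l x + eta| <= K + `|eta|.
  by move=> /SM/hK[_ _ _ [? _ _]]; apply: (le_trans (ler_normD _ _)); lra.
have b12 x : S x -> `|cQ12 kap l x| <= K + `|eta| by move=> /SM/hK[_ _ _ [_ ? _]]; lra.
have b22 x : S x -> `|cQ22 kap l x + eta| <= K + `|eta|.
  by move=> /SM/hK[_ _ _ [_ _ ?]]; apply: (le_trans (ler_normD _ _)); lra.
have [_ m0] := al _ (measurable_bF kap l) b0.
have [a1 m1] := al _ (measurable_cL1 kap l) b1.
have [a2 m2] := al _ (measurable_cL2 kap l) b2.
have [a11 m11] := al _ (measurable_funD (measurable_cQ11 kap l) (measurable_cst eta)) b11.
have [a12 m12] := al _ (measurable_cQ12 kap l) b12.
have [a22 m22] := al _ (measurable_funD (measurable_cQ22 kap l) (measurable_cst eta)) b22.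
have mz1 := all_moments_incr1 bm q i; have mz2 := all_moments_incr2 bm q i.
pose quad w := V w * bF kap l (state q m i w) + (V w * cL1 kap l (state q m i w)) * Z1 q i w
   + (V w * cL2 kap l (state q m i w)) * Z2 q i w
   + (V w * (cQ11 kap l (state q m i w) + eta)) * Z1 q i w ^+ 2
   + (V w * cQ12 kap l (state q m i w)) * (Z1 q i w * Z2 q i w)
   + (V w * (cQ22 kap l (state q m i w) + eta)) * Z2 q i w ^+ 2.
have eF : F = quad by apply/funext => w; rewrite /F /quad /bT; ring.
pose tr w := V w * bF kap l (state q m i w)
   + step q * (V w * (cQ11 kap l (state q m i w) + eta) + V w * (cQ22 kap l (state q m i w) + eta)).
have eG : G = tr.
  apply/funext => w; rewrite /G /tr -mulrDr.
  rewrite (_ : _ + eta + _ = (cQ11 kap l (state q m i w) + cQ22 kap l (state q m i w)) + 2 * eta); last by ring.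
  by rewrite trace_eq; ring.
split; first by rewrite eF /quad; moments.
  by rewrite eG /tr; moments.
by rewrite eF eG /quad (step_mean_eq bm m0 a1 m1 a2 m2 a11 m11 a12 m12 a22 m22).
Qed.

Section ground_state.
Variable sz : R.
Hypotheses (sz0 : 0 < sz) (bz : bessel 0 sz = 0)
  (bpos : forall x, 0 <= x -> x < sz -> 0 < bessel 0 x).

Definition disk (e2 : R) (x : R * R * R) : bool := nv2 x <= e2.

Lemma measurable_disk e2 : measurable_fun setT (disk e2).
Proof. by apply: measurable_fun_ler => //; exact: measurable_nv2. Qed.

Lemma measurable_fdisk (z r2 : R) : measurable_fun setT (fdisk z r2).
Proof.
apply: measurable_funM; last exact: measurable_bF.
rewrite (_ : (fun _ => _) = (fun x : R * R * R => if nv2 x < r2 then 1 else 0)); last first.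
  by apply/funext => x; case: (_ < _).
by apply: measurable_fun_ifT => //; apply: measurable_fun_ltr => //; exact: measurable_nv2.
Qed.

Let gconst_ge0 : 0 <= gconst :> R.
Proof. by rewrite /gconst !mulr_ge0 ?expR_ge0 ?exprn_ge0. Qed.

(** Each step contracts the mean by [expR (- (kap / 2 * h))] up to an error [(2 eta + C h) h], and
    the initial value is at most 1. Here [kap / 2 = sz / r2 / 2] is the lowest eigenvalue of the
    disk of squared radius r2. *)
Lemma euler_disk_mean (e2 r2 eta : R) : 0 < e2 -> e2 < r2 -> 0 < eta ->
  exists2 C : R, 0 <= C & forall q m n, (m <= n)%N ->
  mean (fun w => alive (disk e2) q m n w * fdisk sz r2 (state q m n w)) <=
  expR (- (sz / r2 / 2 * ((n - m)%:R * step q))) + (2 * eta + C * step q) * ((n - m)%:R * step q).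
Proof.
move=> e20 er eta0; have r20 : 0 < r2 by exact: lt_trans er.
set kap := sz / r2; have kap0 : 0 < kap by rewrite divr_gt0.
have [C1 C10 hC1] := upper_step sz0 e20 er eta0.
exists (C1 * (4 * gconst)); first by rewrite !mulr_ge0.
move=> q m n mn; set h := step q; have h0 : 0 < h := step_gt0 q.
have mS := measurable_disk e2.
pose Y i := alive (disk e2) q m i.
have Y01 i w : 0 <= Y i w <= 1 := alive01 W1 W2 (disk e2) q m i w.
have mfd := measurable_fdisk sz r2.
pose e i := mean (fun w => Y i w * fdisk sz r2 (state q m i w)).
have mfdi i : (m <= i)%N -> all_moments (fun w => Y i w * fdisk sz r2 (state q m i w)).
  move=> mi; apply: (@alive_mul _ _ (expR sz) q m i mS mfd mi _).2.
  by move=> x _; rewrite ger0_norm ?(fdisk_ge0 sz0 bpos e20 er)// (fdisk_ub sz0 e20 er).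
have rec i : (m <= i < n)%N -> e i.+1 <= expR (- (kap / 2 * h)) * e i + (2 * eta + C1 * (4 * gconst) * h) * h.
  move=> /andP[mi _].
  have mS' : measurable_fun setT (fun x : R * R * R => true) by exact: measurable_cst.
  have [mF mG FG] := @mean_bT (disk e2) (fun=> true) kap 0 e2 eta q m i mS mS' (ltW kap0) (fun x => id) mi.
  have mz1 := all_moments_incr1 bm q i; have mz2 := all_moments_incr2 bm q i.
  have mY : all_moments (Y i) by exact: all_moments_alive.
  pose N w := Z1 q i w ^+ 2 + Z2 q i w ^+ 2.
  have mN : all_moments (fun w => Y i w * N w ^+ 2) by rewrite /N; moments.
  apply: (@le_trans _ _ (mean (fun w => Y i w * true%:R * (bT kap 0 (state q m i w) (Z1 q i w) (Z2 q i w)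
      + eta * (Z1 q i w ^+ 2 + Z2 q i w ^+ 2)) + C1 * (Y i w * N w ^+ 2)))).
    apply: mean_le; [by apply: mfdi; exact: leqW|by apply: all_momentsD mF _; exact: all_momentsZ|].
    move=> w; rewrite /Y aliveS ?(leqW mi)// -/(state _ _ _ _) stateS// mulr1.
    have := hC1 (state q m i w) (Z1 q i w) (Z2 q i w).
    have f0 := fdisk_ge0 sz0 bpos e20 er (hstep (state q m i w) (Z1 q i w) (Z2 q i w)).
    have [hY|[hY hS]] := alive_cases W1 W2 (disk e2) q m i w; rewrite hY.
      by rewrite !mul0r mulr0 addr0.
    have hSi : disk e2 (state q m i w) by apply: hS; rewrite mi leqnn.
    move=> /(_ hSi) hh; rewrite !mul1r.
    apply: (@le_trans _ _ (fdisk sz r2 (hstep (state q m i w) (Z1 q i w) (Z2 q i w)))).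
      by case: (disk _ _) => /=; rewrite ?mul1r ?mul0r.
    by apply: (le_trans hh); rewrite -/kap /N.
  rewrite meanD; [|exact: mF|exact: all_momentsZ].
  rewrite FG meanZ//.
  have N4 : mean (fun w => Y i w * N w ^+ 2) <= 4 * gconst * h ^+ 2.
    by apply: (step_mean4 bm); [exact: adapted_alive0|exact: Y01].
  have mR : all_moments (fun w => expR (- (kap / 2 * h)) * (Y i w * fdisk sz r2 (state q m i w))
      + 2 * eta * h * cst 1 w).
    apply: all_momentsD; first by apply: all_momentsZ; exact: mfdi.
    by apply: all_momentsZ; exact: all_moments_cst.
  apply: (@le_trans _ _ (mean (fun w => expR (- (kap / 2 * h)) * (Y i w * fdisk sz r2 (state q m i w))
      + 2 * eta * h * cst 1 w) + C1 * (4 * gconst * h ^+ 2))).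
    apply: lerD; last by rewrite ler_wpM2l.
    apply: mean_le; [exact: mG|exact: mR|move=> w].
    have c0 : 0 <= 2 * eta * h by rewrite !mulr_ge0// ltW.
    rewrite /cst !mulr1 /Y.
    have [hY|[hY hS]] := alive_cases W1 W2 (disk e2) q m i w; rewrite hY.
      by rewrite !mul0r mulr0 add0r.
    have hSi : disk e2 (state q m i w) by apply: hS; rewrite mi leqnn.
    rewrite !mul1r /fdisk (le_lt_trans hSi er) mul1r -/kap.
    have bpos' : 0 <= bF kap 0 (state q m i w).
      have := fdisk_ge0 sz0 bpos e20 er (state q m i w).
      by rewrite /fdisk (le_lt_trans hSi er) mul1r.
    rewrite expr0n /= !mul0r addr0 lerD2r.
    have ex := expR_ge1Dx (- (kap / 2 * h)).
    by have := ler_wpM2r bpos' ex; rewrite -/h; lra.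
  rewrite meanD; [|by apply: all_momentsZ; exact: mfdi|by apply: all_momentsZ; exact: all_moments_cst].
  rewrite meanZ; last exact: mfdi.
  rewrite meanZ; last exact: all_moments_cst.
  by rewrite mean_cst -/(e i); lra.
have r1 : expR (- (kap / 2 * h)) <= 1.
  by rewrite -expR0 ler_expR oppr_le0 mulr_ge0 ?(ltW h0)// divr_ge0 ?(ltW kap0).
have c0 : 0 <= (2 * eta + C1 * (4 * gconst) * h) * h.
  by rewrite mulr_ge0 ?addr_ge0 ?mulr_ge0// ltW.
have := geometric_iter_ub (expR_ge0 _) r1 c0 mn rec.
have em : e m <= 1.
  rewrite -(mean_cst P 1); apply: mean_le; [exact: mfdi|exact: all_moments_cst|move=> w].
  rewrite state0 /cst /fdisk /bF /= expr0n addr0 mulr0 mul0r bessel0 cos0 r20 !mulr1.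
  by have /andP[] := Y01 m w.
rewrite -expRM_natl => hh; apply: (le_trans hh); apply: lerD.
  rewrite (_ : _ * - _ = - (kap / 2 * ((n - m)%:R * h))); last by ring.
  by rewrite ler_piMr ?expR_ge0.
by rewrite le_eqVlt; apply/orP; left; apply/eqP; ring.
Qed.

(** Enlarging the squared radius by 1 / th bounds the ground state below on the original disk by its
    minimum on [[0, th sz]]. By scaling this minimum depends on th only, so the prefactor is uniform
    over all radii met in the Borel-Cantelli argument. *)
Lemma euler_disk_upper (th : R) : 0 < th -> th < 1 -> exists2 m0 : R, 0 < m0 &
  forall e2 eta, 0 < e2 -> 0 < eta -> exists2 C : R, 0 <= C & forall q m n, (m <= n)%N ->
  m0 * fine (P (alive_set (disk e2) q m n)) <=
  expR (- (sz * th / e2 / 2 * ((n - m)%:R * step q))) + (2 * eta + C * step q) * ((n - m)%:R * step q).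
Proof.
move=> th0 th1; have ts0 : 0 <= th * sz by rewrite mulr_ge0// ltW.
have [|c c0 hc] := EVT_min ts0 (f := bessel 0).
  by apply: continuous_subspaceT; exact: bessel_continuous.
move: c0; rewrite in_itv /= => /andP[c0 c1].
have cs : c < sz by rewrite (le_lt_trans c1)// gtr_pMl.
exists (bessel 0 c); first exact: bpos.
move=> e2 eta e20 eta0; pose r2 := e2 / th.
have r20 : 0 < r2 by rewrite divr_gt0.
have er : e2 < r2 by rewrite ltr_pdivlMr// gtr_pMr.
have [C C0 hC] := euler_disk_mean e20 er eta0.
exists C => // q m n mn; have := hC q m n mn.
rewrite (_ : sz / r2 = sz * th / e2); last by rewrite /r2; field; rewrite !gt_eqF.
apply: le_trans; rewrite -(mean_alive bm (measurable_disk e2)) -meanZ; last first.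
  exact: all_moments_alive (measurable_disk e2) _ _ _.
apply: mean_le.
- by apply: all_momentsZ; exact: all_moments_alive (measurable_disk e2) _ _ _.
- apply: (@alive_mul _ _ (expR sz) q m n (measurable_disk e2) (measurable_fdisk _ _) mn _).2.
  by move=> x _; rewrite ger0_norm ?(fdisk_ge0 sz0 bpos e20 er)// (fdisk_ub sz0 e20 er).
move=> w; have [hY|[hY hS]] := alive_cases W1 W2 (disk e2) q m n w; rewrite hY.
  by rewrite mulr0 mul0r.
have hSi : disk e2 (state q m n w) by apply: hS; rewrite mn leqnn.
rewrite mulr1 mul1r /fdisk (le_lt_trans hSi er) mul1r /bF mul0r cos0 mulr1.
apply: hc; rewrite in_itv /=; apply/andP; split.
  by rewrite mulr_ge0 ?divr_ge0 ?addr_ge0 ?sqr_ge0// ltW.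
rewrite (_ : th * sz = sz / r2 * e2); last by rewrite /r2; field; rewrite !gt_eqF.
by rewrite ler_wpM2l// divr_ge0// ltW.
Qed.

Lemma expRN_ub (x : R) : 0 <= x -> expR (- x) <= 1 - x + x ^+ 2.
Proof.
move=> x0; rewrite expRN; have x1 : 0 < 1 + x by lra.
have h := expR_ge1Dx x.
apply: (@le_trans _ _ (1 + x)^-1); first by rewrite lef_pV2 ?posrE ?expR_gt0.
rewrite -(ler_pM2r x1) mulVf ?gt_eqF//.
have := exprn_ge0 3 x0; rewrite (_ : (1 - x + x ^+ 2) * (1 + x) = 1 + x ^+ 3); [lra|ring].
Qed.

(** The rate [kap / 2 + l^2 |v|^2 / 8] varies over the cylinder and is replaced by its value mu at
    [|v| = al]. The factor [expR sz], an upper bound of the truncated function, converts its mean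
    into a survival probability. *)
Lemma euler_cyl_lower (al be eps eta : R) : 0 < al -> 0 < be -> 0 < eps -> 0 < eta ->
  let mu := sz / al ^+ 2 / 2 + (pi / (2 * be)) ^+ 2 * al ^+ 2 / 8 in
  exists2 C : R, 0 <= C & forall q m n, (m <= n)%N ->
  expR (- (mu * ((n - m)%:R * step q))) * (1 - eps) -
    (mu * eps + 2 * eta + C * step q) * ((n - m)%:R * step q)
  <= expR sz * fine (P (alive_set (cyl al be) q m n)).
Proof.
move=> al0 be0 e0 eta0; set kap := sz / al ^+ 2; set l := pi / (2 * be) => mu.
have kap0 : 0 < kap by rewrite divr_gt0// exprn_gt0.
have mu0 : 0 <= mu.
  by rewrite addr_ge0// divr_ge0// ?(ltW kap0)// mulr_ge0 ?sqr_ge0.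
have [C1 C10 hC1] := lower_step sz0 bz bpos al0 be0 e0 eta0.
exists (C1 * (4 * gconst) + mu ^+ 2 * expR sz).
  by rewrite addr_ge0 ?mulr_ge0 ?expR_ge0 ?sqr_ge0.
move=> q m n mn; set h := step q; have h0 : 0 < h := step_gt0 q.
pose S := cyl al be; pose S' x := eps <= bF kap l x.
have mS : measurable_fun setT S.
  apply: measurable_and; apply: measurable_fun_ltr => //; first exact: measurable_nv2.
  by apply: measurable_funX; exact: measurable_snd.
have mS' : measurable_fun setT S'.
  by apply: measurable_fun_ler => //; exact: measurable_bF.
have SM x : S x -> nv2 x <= al ^+ 2 by move=> /andP[/ltW].
pose Y i := alive S q m i.
have Y01 i w : 0 <= Y i w <= 1 := alive01 W1 W2 S q m i w.
have mfp : measurable_fun setT (fplus sz al be eps).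
  apply: measurable_funM.
    rewrite (_ : (fun _ => _) = (fun x : R * R * R => if S x then 1 else 0)); last first.
      by apply/funext => x; rewrite /S; case: (cyl _ _ _).
    exact: measurable_fun_ifT.
  apply: measurable_maxr => //; apply: measurable_funB => //; exact: measurable_bF.
have fp0 x : 0 <= fplus sz al be eps x by rewrite mulr_ge0// le_max lexx.
have bub x : S x -> bF kap l x <= expR sz.
  move=> /SM Sx; rewrite (le_trans (ler_norm _))// /bF normrM.
  have s0 : 0 <= kap * nv2 x by rewrite mulr_ge0 ?(ltW kap0)// addr_ge0 ?sqr_ge0.
  have hb : `|bessel 0 (kap * nv2 x)| <= expR sz.
    rewrite (le_trans (bessel_norm _ _))// ler_expR ger0_norm//.
    by rewrite /kap mulrAC ler_pdivrMr ?exprn_gt0// ler_pM2l.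
  by rewrite (le_trans (ler_piMr _ (cos_max _))).
have fpub x : fplus sz al be eps x <= expR sz.
  rewrite /fplus -/kap -/l; case Sx : (cyl al be x); last by rewrite mul0r expR_ge0.
  rewrite mul1r ge_max expR_ge0 /=; have := bub x Sx; lra.
pose e i := mean (fun w => Y i w * fplus sz al be eps (state q m i w)).
have mfpi i : (m <= i)%N -> all_moments (fun w => Y i w * fplus sz al be eps (state q m i w)).
  move=> mi; apply: (@alive_mul _ _ (expR sz) q m i mS mfp mi _).2.
  by move=> x _; rewrite ger0_norm.
(* The error per unit of time: [mu eps] from the truncation, [2 eta] from the cubic remainder, and
   terms of order h from the fourth moment and from replacing [1 - mu h] by an exponential. *)
pose c := mu * eps + 2 * eta + (C1 * (4 * gconst) + mu ^+ 2 * expR sz) * h.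
have rec i : (m <= i < n)%N -> expR (- (mu * h)) * e i - c * h <= e i.+1.
  move=> /andP[mi _].
  have [mF mG FG] := @mean_bT S S' kap l (al ^+ 2) (- eta) q m i mS mS' (ltW kap0) SM mi.
  have mz1 := all_moments_incr1 bm q i; have mz2 := all_moments_incr2 bm q i.
  have mY : all_moments (Y i) by exact: all_moments_alive.
  have mV : all_moments (fun w => Y i w * (S' (state q m i w))%:R).
    apply: (@alive_mul _ (fun x => (S' x)%:R) 1 q m i mS _ mi _).2.
      rewrite (_ : (fun _ => _) = (fun x => if S' x then 1 else 0)); last first.
        by apply/funext => x; case: (S' x).
      exact: measurable_fun_ifT.
    by move=> x _; case: (S' x); rewrite ?normr1 ?normr0.
  pose N w := Z1 q i w ^+ 2 + Z2 q i w ^+ 2.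
  have mN : all_moments (fun w => Y i w * N w ^+ 2) by rewrite /N; moments.
  have mEN : all_moments (fun w => eps * (Y i w * (S' (state q m i w))%:R) + C1 * (Y i w * N w ^+ 2)).
    by apply: all_momentsD; exact: all_momentsZ.
  apply: (@le_trans _ _ (mean (fun w => Y i w * (S' (state q m i w))%:R *
      (bT kap l (state q m i w) (Z1 q i w) (Z2 q i w)
      + - eta * (Z1 q i w ^+ 2 + Z2 q i w ^+ 2)) -
      (eps * (Y i w * (S' (state q m i w))%:R) + C1 * (Y i w * N w ^+ 2))))); last first.
    apply: mean_le; [by apply: all_momentsB mF mEN|by apply: mfpi; exact: leqW|move=> w].
    rewrite /Y aliveS ?(leqW mi)// -/(state _ _ _ _) stateS// /N.
    set Nw := (Z1 q i w ^+ 2 + Z2 q i w ^+ 2); have N0 : 0 <= C1 * Nw ^+ 2 by rewrite mulr_ge0 ?sqr_ge0.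
    have := hC1 (state q m i w) (Z1 q i w) (Z2 q i w).
    have := fp0 (hstep (state q m i w) (Z1 q i w) (Z2 q i w)).
    have [hY|[hY hS]] := alive_cases W1 W2 S q m i w; rewrite hY.
      by rewrite !mul0r !mulr0 addr0 subr0.
    have hSi : S (state q m i w) by apply: hS; rewrite mi leqnn.
    move=> f0 /(_ hSi); rewrite -/kap -/l !mul1r -/Nw.
    have -> : (S (hstep (state q m i w) (Z1 q i w) (Z2 q i w)))%:R *
        fplus sz al be eps (hstep (state q m i w) (Z1 q i w) (Z2 q i w)) =
        fplus sz al be eps (hstep (state q m i w) (Z1 q i w) (Z2 q i w)).
      by rewrite /fplus /S; case: (cyl _ _ _); rewrite ?mul1r ?mul0r ?mulr0.
    rewrite /S'; case: (leP eps (bF kap l (state q m i w))) => hh; last by rewrite /= mul0r mulr0; lra.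
    by move=> /(_ isT); rewrite /= mul1r mulr1; lra.
  rewrite meanB; [|exact: mF|exact: mEN].
  rewrite FG meanD; [|exact: all_momentsZ|exact: all_momentsZ].
  rewrite [mean (fun w => C1 * _)]meanZ//.
  have N4 : mean (fun w => Y i w * N w ^+ 2) <= 4 * gconst * h ^+ 2.
    by apply: (step_mean4 bm); [exact: adapted_alive0|exact: Y01].
  have CN4 := ler_wpM2l C10 N4.
  pose c' := (mu * eps + 2 * eta + mu ^+ 2 * expR sz * h) * h.
  suff : mean (fun w => expR (- (mu * h)) * (Y i w * fplus sz al be eps (state q m i w)) - c' * cst 1 w) <=
      mean (fun w => Y i w * (S' (state q m i w))%:R * (bF kap l (state q m i w) *
        (1 - step q * (kap / 2 + l ^+ 2 * nv2 (state q m i w) / 8)) + 2 * - eta * step q) -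
        eps * (Y i w * (S' (state q m i w))%:R)).
    rewrite meanB; [|by apply: all_momentsZ; exact: mfpi|by apply: all_momentsZ; exact: all_moments_cst].
    rewrite meanZ; last exact: mfpi.
    rewrite meanZ; last exact: all_moments_cst.
    rewrite mean_cst meanB; [|exact: mG|exact: all_momentsZ].
    by rewrite -/(e i) /c' /c; lra.
  apply: mean_le.
  - apply: all_momentsB; first by apply: all_momentsZ; exact: mfpi.
    by apply: all_momentsZ; exact: all_moments_cst.
  - by apply: all_momentsB mG _; exact: all_momentsZ.
  move=> w; rewrite /cst mulr1 -/h.
  have c'0 : 0 <= c'.
    by rewrite mulr_ge0 ?addr_ge0 ?mulr_ge0 ?sqr_ge0 ?expR_ge0// ltW.
  have [hY|[hY hS]] := alive_cases W1 W2 S q m i w; rewrite /Y hY.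
    by rewrite !mul0r !mulr0; lra.
  have hSi : S (state q m i w) by apply: hS; rewrite mi leqnn.
  rewrite !mul1r /fplus -/kap -/l -/S hSi mul1r.
  have bu := bub _ hSi.
  rewrite /S'; case: (leP eps (bF kap l (state q m i w))) => hh; last first.
    by rewrite /= max_l ?mulr0 ?mul0r; lra.
  rewrite /= max_r ?subr_ge0// mulr1 mul1r.
  set b := bF _ _ _; set nn := (_ ^+ 2 + _ ^+ 2 : R).
  have nn0 : 0 <= nn by rewrite addr_ge0 ?sqr_ge0.
  have b0 : 0 <= b by rewrite (le_trans (ltW e0)).
  have h1 : kap / 2 + l ^+ 2 * nn / 8 <= mu.
    by rewrite /mu lerD2l ler_pM2r// ler_wpM2l ?sqr_ge0// (SM _ hSi).
  have h2 : b * (h * (kap / 2 + l ^+ 2 * nn / 8)) <= b * (h * mu).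
    by rewrite ler_wpM2l// ler_wpM2l// ltW.
  have h3 := expRN_ub (mulr_ge0 mu0 (ltW h0)).
  have be0' : 0 <= b - eps by rewrite subr_ge0.
  have h4 := ler_wpM2l be0' h3.
  have h5 : (b - eps) * (mu * h) ^+ 2 <= expR sz * (mu * h) ^+ 2.
    by rewrite ler_wpM2r ?sqr_ge0//; move: bu; rewrite -/b; lra.
  by rewrite /c'; lra.
have r1 : expR (- (mu * h)) <= 1.
  by rewrite -expR0 ler_expR oppr_le0 mulr_ge0// ltW.
have c0 : 0 <= c * h.
  rewrite mulr_ge0// ?(ltW h0)// /c; apply: addr_ge0.
    by rewrite addr_ge0// mulr_ge0// ltW.
  by rewrite mulr_ge0 ?(ltW h0)// addr_ge0// !mulr_ge0 ?sqr_ge0 ?expR_ge0.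
have := geometric_iter_lb (expR_ge0 _) r1 c0 mn rec.
have em : 1 - eps <= e m.
  rewrite -(mean_cst P (1 - eps)); apply: mean_le; [exact: all_moments_cst|exact: mfpi|move=> w].
  have S0 : S (0, 0, 0) by rewrite /S /cyl /= expr0n addr0 !exprn_gt0.
  rewrite /Y /alive big_nat1 -/(state q m m w) state0 S0 /cst /fplus -/S S0 /bF.
  by rewrite /= expr0n addr0 !mulr0 bessel0 cos0 !mul1r le_max lexx orbT.
have en : e n <= expR sz * fine (P (alive_set S q m n)).
  rewrite -(mean_alive bm mS) -meanZ; last exact: all_moments_alive.
  apply: mean_le; [exact: mfpi|by apply: all_momentsZ; exact: all_moments_alive|move=> w].
  by rewrite mulrC ler_wpM2r//; have /andP[] := Y01 n w.
rewrite -expRM_natl => hh; apply: le_trans en; apply: le_trans hh; apply: lerB.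
  rewrite (_ : _ * - _ = - (mu * ((n - m)%:R * h))); last by ring.
  by rewrite ler_wpM2l ?expR_ge0.
by rewrite /c le_eqVlt; apply/orP; left; apply/eqP; ring.
Qed.
End ground_state.
End small_ball.

(** * Almost sure convergence of the Euler area *)

Section borel_cantelli.
Context {d : measure_display} {T : measurableType d} {R : realType}.
Variable P : probability T R.

Lemma fine_prob_le (E F : set T) : measurable E -> measurable F -> E `<=` F ->
  fine (P E) <= fine (P F).
Proof.
by move=> mE mF EF; apply: fine_le; rewrite ?fin_num_measure// le_measure ?inE.
Qed.

Lemma fine_probU (E F : set T) : measurable E -> measurable F ->
  fine (P (E `|` F)) <= fine (P E) + fine (P F).
Proof.
move=> mE mF; rewrite -fineD ?fin_num_measure//.
apply: fine_le; rewrite ?fin_numD ?fin_num_measure//; first exact: measurableU.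
exact: measureU2.
Qed.

Lemma measurable_gt_set (U : T -> R) (c : R) : measurable_fun setT U -> measurable [set w | c < U w].
Proof.
move=> mU; rewrite (_ : [set _ | _] = setT `&` U @^-1` `]c, +oo[%classic); first exact: mU.
by rewrite setTI; apply/seteqP; split => w /=; rewrite in_itv /= andbT.
Qed.

Lemma measurable_ge_set (U : T -> R) (c : R) : measurable_fun setT U -> measurable [set w | c <= U w].
Proof.
move=> mU; rewrite (_ : [set _ | _] = setT `&` U @^-1` `[c, +oo[%classic); first exact: mU.
by rewrite setTI; apply/seteqP; split => w /=; rewrite in_itv /= andbT.
Qed.

Lemma borel_cantelli1 (F : nat -> set T) (M : R) : (forall k, measurable (F k)) ->
  (forall n, \sum_(0 <= k < n) fine (P (F k)) <= M) ->
  {ae P, forall w, exists n0, forall n, (n0 <= n)%N -> ~ F n w}.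
Proof.
move=> mF FM.
have h0 : P (lim_sup_set F) = 0.
  apply: lim_sup_set_cvg0 => //; apply: (@le_lt_trans _ _ M%:E); last exact: ltry.
  apply: lime_le; first exact: is_cvg_nneseries.
  near=> n; rewrite (eq_bigr (fun k => (fine (P (F k)))%:E)); last first.
    by move=> k _; rewrite fineK// fin_num_measure.
  by rewrite sumEFin lee_fin.
exists (lim_sup_set F); split => //.
  apply: bigcap_measurableType => n _.
  by apply: bigcup_measurable => k _.
move=> w /= h n _ /=; apply: contrapT => hn; apply: h; exists n => k nk Fk.
by apply: hn; exists k.
Unshelve. all: by end_near.
Qed.
End borel_cantelli.

(** * From Euler sums to the Levy area *)

Section levy_convergence.
Context {d : measure_display} {T : measurableType d} {R : realType}.
Variables (P : probability T R) (W1 W2 A : R -> T -> R).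
Hypotheses (bm : is_BM2 P W1 W2) (la : is_levy_area P W1 W2 A).
Local Notation mean := (mean P).
Local Notation all_moments := (all_moments P).
Local Notation step q := ((2 ^+ q)^-1 : R).
Local Notation dya := (@dya R).
Local Notation earea := (earea W1 W2).
Local Notation freeze_err := (freeze_err W1 W2).

(** Left-point sum over K blocks of j cells of level q. Euler sums of coarser levels and the sums
    [levy_sum] at dyadic times are both of this form, hence comparable on a common grid. *)
Definition coarse (q j K : nat) (w : T) : R :=
  \sum_(0 <= k < K) 2^-1 *
    (W1 (dya q (j * k)) w * (W2 (dya q (j * k.+1)) w - W2 (dya q (j * k)) w) -
     W2 (dya q (j * k)) w * (W1 (dya q (j * k.+1)) w - W1 (dya q (j * k)) w)).

Let dya0 q : dya q 0 = 0. Proof. by rewrite /dya mul0r. Qed.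

Let disp10 q l w : disp W1 q 0 l w = W1 (dya q l) w.
Proof. by have [_ /(_ w)[h _] _ _] := bm; rewrite /disp dya0 h subr0. Qed.
Let disp20 q l w : disp W2 q 0 l w = W2 (dya q l) w.
Proof. by have [_ /(_ w)[_ h] _ _] := bm; rewrite /disp dya0 h subr0. Qed.

Lemma coarse_err q j K w : (0 < j)%N ->
  coarse q j K w = earea q 0 (j * K) w - freeze_err q j (j * K) w.
Proof.
move=> j0.
have block k i : (i <= j)%N -> earea q 0 (j * k + i) w - freeze_err q j (j * k + i) w =
    earea q 0 (j * k) w - freeze_err q j (j * k) w + 2^-1 *
    (W1 (dya q (j * k)) w * (W2 (dya q (j * k + i)) w - W2 (dya q (j * k)) w) -
     W2 (dya q (j * k)) w * (W1 (dya q (j * k + i)) w - W1 (dya q (j * k)) w)).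
  elim: i => [|i ih] ij; first by rewrite !addn0 !subrr !mulr0 subr0 mulr0 addr0.
  rewrite addnS eareaS// [freeze_err _ _ (_ + _).+1 _]big_nat_recr//= -/(freeze_err _ _ _ _) opprD addrACA.
  rewrite (ih (ltnW ij)) !disp10 !disp20.
  have -> : (j * k + i - (j * k + i) %% j = j * k)%N.
    by rewrite mulnC modnMDl modn_small// addnK.
  by rewrite /disp /incr; ring.
elim: K => [|K ih]; first by rewrite /coarse muln0 !big_geq// earea0 /freeze_err big_geq// subr0.
by rewrite /coarse big_nat_recr//= -/(coarse _ _ _ _) ih mulnS addnC (block K j (leqnn j)).
Qed.

Lemma levy_sum_coarse p j m w : levy_sum W1 W2 m (dya p j) w = coarse (p + m) j (2 ^ m) w.
Proof.
have e k : dya p j * k%:R / 2 ^+ m = dya (p + m) (j * k).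
  by rewrite /dya natrM exprD invfM; ring.
rewrite /levy_sum /coarse mulr_sumr big_mkord; apply: eq_bigr => k _.
by rewrite !e.
Qed.

Lemma earea_coarse p j r w : earea p 0 j w = coarse (p + r) (2 ^ r) j w.
Proof.
rewrite /earea /coarse; apply: eq_big_nat => k _.
have e i : dya (p + r) (2 ^ r * i) = dya p i by rewrite mulnC dya_refine.
by rewrite disp10 disp20 !e.
Qed.

Lemma chebyshev_freeze q j n (eps : R) : (0 < j)%N -> 0 < eps ->
  fine (P [set w | eps < `|freeze_err q j n w|]) <= 2^-1 * n%:R * j%:R * step q ^+ 2 / eps ^+ 2.
Proof.
move=> j0 e0; have [mE hE] := freeze_err_mean bm q n j0.
have e20 : 0 < eps ^+ 2 by rewrite exprn_gt0.
rewrite ler_pdivlMr// mulrC; apply: le_trans hE.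
apply: le_trans (markov_mean (all_momentsX 2 mE) _ e20); last by move=> w; exact: sqr_ge0.
have m2 := (all_momentsX 2 mE).1.
rewrite ler_pM2l//; apply: fine_prob_le.
- by apply: measurable_gt_set; apply: measurableT_comp => //; case: mE.
- exact: measurable_ge_set.
move=> w /= h; rewrite -(real_normK (num_real (freeze_err q j n w))).
by rewrite lerXn2r ?nnegrE// ltW.
Qed.

Lemma measurable_earea q m i : measurable_fun setT (earea q m i).
Proof. by have [] := all_moments_earea bm q m i. Qed.

Lemma measurable_levy_sum m t : measurable_fun setT (levy_sum W1 W2 m t).
Proof.
have [mW _ _ _] := bm; rewrite /levy_sum; apply: measurable_funM => //.
apply: measurable_sum => k; apply: measurable_funB; apply: measurable_funM;
  by [exact: (mW _).1|exact: (mW _).2|apply: measurable_funB; [exact: (mW _).1|exact: (mW _).1]|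
      apply: measurable_funB; [exact: (mW _).2|exact: (mW _).2]].
Qed.

(** [levy_sum] cuts [[0, t]] into [2 ^ m] pieces, which for [t = j / 2 ^ p] are blocks of j cells of
    level p + m. Both sums are therefore compared with the Euler sum of that level; as m grows, only
    the error of the coarse Euler sum, frozen on blocks of [2 ^ m] cells, survives. *)
Lemma earea_tail p j (eps : R) : 0 < eps ->
  fine (P [set w | 3 * eps < `|earea p 0 j w - A (dya p j) w|]) <=
  2^-1 * j%:R * step p ^+ 2 / eps ^+ 2.
Proof.
move=> e0; have [mA _ Acvg] := la.
have mB (U V : T -> R) c : measurable_fun setT U -> measurable_fun setT V ->
    measurable [set w | c < `|U w - V w|].
  by move=> mU mV; apply: measurable_gt_set; apply: measurableT_comp => //; exact: measurable_funB.
set x0 := dya p j; set K := 2^-1 * _ * _ / _.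
have x00 : 0 <= x0 by exact: dya_ge0.
pose b (m : nat) := fine (P [set w | eps < `|levy_sum W1 W2 m x0 w - A x0 w|]).
pose K2 := 2^-1 * j%:R ^+ 2 * step p ^+ 2 / eps ^+ 2.
have bcvg : b @ \oo --> (0 : R).
  by have /fine_cvgP[] := Acvg _ x00 _ e0.
have main m : fine (P [set w | 3 * eps < `|earea p 0 j w - A x0 w|]) <= K + K2 * 2^-1 ^+ m + b m.
  pose E1 := [set w | eps < `|earea p 0 j w - earea (p + m) 0 (j * 2 ^ m) w|].
  pose E2 := [set w | eps < `|earea (p + m) 0 (j * 2 ^ m) w - levy_sum W1 W2 m x0 w|].
  pose E3 := [set w | eps < `|levy_sum W1 W2 m x0 w - A x0 w|].
  have mE1 : measurable E1 by apply: mB; exact: measurable_earea.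
  have mE2 : measurable E2 by apply: mB; [exact: measurable_earea|exact: measurable_levy_sum].
  have mE3 : measurable E3 by apply: mB => //; exact: measurable_levy_sum.
  have mE : measurable [set w | 3 * eps < `|earea p 0 j w - A x0 w|].
    by apply: mB => //; exact: measurable_earea.
  have h12 : fine (P [set w | 3 * eps < `|earea p 0 j w - A x0 w|]) <= fine (P (E1 `|` E2 `|` E3)).
    apply: fine_prob_le => //; first by apply: measurableU => //; exact: measurableU.
    move=> w /= hw; apply: contrapT => /not_orP[/not_orP[/negP + /negP +] /negP +].
    rewrite -!leNgt => h1 h2 h3.
    have := ler_distD (earea (p + m) 0 (j * 2 ^ m) w) (earea p 0 j w) (A x0 w).
    have := ler_distD (levy_sum W1 W2 m x0 w) (earea (p + m) 0 (j * 2 ^ m) w) (A x0 w).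
    lra.
  have hU := fine_probU P (measurableU _ _ mE1 mE2) mE3.
  have hU' := fine_probU P mE1 mE2.
  have h1 : fine (P E1) <= K.
    have -> : E1 = [set w | eps < `|freeze_err (p + m) (2 ^ m) (2 ^ m * j) w|].
      rewrite /E1; apply/seteqP; split => w /=; rewrite (earea_coarse p j m) coarse_err ?expn_gt0// [(j * _)%N]mulnC;
      by rewrite addrAC subrr add0r normrN.
    apply: (le_trans (chebyshev_freeze _ _ _ e0)); first by rewrite expn_gt0.
    rewrite ler_pM2r ?invr_gt0 ?exprn_gt0//.
    rewrite natrM natrX exprD invfM exprMn le_eqVlt; apply/orP; left; apply/eqP.
    by field; rewrite ?expf_neq0.
  have h2 : fine (P E2) <= K2 * 2^-1 ^+ m.
    have [j0|j0] := posnP j.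
      rewrite /K2 /E2 (_ : [set _ | _] = set0) ?measure0 ?j0 /=.
        by rewrite expr0n /= !(mulr0, mul0r).
      apply/seteqP; split => w //=; rewrite /x0 levy_sum_coarse j0 mul0n earea0 /coarse.
      rewrite big1 ?subrr ?normr0 ?ltNge ?(ltW e0)// => i _.
      by rewrite !mul0n !subrr !mulr0 subr0 mulr0.
    have -> : E2 = [set w | eps < `|freeze_err (p + m) j (j * 2 ^ m) w|].
      rewrite /E2; apply/seteqP; split => w /=; rewrite /x0 levy_sum_coarse coarse_err//;
      by rewrite opprB addrCA subrr addr0.
    apply: (le_trans (chebyshev_freeze _ _ j0 e0)).
    rewrite /K2 [leRHS]mulrAC ler_pM2r ?invr_gt0 ?exprn_gt0//.
    rewrite natrM natrX exprD invfM !exprMn le_eqVlt; apply/orP; left; apply/eqP.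
    by rewrite exprVn; field; rewrite ?expf_neq0.
  have -> : b m = fine (P E3) by [].
  lra.
have cv : (fun m => K + K2 * 2^-1 ^+ m + b m) @ \oo --> K.
  rewrite -[X in _ --> X]addr0; apply: cvgD => //.
  rewrite -[X in _ --> X]addr0; apply: cvgD; first exact: cvg_cst.
  rewrite -(mulr0 K2); apply: cvgM; first exact: cvg_cst.
  by apply: cvg_expr; rewrite ger0_norm; lra.
rewrite -(cvg_lim _ cv)//; apply: limr_ge; first by apply/cvg_ex; exists K.
by apply: nearW => m; exact: main.
Qed.

(** The almost sure property through which the Levy area is used from here on; the later pathwise
    arguments assume it. *)
Definition area_cvg (w : T) := forall p j,
  (fun q => earea (p + q) 0 (j * 2 ^ q) w) @ \oo --> A (dya p j) w.

(** At a fixed dyadic time and tolerance the deviation probability decays like [2^-n] in the level,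
    so Borel-Cantelli applies; dyadic times and tolerances are countable. *)
Lemma ae_area_cvg : {ae P, forall w, area_cvg w}.
Proof.
apply: ae_foralln => p; apply: ae_foralln => j.
have [mA _ _] := la.
have main k : {ae P, forall w, exists n0, forall n, (n0 <= n)%N ->
    `|earea (p + n) 0 (j * 2 ^ n) w - A (dya p j) w| <= 3 * k.+1%:R^-1}.
  pose e : R := k.+1%:R^-1; have e0 : 0 < e by rewrite invr_gt0.
  pose F n := [set w | 3 * e < `|earea (p + n) 0 (j * 2 ^ n) w - A (dya p j) w|].
  pose K := 2^-1 * j%:R / e ^+ 2.
  have K0 : 0 <= K by rewrite divr_ge0 ?sqr_ge0// mulr_ge0.
  have FK n : fine (P (F n)) <= K * 2^-1 ^+ n.
    have := @earea_tail (p + n) (j * 2 ^ n) e e0; rewrite dya_refine => h.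
    apply: (le_trans h); rewrite /K [leRHS]mulrAC ler_pM2r ?invr_gt0 ?exprn_gt0//.
    rewrite natrM natrX -!mulrA ler_wpM2l// ler_wpM2l//.
    have a0 : 0 < (2 : R) ^+ n by exact: exprn_gt0.
    have b1 : 1 <= (2 : R) ^+ p by rewrite exprn_ege1// ler1n.
    rewrite exprD invfM exprMn exprVn.
    rewrite (_ : 2 ^+ n * _ = (2 ^+ p)^-1 ^+ 2 * (2 ^+ n)^-1); last by field; rewrite ?expf_neq0.
    by rewrite ler_piMl ?invr_ge0 ?(ltW a0)// exprn_ile1 ?invr_ge0 ?invf_le1 ?exprn_gt0 ?exprn_ge0.
  have mF n : measurable (F n).
    apply: measurable_gt_set; apply: measurableT_comp => //; apply: measurable_funB => //.
    exact: measurable_earea.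
  have := @borel_cantelli1 _ _ _ P F (2 * K) mF.
  move=> /(_ _)/wrap[].
    move=> n; apply: (@le_trans _ _ (\sum_(0 <= i < n) K * 2^-1 ^+ i)).
      by apply: ler_sum => i _; exact: FK.
    rewrite -mulr_sumr mulrC ler_wpM2r//.
    have : \sum_(0 <= i < n) (2^-1 : R) ^+ i = 2 - 2 * 2^-1 ^+ n.
      elim: n => [|n ih]; first by rewrite big_geq// expr0 mulr1 subrr.
      by rewrite big_nat_recr//= ih exprS; field.
    by move=> ->; rewrite gerBl mulr_ge0// exprn_ge0.
  apply: filterS => w [n0 h]; exists n0 => n /h /negP.
  by rewrite -leNgt.
have := ae_foralln main; apply: filterS => w h; apply/cvgrPdist_le => e e0.
have [k hk] : exists k : nat, 3 * k.+1%:R^-1 <= e.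
  exists (Num.truncn (3 / e)); rewrite ler_pdivrMr// mulrC -ler_pdivrMr//.
  by rewrite ltW// Num.Theory.truncnS_gt.
have [n0 hn0] := h k; exists n0 => // n /= nn; rewrite distrC; apply: le_trans hk.
exact: hn0.
Qed.
End levy_convergence.

(** * Past, future and the zero-one law *)

Section almost_sure.
Context {d : measure_display} {T : measurableType d} {R : realType}.
Variable P : probability T R.

Lemma ae_prob_le (E F : set T) : measurable E -> measurable F ->
  {ae P, forall w, E w -> F w} -> (P E <= P F)%E.
Proof.
move=> mE mF [N [mN N0 EFN]].
have sub : E `<=` F `|` N.
  move=> w Ew; have [Fw|nF] := pselect (F w); [by left|right].
  by apply: EFN => /= /(_ Ew).
apply: (@le_trans _ _ (P (F `|` N))); first by apply: le_measure => //; rewrite inE//; exact: measurableU.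
rewrite -[leRHS]adde0 -N0; exact: measureU2.
Qed.

Lemma ae_prob_eq (E F : set T) : measurable E -> measurable F ->
  {ae P, forall w, E w <-> F w} -> P E = P F.
Proof.
move=> mE mF h; apply/eqP; rewrite eq_le; apply/andP; split; apply: ae_prob_le => //;
by apply: filterS h => w [].
Qed.

Lemma prob1_ae (E : set T) : measurable E -> P E = 1%E -> {ae P, forall w, E w}.
Proof.
move=> mE P1; exists (~` E); split => //; first exact: measurableC.
by rewrite probability_setC// P1 subee.
Qed.

Lemma prob0_ae (E : set T) : measurable E -> P E = 0%E -> {ae P, forall w, ~ E w}.
Proof. by move=> mE P0; exists E; split => // w /= /contrapT. Qed.

Lemma ae_prob1 (E : set T) : measurable E -> {ae P, forall w, E w} -> P E = 1%E.
Proof.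
move=> mE h; rewrite -(probability_setT P); apply: ae_prob_eq => //.
by apply: filterS h.
Qed.
End almost_sure.

Section filtration.
Context {d : measure_display} {T : measurableType d} {R : realType}.
Variables (P : probability T R) (W1 W2 : R -> T -> R).
Hypotheses (bm : is_BM2 P W1 W2).
Local Notation rect := (rect W1 W2).

(** [past] and [future] are unions over all levels of sigma-algebras that grow with the level;
    raising two events to a common level shows that such a union is a pi-system. *)
Definition past (N : nat) : set (set T) := [set E | exists q, <<s rect q 0 (N * 2 ^ q) >> E].
Definition future (N : nat) : set (set T) :=
  [set E | exists q n, <<s rect q (N * 2 ^ q) n >> E].

Let sub_sigma_rect q m n m' n' : (m' <= m)%N -> (n <= n')%N ->
  <<s rect q m n >> `<=` <<s rect q m' n' >>.
Proof. by move=> mm nn; apply: sub_smallest2r; [exact: smallest_sigma_algebra|exact: sub_rect]. Qed.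

Let past_raise N q q' : (q <= q')%N ->
  <<s rect q 0 (N * 2 ^ q) >> `<=` <<s rect q' 0 (N * 2 ^ q') >>.
Proof.
move=> qq; have := @sigma_rect_refine _ _ _ W1 W2 q (q' - q) 0 (N * 2 ^ q).
by rewrite muln0 subnKC// mulnCA -expnD subnK.
Qed.

Let future_raise N q q' n : (q <= q')%N ->
  <<s rect q (N * 2 ^ q) n >> `<=` <<s rect q' (N * 2 ^ q') (2 ^ (q' - q) * n) >>.
Proof.
move=> qq; have := @sigma_rect_refine _ _ _ W1 W2 q (q' - q) (N * 2 ^ q) n.
by rewrite subnKC// mulnCA -expnD subnK.
Qed.

Lemma past_measurable N : past N `<=` measurable.
Proof. by move=> E [q]; apply: sub_sigma_measurable; exact: (rect_measurable bm). Qed.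
Lemma future_measurable N : future N `<=` measurable.
Proof. by move=> E [q [n]]; apply: sub_sigma_measurable; exact: (rect_measurable bm). Qed.

Let sigmaI (C : set (set T)) E F : <<s C >> E -> <<s C >> F -> <<s C >> (E `&` F).
Proof. exact: (@measurableI _ (g_sigma_algebraType C)). Qed.

Let sigmaT (C : set (set T)) : <<s C >> setT.
Proof. exact: (@measurableT _ (g_sigma_algebraType C)). Qed.

Lemma past_setI N : setI_closed (past N).
Proof.
move=> E F [q hE] [q' hF]; exists (maxn q q'); apply: sigmaI.
- by apply: past_raise hE; exact: leq_maxl.
- by apply: past_raise hF; exact: leq_maxr.
Qed.

Lemma future_setI N : setI_closed (future N).
Proof.
move=> E F [q [n hE]] [q' [n' hF]]; set Q := maxn q q'.
exists Q, (maxn (2 ^ (Q - q) * n) (2 ^ (Q - q') * n')); apply: sigmaI.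
- apply: (@sub_sigma_rect Q (N * 2 ^ Q) (2 ^ (Q - q) * n)) => //; first exact: leq_maxl.
  by apply: future_raise hE; exact: leq_maxl.
- apply: (@sub_sigma_rect Q (N * 2 ^ Q) (2 ^ (Q - q') * n')) => //; first exact: leq_maxr.
  by apply: future_raise hF; exact: leq_maxr.
Qed.

Lemma past_setT N : past N setT. Proof. by exists 0%N; exact: sigmaT. Qed.
Lemma future_setT N : future N setT. Proof. by exists 0%N, 0%N; exact: sigmaT. Qed.

Lemma past_future_indep N : indep_sys P <<s past N >> <<s future N >>.
Proof.
apply: indep_sigma; by [exact: past_measurable|exact: future_measurable|exact: past_setI|
  exact: future_setI|exact: past_setT|exact: future_setT|
  move=> E F [q hE] [q' [n hF]]; set Q := maxn q q';
  apply: (@sigma_rect_indep _ _ _ P W1 W2 bm Q 0 (N * 2 ^ Q) (maxn (N * 2 ^ Q) (2 ^ (Q - q') * n)));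
  [exact: leq_maxl|apply: past_raise hE; exact: leq_maxl|
   apply: (@sub_sigma_rect Q (N * 2 ^ Q) (2 ^ (Q - q') * n)) => //; [exact: leq_maxr|];
   apply: future_raise hF; exact: leq_maxr]].
Qed.

Lemma past_le N M : (N <= M)%N -> past N `<=` past M.
Proof. by move=> NM E [q hE]; exists q; apply: sub_sigma_rect hE; rewrite ?leq_mul2r ?NM ?orbT. Qed.

(* [EN N] only sees the increments after time [N], so [E] is independent of itself. *)
Lemma zero_one (E : set T) (EN : nat -> set T) : measurable E ->
  (forall N, <<s future N >> (EN N)) -> (forall N, {ae P, forall w, E w <-> EN N w}) ->
  P E = 0%E \/ P E = 1%E.
Proof.
move=> mE fE eE.
pose C := [set F | exists N, past N F].
have mEN N : measurable (EN N).
  by apply: sub_sigma_measurable (fE N); exact: future_measurable.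
have Cm : C `<=` measurable by move=> F [N]; exact: past_measurable.
have CI : setI_closed C.
  move=> F F' [N hF] [M hF']; exists (maxn N M); apply: past_setI.
  - by apply: past_le hF; exact: leq_maxl.
  - by apply: past_le hF'; exact: leq_maxr.
have CT : C setT by exists 0%N; exact: past_setT.
have ind : indep_sys P C [set E].
  move=> F _ [N hF] ->.
  have mF : measurable F by exact: past_measurable hF.
  rewrite (@ae_prob_eq _ _ _ P (F `&` E) (F `&` EN N)).
  - rewrite (ae_prob_eq mE (mEN N) (eE N)); apply: (@past_future_indep N) => //.
    exact: sub_sigma_algebra.
  - exact: measurableI.
  - exact: measurableI.
  by apply: filterS (eE N) => w h /=; rewrite h.
have sE : [set E] `<=` measurable by move=> _ ->.
have ind' := indep_sigmal Cm sE CI CT ind.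
(* An event on finitely many cells after time 0 lies in the past of some later integer time. *)
have C0 : <<s C >> (EN 0%N).
  have : future 0 `<=` C.
    move=> F [q [n hF]]; exists n, q; apply: sub_sigma_rect hF; rewrite ?mul0n//.
    by rewrite leq_pmulr// expn_gt0.
  by move=> h; apply: sub_smallest2r h _ (fE 0%N); exact: smallest_sigma_algebra.
(* As [EN 0] agrees with E almost surely, this reads [P E = P E ^ 2]. *)
have := ind' _ _ C0 erefl.
rewrite (@ae_prob_eq _ _ _ P (EN 0%N `&` E) E) ?(ae_prob_eq mE (mEN 0%N) (eE 0%N))//; last 2 first.
- exact: measurableI.
- by apply: filterS (eE 0%N) => w h /=; split => [[]//|Ew]; split => //; apply/h.
have f : P (EN 0%N) \is a fin_num by exact: fin_num_measure.
rewrite -(fineK f) -EFinM => -[] h; set x := fine _ in h *.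
have /eqP : x * (x - 1) = 0 by rewrite mulrBr mulr1 -h subrr.
by rewrite mulf_eq0 subr_eq0 => /orP[/eqP ->|/eqP ->]; [left|right].
Qed.
End filtration.

(** * Confinement of the path during a block of time *)

Section block_events.
Context {d : measure_display} {T : measurableType d} {R : realType}.
Variables (P : probability T R) (W1 W2 A : R -> T -> R).
Hypotheses (bm : is_BM2 P W1 W2) (la : is_levy_area P W1 W2 A).
Local Notation dya := (@dya R).
Local Notation earea := (earea W1 W2).
Local Notation state := (state W1 W2).
Local Notation rect := (rect W1 W2).
Local Notation area_cvg := (area_cvg W1 W2 A).
Local Notation past := (past W1 W2).
Local Notation future := (future W1 W2).
Local Notation alive_set := (alive_set W1 W2).

(* The path [g_N^-1 g_s] in the Heisenberg group. *)
Definition hstate (N : nat) (s : R) (w : T) : R * R * R :=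
  (W1 s w - W1 N%:R w, W2 s w - W2 N%:R w,
   A s w - A N%:R w - 2^-1 * (W1 N%:R w * (W2 s w - W2 N%:R w) - W2 N%:R w * (W1 s w - W1 N%:R w))).

Definition stays (N t : nat) (x : R) : set T :=
  [set w | forall p j, (N * 2 ^ p <= j <= t * 2 ^ p)%N -> hq (hstate N (dya p j) w) <= x].

(* Almost surely equal to [stays], but measurable for the increments between [N] and [t]. *)
Definition safe (N t : nat) (x : R) : set T :=
  [set w | forall p j, (N * 2 ^ p <= j <= t * 2 ^ p)%N -> forall m, exists r0, forall r,
     (r0 <= r)%N -> hq (state (p + r) (N * 2 ^ (p + r)) (j * 2 ^ r) w) <= x + m.+1%:R^-1].

Lemma dya_nat p N : dya p (N * 2 ^ p) = N%:R.
Proof. by rewrite -[p in LHS]add0n dya_refine /dya expr0 divr1. Qed.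

(** Discrete form of the group law: the area accumulated from m on is the vertical coordinate of the
    inverse of [g_m] times [g_i]. *)
Lemma earea_shift q m i w : (m <= i)%N -> earea q m i w =
  earea q 0 i w - earea q 0 m w - 2^-1 * (W1 (dya q m) w * disp W2 q m i w - W2 (dya q m) w * disp W1 q m i w).
Proof.
have [_ /(_ w)[h1 h2] _ _] := bm.
move=> mi; rewrite -(subnKC mi); elim: (i - m)%N => [|k ih].
  by rewrite addn0 earea0 !disp0 !mulr0 subrr subr0 mulr0 subr0.
rewrite addnS !eareaS ?leq_addr// ih !dispS /disp (_ : dya q 0 = 0) ?h1 ?h2; last by rewrite /dya mul0r.
by rewrite /incr; ring.
Qed.

Lemma state_cvg w N p j : area_cvg w -> (N * 2 ^ p <= j)%N ->
  (fun r => hq (state (p + r) (N * 2 ^ (p + r)) (j * 2 ^ r) w)) @ \oo --> hq (hstate N (dya p j) w).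
Proof.
move=> cw Nj; have eN r : (N * 2 ^ (p + r) = N * 2 ^ p * 2 ^ r)%N by rewrite expnD mulnA.
have e r : state (p + r) (N * 2 ^ (p + r)) (j * 2 ^ r) w =
    (W1 (dya p j) w - W1 N%:R w, W2 (dya p j) w - W2 N%:R w,
     earea (p + r) 0 (j * 2 ^ r) w - earea (p + r) 0 (N * 2 ^ p * 2 ^ r) w -
     2^-1 * (W1 N%:R w * (W2 (dya p j) w - W2 N%:R w) - W2 N%:R w * (W1 (dya p j) w - W1 N%:R w))).
  rewrite /state earea_shift; last by rewrite eN leq_mul2r Nj orbT.
  by rewrite /disp !dya_refine !dya_nat eN.
rewrite (_ : (fun r => _) = (fun r => hq (W1 (dya p j) w - W1 N%:R w, W2 (dya p j) w - W2 N%:R w,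
     earea (p + r) 0 (j * 2 ^ r) w - earea (p + r) 0 (N * 2 ^ p * 2 ^ r) w -
     2^-1 * (W1 N%:R w * (W2 (dya p j) w - W2 N%:R w) - W2 N%:R w * (W1 (dya p j) w - W1 N%:R w))))); last first.
  by apply/funext => r; rewrite e.
rewrite /hq /hstate /=; apply: cvgD; first exact: cvg_cst.
rewrite [X in _ --> X]expr2; under eq_fun do rewrite expr2.
suff h : (fun r => earea (p + r) 0 (j * 2 ^ r) w - earea (p + r) 0 (N * 2 ^ p * 2 ^ r) w -
     2^-1 * (W1 N%:R w * (W2 (dya p j) w - W2 N%:R w) - W2 N%:R w * (W1 (dya p j) w - W1 N%:R w))) @ \oo -->
    A (dya p j) w - A N%:R w - 2^-1 * (W1 N%:R w * (W2 (dya p j) w - W2 N%:R w) - W2 N%:R w * (W1 (dya p j) w - W1 N%:R w)).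
  exact: cvgM.
apply: cvgB; last exact: cvg_cst.
apply: cvgB; first exact: cw.
by rewrite -(dya_nat p N); exact: cw.
Qed.

Lemma safeP w N t x : area_cvg w -> safe N t x w <-> stays N t x w.
Proof.
move=> cw; split => h p j pj; have /andP[Nj _] := pj; have cv := state_cvg cw Nj.
- rewrite -(cvg_lim _ cv)//; apply/ler_addgt0Pr => e e0.
  have [m hm] : exists m : nat, m.+1%:R^-1 <= e.
    exists (Num.truncn e^-1); rewrite invf_ple ?posrE// ltW// Num.Theory.truncnS_gt//.
  have [r0 hr0] := h p j pj m.
  apply: limr_le; first by apply/cvg_ex; eexists; exact: cv.
  by exists r0 => // r /= /hr0 hr; apply: (le_trans hr); rewrite lerD2l.
- move=> m; have m0 : 0 < m.+1%:R^-1 :> R by rewrite invr_gt0.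
  move/cvgrPdist_lt : cv => /(_ _ m0)[r0 _ hr0].
  exists r0 => r /hr0 /=; have := h p j pj; rewrite distrC => hx hd.
  by apply: le_trans (lerD hx (ltW (le_lt_trans (ler_norm _) hd))); rewrite addrC subrK.
Qed.

Lemma safe_sigma (C : set (set T)) N t x :
  (forall p j r c, (N * 2 ^ p <= j <= t * 2 ^ p)%N ->
    <<s C >> [set w | hq (state (p + r) (N * 2 ^ (p + r)) (j * 2 ^ r) w) <= c]) ->
  <<s C >> (safe N t x).
Proof.
move=> h; rewrite (_ : safe N t x = \bigcap_p \bigcap_(j in [set j | (N * 2 ^ p <= j <= t * 2 ^ p)%N])
  \bigcap_m \bigcup_r0 \bigcap_(r in [set r | (r0 <= r)%N])
  [set w | hq (state (p + r) (N * 2 ^ (p + r)) (j * 2 ^ r) w) <= x + m.+1%:R^-1]).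
  do !(apply: (@bigcap_measurableType _ (g_sigma_algebraType C)) => ? ?).
  apply: (@bigcup_measurable _ (g_sigma_algebraType C)) => r0 _.
  apply: (@bigcap_measurableType _ (g_sigma_algebraType C)) => r ?.
  exact: h.
apply/seteqP; split => w /=.
- move=> hw p _ j pj m _; have [r0 hr] := hw p j pj m.
  by exists r0 => // r /hr.
- move=> hw p j pj m; have [r0 _ hr] := hw p I j pj m I.
  by exists r0 => r /hr.
Qed.

Let level_event q m i c : (m <= i)%N -> <<s rect q m i >> [set w | hq (state q m i w) <= c].
Proof.
move=> mi; have := @adapted_state _ _ _ W1 W2 q m i _ _ _ mi (@measurable_hball R c).
move=> /(_ measurableT [set true] I); rewrite setTI; congr (_ _).
Qed.

Lemma safe_future N t x : <<s future N >> (safe N t x).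
Proof.
apply: safe_sigma => p j r c /andP[Nj jt]; apply: sub_sigma_algebra.
exists (p + r)%N, (j * 2 ^ r)%N; apply: level_event.
by rewrite expnD mulnA leq_mul2r Nj orbT.
Qed.

Lemma safe_past N t x : <<s past t >> (safe N t x).
Proof.
apply: safe_sigma => p j r c /andP[Nj jt]; apply: sub_sigma_algebra.
exists (p + r)%N; have Nj' : (N * 2 ^ (p + r) <= j * 2 ^ r)%N.
  by rewrite expnD mulnA leq_mul2r Nj orbT.
have := @level_event (p + r)%N _ _ c Nj'; apply: sub_smallest2r; first exact: smallest_sigma_algebra.
by apply: sub_rect => //; rewrite expnD mulnA leq_mul2r jt orbT.
Qed.

Lemma measurable_safe N t x : measurable (safe N t x).
Proof. by apply: sub_sigma_measurable (@safe_future N t x); exact: (future_measurable bm). Qed.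

(** The probability of a limsup of events is at least the limsup of their probabilities. If the
    chain survives on infinitely many levels, each fixed dyadic time lies on all fine grids, and
    convergence of the area carries the bound over to the path. *)
Lemma safe_prob_ge (S : R * R * R -> bool) N t x rho q0 :
  measurable_fun setT S -> (forall y, S y -> hq y <= x) ->
  (forall q, (q0 <= q)%N -> rho <= fine (P (alive_set S q (N * 2 ^ q) (t * 2 ^ q)))) ->
  rho <= fine (P (safe N t x)).
Proof.
move=> mS Sx hrho.
pose F q := alive_set S q (N * 2 ^ q) (t * 2 ^ q).
have mF q : measurable (F q) by exact: (measurable_alive_set bm).
have mL : measurable (lim_sup_set F).
  by apply: bigcap_measurableType => n _; apply: bigcup_measurable.
have h1 : rho <= fine (P (lim_sup_set F)).
  have := @lim_sup_set_cvg _ _ _ P F mF.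
  move=> /(_ _)/wrap[]; first by rewrite ltey_eq fin_num_measure//; exact: bigcup_measurable.
  move=> cv; rewrite -lee_fin fineK ?fin_num_measure// -(cvg_lim _ cv)//.
  apply: lime_ge; first by apply/cvg_ex; eexists; exact: cv.
  exists q0 => // q /= qq; have := hrho q qq; rewrite -/(F q) -lee_fin fineK ?fin_num_measure//.
  move=> hh; apply: (le_trans hh); apply: le_measure; rewrite ?inE//; first exact: bigcup_measurable.
  by move=> w Fw; exists q => /=.
apply: (le_trans h1); apply: fine_le; rewrite ?fin_num_measure//; try exact: measurable_safe.
apply: ae_prob_le => //; first exact: measurable_safe.
apply: filterS (ae_area_cvg bm la) => w cw Lw; apply/(safeP _ _ _ cw) => p j /andP[Nj jt].
have cv := state_cvg cw Nj; apply/ler_addgt0Pr => e e0.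
move/cvgrPdist_lt : cv => /(_ _ e0)[r0 _ hr0].
have [q pq Fq] := Lw (p + r0)%N I.
pose r := (q - p)%N; have pr : (p + r = q)%N by rewrite subnKC// (leq_trans _ pq)// leq_addr.
have /hr0 /= : (r0 <= r)%N by rewrite leq_subRL ?(leq_trans _ pq)// leq_addr.
have : hq (state (p + r) (N * 2 ^ (p + r)) (j * 2 ^ r) w) <= x.
  by apply: Sx; rewrite pr; apply: Fq; rewrite -pr expnD !mulnA !leq_mul2r Nj jt !orbT.
by have := ler_norm (hq (hstate N (dya p j) w) - hq (state (p + r) (N * 2 ^ (p + r)) (j * 2 ^ r) w)); lra.
Qed.

Lemma safe_maximal t (c : R) : 0 < c ->
  1 - (c ^+ 2 * t%:R ^+ 2 / 4 + 2 * c * t%:R) <= fine (P (safe 0 t (2 / c ^+ 2))).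
Proof.
move=> c0; apply: (@safe_prob_ge (hball (2 / c ^+ 2)) 0 t _ _ 0) => //.
  exact: measurable_hball.
move=> q _; have := @euler_maximal _ _ _ P W1 W2 bm q (0 * 2 ^ q) (t * 2 ^ q) c c0.
by rewrite mul0n subn0 natrM natrX mulfK ?expf_neq0//; apply.
Qed.

Section ground_state.
Variable sz : R.
Hypotheses (sz0 : 0 < sz) (bz : bessel 0 sz = 0)
  (bpos : forall x, 0 <= x -> x < sz -> 0 < bessel 0 x).

(** The prefactor is independent of al, be and the times, as the divergence of a series over blocks
    with growing radii requires. The factor 1/4 is what is left after the truncation and the
    discretisation. *)
Lemma safe_lower (al be : R) N t : 0 < al -> 0 < be -> (N <= t)%N ->
  let mu := sz / al ^+ 2 / 2 + (pi / (2 * be)) ^+ 2 * al ^+ 2 / 8 in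
  expR (- sz) / 4 * expR (- (mu * (t - N)%:R)) <= fine (P (safe N t (al ^+ 4 + be ^+ 2))).
Proof.
move=> al0 be0 Nt; set mu := (_ + _ : R) => /=.
have mu0 : 0 < mu.
  by rewrite ltr_pwDl// ?divr_gt0 ?exprn_gt0// ltW// !mulr_gt0 ?invr_gt0 ?exprn_gt0 ?divr_gt0 ?pi_gt0 ?mulr_gt0.
set tt := (t - N)%:R; have tt0 : 0 <= tt by [].
set X := expR (- (mu * tt)); have X0 : 0 < X by exact: expR_gt0.
(* The errors sum to at most [4 D tt <= X / 4], out of the [X / 2] that remains because eps is at
   most one half. *)
pose D := X / 16 / (1 + tt); have D0 : 0 < D by rewrite !divr_gt0// ltr_pwDl.
have Dt : D * tt <= X / 16.
  rewrite /D mulrAC ler_pdivrMr ?ltr_pwDl// ler_wpM2l ?divr_ge0 ?(ltW X0)//.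
  by rewrite lerDr.
pose eps := Num.min 2^-1 (D / mu); have e0 : 0 < eps by rewrite lt_min invr_gt0 ltr0n divr_gt0.
have e2 : eps <= 2^-1 by rewrite ge_min lexx.
have eD : mu * eps <= D.
  by rewrite -ler_pdivlMl// mulrC ge_min lexx orbT.
have [C C0 hC] := euler_cyl_lower bm sz0 bz bpos al0 be0 e0 D0.
pose q0 := Num.truncn (C / D).
have mS : measurable_fun setT (cyl al be).
  apply: measurable_and; apply: measurable_fun_ltr => //; first exact: measurable_nv2.
  by apply: measurable_funX; exact: measurable_snd.
apply: (@safe_prob_ge (cyl al be) N t _ _ q0) => //.
  move=> y /andP[y1 y2]; rewrite /hq; apply: lerD; last exact: ltW.
  rewrite -[4%N]/(2 * 2)%N exprM; apply: lerXn2r (ltW y1); by rewrite nnegrE ?sqr_ge0// addr_ge0 ?sqr_ge0.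
move=> q qq; have := hC q (N * 2 ^ q)%N (t * 2 ^ q)%N; rewrite leq_mul2r Nt orbT => /(_ isT).
rewrite -/mu -mulnBl natrM natrX mulfK ?expf_neq0// -/tt -/X.
have Ch : C * (2 ^+ q)^-1 <= D.
  rewrite ler_pdivrMr ?exprn_gt0// mulrC -ler_pdivrMr//.
  apply: (le_trans (ltW (Num.Theory.truncnS_gt _))); rewrite -natrX ler_nat.
  by apply: (leq_ltn_trans qq); exact: ltn_expl.
have h1 : (mu * eps + 2 * D + C / 2 ^+ q) * tt <= 4 * D * tt.
  by rewrite ler_wpM2r//; lra.
have h2 : X * 2^-1 <= X * (1 - eps) by rewrite ler_pM2l//; lra.
rewrite mulrAC ler_pdivrMr// -ler_pdivlMl ?expR_gt0// expRN invrK => h3.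
rewrite mulrA; lra.
Qed.

(** Dyadic times of one level contain the grid of the chain, so E lies in the survival event of
    every level. Eta and the level are chosen after an arbitrary tolerance e, which disposes of the
    discretisation error. *)
Lemma disk_upper (th : R) : 0 < th -> th < 1 -> exists2 K : R, 0 < K &
  forall e2 t (E : set T), 0 < e2 -> measurable E ->
  (forall w, E w -> forall p j, (j <= t * 2 ^ p)%N ->
     W1 (dya p j) w ^+ 2 + W2 (dya p j) w ^+ 2 <= e2) ->
  fine (P E) <= K * expR (- (sz * th / e2 / 2 * t%:R)).
Proof.
move=> th0 th1; have [m0 m00 hm0] := euler_disk_upper bm sz0 bpos th0 th1.
exists m0^-1; first by rewrite invr_gt0.
move=> e2 t E e20 mE hE; rewrite -ler_pdivrMl ?invr_gt0// invrK.
apply/ler_addgt0Pr => e e0; set X := expR _.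
pose D := e / (4 * (1 + t%:R)); have D0 : 0 < D by rewrite divr_gt0// mulr_gt0// ltr_pwDl.
have [C C0 hC] := hm0 e2 D e20 D0.
pose q := Num.truncn (C / D); have := hC q 0%N (t * 2 ^ q)%N (leq0n _).
rewrite subn0 natrM natrX mulfK ?expf_neq0// -/X.
have Ch : C * (2 ^+ q)^-1 <= D.
  rewrite ler_pdivrMr ?exprn_gt0// mulrC -ler_pdivrMr//.
  apply: (le_trans (ltW (Num.Theory.truncnS_gt _))); rewrite -natrX ler_nat.
  exact: ltn_expl.
have h1 : (2 * D + C / 2 ^+ q) * t%:R <= e.
  apply: (@le_trans _ _ (3 * D * (1 + t%:R))).
    apply: ler_pM => //; [|lra|lra].
    by rewrite addr_ge0 ?mulr_ge0 ?invr_ge0 ?exprn_ge0// ltW.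
  have t1 : 0 < 1 + t%:R :> R by rewrite ltr_pwDl.
  by rewrite (_ : 3 * D * _ = 3 / 4 * e); [lra|rewrite /D; field; rewrite gt_eqF].
have h2 : m0 * fine (P E) <= m0 * fine (P (alive_set (disk e2) q 0 (t * 2 ^ q))).
  rewrite ler_pM2l//; apply: fine_prob_le => //.
    by apply: (measurable_alive_set bm); exact: measurable_disk.
  have [_ h0 _ _] := bm.
  move=> w Ew l /andP[_ lt]; have [a b] := h0 w.
  by rewrite /disk /disp /= (_ : dya q 0 = 0) ?a ?b ?subr0; [exact: hE|rewrite /dya mul0r].
lra.
Qed.
End ground_state.
End block_events.

(** * The normalisation and left translations *)

Section normalisation.
Context {R : realType}.
Implicit Types a b s t x : R.

(** Square of the radius for which [phi t * radius = a]; hence the condition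
    [hq <= rad a t ^+ 2]. *)
Definition rad a t : R := a ^+ 2 * t / ln (ln t).

(** From this time on both [ln t] and [ln (ln t)] are at least 1. *)
Definition ee : R := expR (expR 1).

Lemma ln_le_sub1 x : 0 < x -> ln x <= x - 1.
Proof. by move=> x0; have := expR_ge1Dx (ln x); rewrite lnK ?posrE//; lra. Qed.

Let e1 : 1 <= expR 1 :> R. Proof. by have := expR_ge1Dx (1 : R); lra. Qed.

Lemma ee_ln t : ee <= t -> [/\ 0 < t, 1 <= ln t & 1 <= ln (ln t)].
Proof.
move=> et; have t0 : 0 < t by exact: lt_le_trans (expR_gt0 _) et.
have lt : expR 1 <= ln t by rewrite -(expRK (expR 1)) ler_ln// ?posrE// expR_gt0.
have l1 : 1 <= ln t by exact: le_trans lt.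
split => //; rewrite -{1}(expRK 1) ler_ln// ?posrE ?expR_gt0//.
exact: lt_le_trans l1.
Qed.

Lemma lnln_mono s t : ee <= s -> s <= t -> ln (ln s) <= ln (ln t).
Proof.
move=> es st; have [s0 s1 s2] := ee_ln es; have [t0 t1 t2] := ee_ln (le_trans es st).
by rewrite ler_ln ?posrE ?(lt_le_trans _ s1) ?(lt_le_trans _ t1)// ler_ln.
Qed.

(** [ln x <= x - 1], used at [t / s] and at [ln t / ln s], gives [ln (ln t) <= t / s * ln (ln s)],
    since beyond [ee] both [ln s] and [ln (ln s)] are at least 1. *)
Lemma rad_mono a s t : ee <= s -> s <= t -> rad a s <= rad a t.
Proof.
move=> es st; have [s0 s1 s2] := ee_ln es; have [t0 t1 t2] := ee_ln (le_trans es st).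
have ls0 : 0 < ln s by exact: lt_le_trans s1.
have lt0 : 0 < ln t by exact: lt_le_trans t1.
rewrite /rad -[leLHS]mulrA -[leRHS]mulrA ler_wpM2l ?sqr_ge0//.
rewrite ler_pdivrMr ?(lt_le_trans _ s2)// mulrAC ler_pdivlMr ?(lt_le_trans _ t2)//.
have ts0 : 0 < t / s by rewrite divr_gt0.
have h1 : ln t - ln s <= t / s - 1 by rewrite -ln_div ?posrE// ln_le_sub1.
have h2 : ln (ln t) - ln (ln s) <= ln t / ln s - 1.
  by rewrite -ln_div ?posrE// ln_le_sub1 ?divr_gt0.
have lst : 0 <= ln t - ln s by rewrite subr_ge0 ler_ln.
have h3 : ln t / ln s - 1 <= ln t - ln s.
  rewrite -[X in _ - X](@mulfV _ (ln s)) ?gt_eqF// -mulrBl ler_pdivrMr//.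
  by rewrite ler_peMr.
have h4 : t / s - 1 <= (t / s - 1) * ln (ln s).
  by rewrite ler_peMr// subr_ge0 ler_pdivlMr// mul1r.
have h5 : ln (ln t) <= t / s * ln (ln s) by lra.
have := ler_wpM2l (ltW s0) h5; rewrite mulrA (mulrCA s) mulfV ?gt_eqF// mulr1; lra.
Qed.

Lemma rad_gt0 a t : 0 < a -> ee <= t -> 0 < rad a t.
Proof.
by move=> a0 et; have [t0 t1 t2] := ee_ln et; rewrite divr_gt0 ?mulr_gt0 ?exprn_gt0// (lt_le_trans _ t2).
Qed.

Lemma rad_ge a t : ee <= t -> a ^+ 2 * Num.sqrt t / 2 <= rad a t.
Proof.
move=> et; have [t0 t1 t2] := ee_ln et.
have s0 : 0 < Num.sqrt t by rewrite sqrtr_gt0.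
have st : t = Num.sqrt t * Num.sqrt t by rewrite -expr2 sqr_sqrtr// ltW.
rewrite /rad -[leLHS]mulrA -[leRHS]mulrA ler_wpM2l ?sqr_ge0// ler_pdivrMr// mulrAC ler_pdivlMr ?(lt_le_trans _ t2)//.
rewrite {3}st -mulrA ler_pM2l//.
have h1 := ln_le_sub1 (lt_le_trans ltr01 t1).
have h2 : ln t = ln (Num.sqrt t) + ln (Num.sqrt t) by rewrite {1}st lnM ?posrE.
have := ln_le_sub1 s0; lra.
Qed.

Lemma rad_unbounded a K : 0 < a -> exists2 t0 : R, ee <= t0 & forall t, t0 <= t -> K <= rad a t.
Proof.
move=> a0; pose s := Num.max 0 (2 * K / a ^+ 2); exists (Num.max ee (s ^+ 2)).
  by rewrite le_max lexx.
move=> t; rewrite ge_max => /andP[et st]; apply: le_trans (rad_ge a et).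
have s0 : 0 <= s by rewrite le_max lexx.
have : s <= Num.sqrt t by rewrite -(ger0_norm s0) -sqrtr_sqr ler_wsqrtr.
rewrite ge_max => /andP[_]; rewrite ler_pdivrMr ?exprn_gt0//; lra.
Qed.

Lemma rad_scale a b t : 0 < b -> rad a t = (a / b) ^+ 2 * rad b t.
Proof. by move=> b0; rewrite /rad [RHS]mulrA [in RHS]mulrA -exprMn divfK ?gt_eqF. Qed.

Lemma lnX_ub (n : nat) : (0 < n)%N -> ln ((n`!)%:R : R) <= n%:R * ln n%:R.
Proof.
move=> n0; rewrite mulr_natl -lnXn ?ltr0n// ler_ln ?posrE ?ltr0n ?fact_gt0 ?exprn_gt0 ?ltr0n//.
rewrite -natrX ler_nat; elim: n {n0} => [//|n ih]; rewrite factS expnS leq_mul2l /=.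
by apply: (leq_trans ih); case: n {ih} => // n; rewrite leq_exp2r.
Qed.

End normalisation.

(** * Left translations and homogeneous balls *)

Section translation.
Context {R : realType}.

Definition hmul (g y : R * R * R) : R * R * R :=
  (g.1.1 + y.1.1, g.1.2 + y.1.2, g.2 + y.2 + 2^-1 * (g.1.1 * y.1.2 - g.1.2 * y.1.1)).

(** Quasi-triangle inequality with an explicit loss. The horizontal norms multiply in the cross
    terms, so a squared radius [del^2 r] for g makes them at most [del r]; expanding the two squares
    yields 23 = 6 + 4 + 13. *)
Lemma hmul_ball (g y : R * R * R) (del r : R) : 0 <= del -> del <= 1 -> 0 <= r ->
  hq g <= (del ^+ 2 * r) ^+ 2 -> hq y <= r ^+ 2 -> hq (hmul g y) <= r ^+ 2 * (1 + 23 * del).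
Proof.
move: g y => [[g1 g2] g3] [[y1 y2] y3] d0 d1 r0.
rewrite /hq /hmul /= => hg hy.
set G := g1 ^+ 2 + g2 ^+ 2 in hg; set Y := y1 ^+ 2 + y2 ^+ 2 in hy *.
have G0 : 0 <= G by rewrite addr_ge0 ?sqr_ge0.
have Y0 : 0 <= Y by rewrite addr_ge0 ?sqr_ge0.
have s0 : 0 <= del ^+ 2 * r by rewrite mulr_ge0 ?sqr_ge0.
have sq_le (u v : R) : 0 <= v -> u ^+ 2 <= v ^+ 2 -> `|u| <= v.
  by move=> v0; rewrite -[u ^+ 2]real_normK ?num_real// ler_pXn2r ?nnegrE.
have hG : G <= del ^+ 2 * r.
  by rewrite -(ger0_norm G0); apply: sq_le => //; have := sqr_ge0 g3; lra.
have hg3 : `|g3| <= del ^+ 2 * r by apply: sq_le => //; have := sqr_ge0 G; lra.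
have hY : Y <= r by rewrite -(ger0_norm Y0); apply: sq_le => //; have := sqr_ge0 y3; lra.
have hy3 : `|y3| <= r by apply: sq_le => //; have := sqr_ge0 Y; lra.
have GY : G * Y <= (del * r) ^+ 2.
  by rewrite (_ : (del * r) ^+ 2 = del ^+ 2 * r * r); [exact: ler_pM|ring].
have dr0 : 0 <= del * r by rewrite mulr_ge0.
have om : `|g1 * y2 - g2 * y1| <= del * r.
  apply: sq_le => //; apply: le_trans GY.
  by have := sqr_ge0 (g1 * y1 + g2 * y2); rewrite /G /Y; nra.
have dt : `|g1 * y1 + g2 * y2| <= del * r.
  apply: sq_le => //; apply: le_trans GY.
  by have := sqr_ge0 (g1 * y2 - g2 * y1); rewrite /G /Y; nra.
have d2 : del ^+ 2 * r <= del * r by rewrite ler_wpM2r// expr2 ler_piMl.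
have vv : (g1 + y1) ^+ 2 + (g2 + y2) ^+ 2 <= Y + 3 * (del * r).
  have -> : (g1 + y1) ^+ 2 + (g2 + y2) ^+ 2 = G + Y + 2 * (g1 * y1 + g2 * y2) by rewrite /G /Y; ring.
  have := ler_norm (g1 * y1 + g2 * y2); lra.
have zz : `|g3 + y3 + 2^-1 * (g1 * y2 - g2 * y1)| <= `|y3| + 2 * (del * r).
  apply: (le_trans (ler_normD _ _)); have := ler_normD g3 y3.
  by rewrite normrM (ger0_norm (_ : 0 <= 2^-1)) ?invr_ge0//; lra.
have vv0 : 0 <= (g1 + y1) ^+ 2 + (g2 + y2) ^+ 2 by rewrite addr_ge0 ?sqr_ge0.
have v2 : ((g1 + y1) ^+ 2 + (g2 + y2) ^+ 2) ^+ 2 <= (Y + 3 * (del * r)) ^+ 2.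
  by rewrite lerXn2r ?nnegrE// addr_ge0// mulr_ge0.
have z2 : (g3 + y3 + 2^-1 * (g1 * y2 - g2 * y1)) ^+ 2 <= (`|y3| + 2 * (del * r)) ^+ 2.
  by rewrite -[leLHS]real_normK ?num_real// lerXn2r ?nnegrE// addr_ge0// mulr_ge0.
apply: (le_trans (lerD v2 z2)).
have y32 : `|y3| ^+ 2 = y3 ^+ 2 by rewrite real_normK ?num_real.
have h1 : Y * (del * r) <= r * (del * r) by rewrite ler_wpM2r.
have h2 : `|y3| * (del * r) <= r * (del * r) by rewrite ler_wpM2r.
have h3 : (del * r) ^+ 2 <= r * (del * r).
  by rewrite expr2 ler_wpM2r// ler_piMl.
rewrite [leLHS](_ : _ = Y ^+ 2 + `|y3| ^+ 2 + 6 * (Y * (del * r)) + 4 * (`|y3| * (del * r)) + 13 * (del * r) ^+ 2); last by ring.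
rewrite (_ : r ^+ 2 * _ = r ^+ 2 + 23 * (r * (del * r))); last by ring.
lra.
Qed.
End translation.

(** * Level sets of the liminf as tail events *)

Section tail_events.
Context {d : measure_display} {T : measurableType d} {R : realType}.
Variables (P : probability T R) (W1 W2 A : R -> T -> R).
Hypotheses (bm : is_BM2 P W1 W2) (la : is_levy_area P W1 W2 A).
Local Notation dya := (@dya R).
Local Notation area_cvg := (area_cvg W1 W2 A).
Local Notation past := (past W1 W2).
Local Notation future := (future W1 W2).
Local Notation hstate := (hstate W1 W2 A).
Local Notation stays := (stays W1 W2 A).
Local Notation safe := (safe W1 W2).

(** Integer times suffice, because the normalisation changes by a factor close to 1 between
    consecutive integers. *)
Definition small_io (N : nat) (a : R) : set T :=
  [set w | forall n0, exists2 t, (n0 <= t)%N & safe N t (rad a t%:R ^+ 2) w].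

(** Intersecting over tolerances matches the non-strict inequality [liminf <= a], and makes the
    event insensitive to the small losses of a left translation. *)
Definition small_liminf (N : nat) (a : R) : set T :=
  [set w | forall m, small_io N (a + m.+1%:R^-1) w].

Definition stays_io (N : nat) (a : R) : set T :=
  [set w | forall n0, exists2 t, (n0 <= t)%N & stays N t (rad a t%:R ^+ 2) w].

Lemma small_ioP w N a : area_cvg w -> small_io N a w <-> stays_io N a w.
Proof.
by move=> cw; split => h n0; have [t tn /(safeP bm _ _ _ cw) ?] := h n0; exists t.
Qed.

Lemma small_io_future N a : <<s future N >> (small_io N a).
Proof.
rewrite (_ : small_io N a = \bigcap_n0 \bigcup_(t in [set t | (n0 <= t)%N]) safe N t (rad a t%:R ^+ 2)).
  apply: (@bigcap_measurableType _ (g_sigma_algebraType (future N))) => n0 _.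
  apply: (@bigcup_measurable _ (g_sigma_algebraType (future N))) => t _.
  exact: safe_future.
apply/seteqP; split => w h n0; first by move=> _; have [t] := h n0; exists t.
by have [t] := h n0 I; exists t.
Qed.

Lemma small_liminf_future N a : <<s future N >> (small_liminf N a).
Proof.
rewrite (_ : small_liminf N a = \bigcap_m small_io N (a + m.+1%:R^-1)).
  apply: (@bigcap_measurableType _ (g_sigma_algebraType (future N))) => m _.
  exact: small_io_future.
by apply/seteqP; split => w h m; [move=> _|]; apply: h.
Qed.

Lemma measurable_small_liminf N a : measurable (small_liminf N a).
Proof. by apply: sub_sigma_measurable (@small_liminf_future N a); exact: (future_measurable bm). Qed.

Lemma hstate_mul N s w : hstate 0 s w = hmul (hstate 0 N%:R w) (hstate N s w).
Proof.
have [_ /(_ w)[h1 h2] _ _] := bm.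
rewrite /hmul /hstate /= h1 h2; congr (_, _, _); by [ring|field].
Qed.

Definition hopp (g : R * R * R) : R * R * R := (- g.1.1, - g.1.2, - g.2).

Lemma hstate_mulV N s w : hstate N s w = hmul (hopp (hstate 0 N%:R w)) (hstate 0 s w).
Proof.
have [_ /(_ w)[h1 h2] _ _] := bm.
rewrite /hmul /hopp /hstate /= h1 h2; congr (_, _, _); by [ring|field].
Qed.

Lemma hq_opp g : hq (hopp g) = hq g.
Proof. by rewrite /hq /hopp /= !sqrrN. Qed.

Lemma path_continuous (w : T) : {within `[0, +oo[, continuous (fun s => hq (hstate 0 s w))}.
Proof.
have [_ _ /(_ w)[c1 c2] _] := bm; have [_ /(_ w) cA _] := la.
have [_ /(_ w)[h1 h2] _ _] := bm.
rewrite (_ : (fun s => _) = (fun s => (W1 s w * W1 s w + W2 s w * W2 s w) * (W1 s w * W1 s w + W2 s w * W2 s w) + (A s w - A 0 w) * (A s w - A 0 w))); last first.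
  by apply/funext => s; rewrite /hq /hstate /= h1 h2; ring.
move=> s; have k1 := c1 s; have k2 := c2 s; have k3 := cA s.
have k12 := continuousD (continuousM k1 k1) (continuousM k2 k2).
have k3' := continuousB k3 (@cst_continuous _ _ (A 0 w) s).
exact: (continuousD (continuousM k12 k12) (continuousM k3' k3')).
Qed.

(** Chooses del so that passing from a1 to a2 pays for the loss in [hmul_ball]. *)
Lemma rad_gap a1 a2 : 0 < a1 -> a1 < a2 -> exists2 del : R, 0 < del <= 1 &
  forall t, ee <= t -> rad a1 t ^+ 2 * (1 + 23 * del) <= rad a2 t ^+ 2.
Proof.
move=> a10 a12; pose k := (a2 / a1) ^+ 4; have a20 := lt_trans a10 a12.
have k1 : 1 < k by rewrite exprn_egt1// ltr_pdivlMr// mul1r.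
exists (Num.min 1 ((k - 1) / 23)); first by rewrite lt_min ltr01 divr_gt0 ?subr_gt0//= ge_min lexx.
move=> t et; rewrite (rad_scale a2 t a10) (_ : (_ * _) ^+ 2 = rad a1 t ^+ 2 * k); last by rewrite /k; ring.
rewrite ler_wpM2l ?sqr_ge0//.
have : Num.min 1 ((k - 1) / 23) <= (k - 1) / 23 by rewrite ge_min lexx orbT.
by rewrite -/k; lra.
Qed.

Lemma path_bound (w : T) (N : nat) : exists2 K : R, 0 <= K &
  forall s, 0 <= s -> s <= N%:R -> hq (hstate 0 s w) <= K.
Proof.
have N0 : 0 <= N%:R :> R by [].
have [|c c0 hc] := EVT_max N0 (f := fun s => hq (hstate 0 s w)).
  have := @path_continuous w; apply: continuous_subspaceW.
  by move=> s /=; rewrite !in_itv /= andbT => /andP[].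
exists (hq (hstate 0 c w)); first by rewrite /hq addr_ge0 ?sqr_ge0.
by move=> s s0 sN; apply: hc; rewrite in_itv /= s0.
Qed.

Lemma large_rad (a del K : R) n0 : 0 < a -> 0 < del -> 0 <= K -> exists2 n1 : nat, (n0 <= n1)%N &
  forall t, (n1 <= t)%N -> ee <= t%:R :> R /\ K <= (del ^+ 2 * rad a t%:R) ^+ 2.
Proof.
move=> a0 d0 K0; have [t0 et0 ht0] := rad_unbounded ((K + 1) / del ^+ 2) a0.
exists (maxn n0 (Num.truncn t0).+1); first exact: leq_maxl.
move=> t; rewrite geq_max => /andP[_ nt].
have tt : t0 <= t%:R by rewrite (le_trans (ltW (Num.Theory.truncnS_gt t0)))// ler_nat.
split; first exact: le_trans tt.
have := ht0 _ tt; rewrite ler_pdivrMr ?exprn_gt0// mulrC => h.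
have : (K + 1) ^+ 2 <= (del ^+ 2 * rad a t%:R) ^+ 2.
  by rewrite lerXn2r ?nnegrE ?addr_ge0// (le_trans _ h)// addr_ge0.
by apply: le_trans; have := sqr_ge0 K; rewrite sqrrD1; lra.
Qed.

Lemma dya_le_nat p j N : (j <= N * 2 ^ p)%N -> dya p j <= N%:R.
Proof.
by move=> jN; rewrite /dya ler_pdivrMr ?exprn_gt0// -natrX -natrM ler_nat.
Qed.

Lemma stays_mul w N t (del r : R) : 0 <= del -> del <= 1 -> 0 <= r ->
  stays 0 N ((del ^+ 2 * r) ^+ 2) w -> stays N t (r ^+ 2) w -> stays 0 t (r ^+ 2 * (1 + 23 * del)) w.
Proof.
move=> d0 d1 r0 hK hs p j /andP[_ jt]; have [Nj|jN] := leqP (N * 2 ^ p) j.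
  rewrite (hstate_mul N); apply: hmul_ball => //; last by apply: hs; rewrite Nj.
  by rewrite -(dya_nat 0 N); apply: hK; rewrite mul0n leqnn.
have jN' : (0 * 2 ^ p <= j <= N * 2 ^ p)%N by rewrite mul0n leq0n ltnW.
apply: (le_trans (hK _ _ jN')).
apply: (@le_trans _ _ (r ^+ 2)); last by rewrite ler_peMr ?sqr_ge0//; lra.
have d2 : 0 <= del ^+ 2 <= 1 by rewrite sqr_ge0 exprn_ile1.
rewrite lerXn2r ?nnegrE ?mulr_ge0 ?sqr_ge0// ler_piMl//; by case/andP: d2.
Qed.

Lemma stays_io_shift w N a1 a2 : 0 < a1 -> a1 < a2 -> stays_io N a1 w -> stays_io 0 a2 w.
Proof.
move=> a10 a12 h n0; have [del /andP[d0 d1] hd] := rad_gap a10 a12.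
have [K K0 hK] := path_bound w N; have [n1 n01 hn1] := large_rad n0 a10 d0 K0.
have [t tn st] := h n1; have [et Kt] := hn1 _ tn; exists t; first exact: leq_trans tn.
have r0 := ltW (rad_gt0 a10 et).
have hK' : stays 0 N ((del ^+ 2 * rad a1 t%:R) ^+ 2) w.
  by move=> p j /andP[_ jN]; apply: le_trans Kt; apply: hK; rewrite ?dya_ge0 ?dya_le_nat.
move=> p j pj; apply: le_trans (hd _ et).
exact: (stays_mul (ltW d0) d1 r0 hK' st).
Qed.

Lemma stays_io_unshift w N a1 a2 : 0 < a1 -> a1 < a2 -> stays_io 0 a1 w -> stays_io N a2 w.
Proof.
move=> a10 a12 h n0; have [del /andP[d0 d1] hd] := rad_gap a10 a12.
have [K K0 hK] := path_bound w N; have [n1 n01 hn1] := large_rad n0 a10 d0 K0.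
have [t tn st] := h n1; have [et Kt] := hn1 _ tn; exists t; first exact: leq_trans tn.
move=> p j /andP[_ jt]; apply: le_trans (hd _ et).
rewrite (hstate_mulV N); apply: hmul_ball => //.
- exact: ltW.
- exact: ltW (rad_gt0 a10 et).
- by rewrite hq_opp; apply: le_trans Kt; exact: hK.
- by apply: st; rewrite mul0n.
Qed.

Lemma small_liminf_shift w N a : area_cvg w -> 0 < a -> small_liminf 0 a w <-> small_liminf N a w.
Proof.
move=> cw a0.
(* Starting from the tolerance [1 / (2 m + 2)] leaves a strict gap below [1 / (m + 1)] for the
   translation. *)
have gap m : a + (m.*2.+1).+1%:R^-1 < a + m.+1%:R^-1 :> R.
  by rewrite ltrD2l ltf_pV2 ?posrE// ltr_nat !ltnS -addnn leq_addr.
have a0' m : 0 < a + m.+1%:R^-1 by rewrite addr_gt0// invr_gt0.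
split => h m; apply/(small_ioP _ _ cw).
- by apply: stays_io_unshift (a0' _) (gap m) _; apply/(small_ioP _ _ cw); exact: h.
- by apply: stays_io_shift (a0' _) (gap m) _; apply/(small_ioP _ _ cw); exact: h.
Qed.

Lemma small_liminf_zero_one a : 0 < a ->
  P (small_liminf 0 a) = 0%E \/ P (small_liminf 0 a) = 1%E.
Proof.
move=> a0; apply: (zero_one bm (EN := fun N => small_liminf N a)).
- exact: measurable_small_liminf.
- by move=> N; exact: small_liminf_future.
- by move=> N; apply: filterS (ae_area_cvg bm la) => w cw; exact: small_liminf_shift.
Qed.

End tail_events.

(** * Borel-Cantelli lemmas along blocks *)

Section series_bounds.
Context {R : realType}.

Lemma harmonic_unbounded (M : R) : exists n, M <= \sum_(0 <= k < n) k.+1%:R^-1.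
Proof.
apply: contrapT => h; apply: (@dvg_harmonic R).
apply: nondecreasing_is_cvgn.
  apply/nondecreasing_seqP => n; rewrite /series /= big_nat_recr//= lerDl.
  by rewrite /harmonic /= invr_ge0.
exists M => _ [n _ <-]; rewrite leNgt; apply/negP => hM; apply: h; exists n.
exact: ltW.
Qed.

Lemma harmonic_shift_unbounded (c M : R) k0 : 0 < c ->
  exists n, M <= \sum_(0 <= k < n) c / (k.+1 + k0)%:R.
Proof.
move=> c0; have [n hn] := harmonic_unbounded (M * (k0.+1)%:R / c); exists n.
move: hn; rewrite ler_pdivrMr// [leRHS]mulrC mulr_sumr -ler_pdivlMr// => h; apply: (le_trans h).
rewrite mulr_suml; apply: ler_sum => k _; rewrite -mulrA ler_pM2l// -invfM lef_pV2 ?posrE ?ltr0n ?addn_gt0//.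
by rewrite -natrM ler_nat mulnS leq_add2l leq_pmull.
Qed.

(** Telescopes by [1 / (x + 1)^2 <= 1 / x - 1 / (x + 1)]. *)
Lemma square_sum_bounded (c : R) k0 n : 0 <= c -> (0 < k0)%N ->
  \sum_(0 <= k < n) c / (k.+1 + k0)%:R ^+ 2 <= c.
Proof.
move=> c0 k00; rewrite -mulr_sumr -[leRHS]mulr1 ler_wpM2l//.
suff : \sum_(0 <= k < n) ((k.+1 + k0)%:R ^+ 2)^-1 <= k0%:R^-1 - (n + k0)%:R^-1 :> R.
  move=> h; apply: (le_trans h); rewrite lerBlDr (le_trans (_ : _ <= 1))// ?lerDl ?invr_ge0//.
  by rewrite invf_le1 ?ltr0n// ler1n.
elim: n => [|n ih]; first by rewrite big_geq// subrr.
rewrite big_nat_recr//=.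
have a0 : 0 < (n + k0)%:R :> R by rewrite ltr0n addn_gt0 k00 orbT.
suff : ((n.+1 + k0)%:R ^+ 2)^-1 <= (n + k0)%:R^-1 - (n.+1 + k0)%:R^-1 :> R by lra.
rewrite addSn -[(n + k0).+1]addn1 natrD; set x := (n + k0)%:R in a0 *.
have x1 : 0 < x + 1 by lra.
clearbody x; rewrite -subr_ge0 (_ : _ - _ = (x * (x + 1) ^+ 2)^-1); last first.
  by field; rewrite (gt_eqF a0) (gt_eqF x1).
by rewrite invr_ge0 mulr_ge0 ?sqr_ge0// ltW.
Qed.

(** The sum of [k^-(1 + s)], telescoped against [k^-s / s]; powers are written with [expR] and [ln],
    as they occur in the probability estimates. *)
Lemma power_sum_bounded (s : R) n : 0 < s ->
  \sum_(0 <= k < n) expR (- ((1 + s) * ln k.+1%:R)) <= 1 + s^-1.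
Proof.
move=> s0.
suff : \sum_(0 <= k < n.+1) expR (- ((1 + s) * ln k.+1%:R)) <= 1 + s^-1 * (1 - expR (- (s * ln n.+1%:R))).
  move=> h; have : \sum_(0 <= k < n) expR (- ((1 + s) * ln k.+1%:R)) <=
      \sum_(0 <= k < n.+1) expR (- ((1 + s) * ln k.+1%:R)) :> R.
    by rewrite big_nat_recr//= lerDl expR_ge0.
  move=> h'; apply: (le_trans h'); apply: (le_trans h); rewrite lerD2l ler_piMr ?invr_ge0 ?(ltW s0)//.
elim: n => [|n ih].
  by rewrite big_nat1 ln1 !mulr0 oppr0 expR0 subrr mulr0 addr0.
rewrite big_nat_recr//=; apply: (le_trans (lerD ih (lexx _))).
suff : expR (- ((1 + s) * ln n.+2%:R)) <=
    s^-1 * (expR (- (s * ln n.+1%:R)) - expR (- (s * ln n.+2%:R))) :> R by lra.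
set x : R := n.+1%:R; have x0 : 0 < x by rewrite ltr0n.
have -> : n.+2%:R = x + 1 :> R by rewrite -[n.+2]addn1 natrD.
have x1 : 0 < x + 1 by lra.
rewrite (_ : - ((1 + s) * ln (x + 1)) = - ln (x + 1) + - (s * ln (x + 1))); last by ring.
rewrite expRD (expRN (ln (x + 1))) lnK ?posrE//.
have h : (x + 1)^-1 <= ln (x + 1) - ln x.
  have := @ln_le_sub1 R (x / (x + 1)); rewrite divr_gt0// => /(_ isT).
  rewrite ln_div ?posrE// (_ : x / (x + 1) - 1 = - (x + 1)^-1); first lra.
  by field; rewrite gt_eqF.
have := expR_ge1Dx (s * (ln (x + 1) - ln x)).
set b := expR (- (s * ln (x + 1))); have b0 : 0 < b by exact: expR_gt0.
have -> : expR (- (s * ln x)) = b * expR (s * (ln (x + 1) - ln x)).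
  by rewrite -expRD; congr expR; ring.
set e := expR _ => he.
rewrite ler_pdivlMl//.
have h' := ler_wpM2l (ltW s0) h.
have : b * (1 + s * (x + 1)^-1) <= b * e by rewrite ler_pM2l//; lra.
rewrite mulrDr mulr1 mulrCA [_ * b]mulrC; lra.
Qed.
End series_bounds.

Section borel_cantelli_blocks.
Context {d : measure_display} {T : measurableType d} {R : realType}.
Variables (P : probability T R) (W1 W2 : R -> T -> R).
Hypothesis (bm : is_BM2 P W1 W2).
Local Notation past := (past W1 W2).
Local Notation future := (future W1 W2).

(** [E k] is determined by the increments between [tau k] and [tau k.+1]. The event [F n] that none
    of n consecutive [E k] occurs is in the past of the next one, so its probability is at most the
    exponential of minus the sum of theirs. *)
Lemma borel_cantelli2 (tau : nat -> nat) (E : nat -> set T) :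
  {homo tau : i j / (i <= j)%N} ->
  (forall k, <<s past (tau k.+1) >> (E k)) -> (forall k, <<s future (tau k) >> (E k)) ->
  (forall M : R, exists n, M <= \sum_(0 <= k < n) fine (P (E k))) ->
  {ae P, forall w, forall n0, exists2 k, (n0 <= k)%N & E k w}.
Proof.
move=> tau_mono pE fE dvg.
have mE k : measurable (E k).
  by apply: sub_sigma_measurable (fE k); exact: (future_measurable bm).
pose x k := fine (P (E k)).
apply: ae_foralln => n0.
pose F := fix F n := if n is m.+1 then F m `&` ~` E (n0 + m)%N else setT.
have pF n : <<s past (tau (n0 + n)) >> (F n).
  elim: n => [|n ih]; first exact: (@measurableT _ (g_sigma_algebraType (past (tau (n0 + 0))))).
  apply: (@measurableI _ (g_sigma_algebraType (past (tau (n0 + n.+1))))).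
    apply: sub_smallest2r ih; first exact: smallest_sigma_algebra.
    by apply: past_le; apply: tau_mono; rewrite leq_add2l.
  apply: (@measurableC _ (g_sigma_algebraType (past (tau (n0 + n.+1))))).
  by have := pE (n0 + n)%N; rewrite -addnS.
have mF n : measurable (F n).
  by apply: sub_sigma_measurable (pF n); exact: (past_measurable bm).
have x1 k : x k <= 1.
  by rewrite -lee_fin fineK ?fin_num_measure// probability_le1.
have FE n : fine (P (F n)) <= expR (- \sum_(0 <= k < n) x (n0 + k)%N).
  elim: n => [|n ih]; first by rewrite big_geq// oppr0 expR0 (congr1 fine (probability_setT P)).
  have -> : fine (P (F n.+1)) = fine (P (F n)) * (1 - x (n0 + n)%N).
    have ind : P (F n `&` ~` E (n0 + n)%N) = (P (F n) * P (~` E (n0 + n)%N))%E.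
      apply: (@past_future_indep _ _ _ P W1 W2 bm (tau (n0 + n)%N)); first exact: pF.
      by apply: (@measurableC _ (g_sigma_algebraType (future (tau (n0 + n)%N)))); exact: fE.
    rewrite /= ind fineM ?fin_num_measure//; last exact: measurableC.
    by rewrite probability_setC// fineB ?fin_num_measure.
  rewrite big_nat_recr//= opprD expRD; apply: ler_pM => //.
  - by rewrite fine_ge0.
  - by rewrite subr_ge0.
  - by have := expR_ge1Dx (- x (n0 + n)%N); lra.
pose G := [set w | forall k, (n0 <= k)%N -> ~ E k w].
have mG : measurable G.
  rewrite (_ : G = \bigcap_(k in [set k | (n0 <= k)%N]) ~` E k); last first.
    by apply/seteqP; split => w h k; [move=> kn|]; exact: h.
  by apply: bigcap_measurableType => k _; exact: measurableC.
have GF n : G `<=` F n.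
  elim: n => [//|n ih] w Gw; split; first exact: ih.
  by apply: Gw; rewrite leq_addr.
have G0 : P G = 0%E.
  have f : P G \is a fin_num by exact: fin_num_measure.
  rewrite -(fineK f); congr EFin; apply/eqP; rewrite eq_le fine_ge0// andbT.
  apply/ler_addgt0Pr => e e0; rewrite add0r.
  have [n hn] := dvg (n0%:R - ln e).
  have h1 : \sum_(0 <= k < n0) x k <= n0%:R.
    apply: (@le_trans _ _ (\sum_(0 <= k < n0) 1)); first by apply: ler_sum.
    by rewrite big_mkord sumr_const card_ord.
  have h2 : - ln e <= \sum_(0 <= k < n) x (n0 + k)%N.
    have : \sum_(0 <= k < n) x k <= \sum_(0 <= k < n0) x k + \sum_(0 <= k < n) x (n0 + k)%N.
      have -> : \sum_(0 <= k < n0) x k + \sum_(0 <= k < n) x (n0 + k)%N = \sum_(0 <= k < n0 + n) x k.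
        elim: n {hn} => [|n ih]; first by rewrite [X in _ + X]big_geq// addr0 addn0.
        by rewrite big_nat_recr//= addrA ih addnS big_nat_recr.
      rewrite [leRHS](@big_cat_nat _ _ _ n)//= ?leq_addl// lerDl.
      by apply: sumr_ge0 => k _; exact: fine_ge0.
    by move: hn; rewrite -/(x _); lra.
  apply: (le_trans (fine_prob_le P mG (mF n) (GF n))); apply: (le_trans (FE n)).
  by rewrite -[leRHS](@lnK _ e) ?posrE// ler_expR; lra.
apply: filterS (prob0_ae mG G0) => w hw; apply: contrapT => h; apply: hw => k kn Ek.
by apply: h; exists k.
Qed.
End borel_cantelli_blocks.

(** * Almost sure bounds at the scale of the iterated logarithm *)

Section chung_bounds.
Context {d : measure_display} {T : measurableType d} {R : realType}.
Variables (P : probability T R) (W1 W2 A : R -> T -> R).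
Hypotheses (bm : is_BM2 P W1 W2) (la : is_levy_area P W1 W2 A).
Local Notation dya := (@dya R).
Local Notation stays := (stays W1 W2 A).
Local Notation safe := (safe W1 W2).
Variable sz : R.
Hypotheses (sz0 : 0 < sz) (bz : bessel 0 sz = 0)
  (bpos : forall x, 0 <= x -> x < sz -> 0 < bessel 0 x).

(** The function minimised in [c_const], with sz / 2 and pi^2 / 8 in the places of [lambda1 2] and
    [lambda1 1]. *)
Definition ub_rate (y : R) : R :=
  sz / 2 / Num.sqrt (1 - y) + pi ^+ 2 / 8 * Num.sqrt (1 - y) / (4 * y).

Lemma ub_rate_gt0 y : 0 < y < 1 -> 0 < ub_rate y.
Proof.
case/andP => y0 y1; rewrite /ub_rate.
have s0 : 0 < Num.sqrt (1 - y) by rewrite sqrtr_gt0 subr_gt0.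
by rewrite addr_gt0// ?divr_gt0// ?mulr_gt0// ?divr_gt0 ?exprn_gt0 ?pi_gt0.
Qed.

Lemma safe_lower_rad (a y : R) N t : 0 < a -> 0 < y < 1 -> (N <= t)%N -> ee <= t%:R :> R ->
  expR (- sz) / 4 * expR (- (ub_rate y / a ^+ 2 * ln (ln t%:R))) <= fine (P (safe N t (rad a t%:R ^+ 2))).
Proof.
move=> a0 y01 Nt et; have /andP[y0 y1] := y01; have ub0 := ub_rate_gt0 y01; have [t0 t1 t2] := ee_ln et.
have r0 := rad_gt0 a0 et; set r := rad a t%:R in r0 *.
have l0 : 0 < ln (ln t%:R) :> R by exact: lt_le_trans t2.
have s0 : 0 < Num.sqrt (1 - y) by rewrite sqrtr_gt0 subr_gt0.
have s2 : Num.sqrt (1 - y) ^+ 2 = 1 - y by rewrite sqr_sqrtr// subr_ge0 ltW.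
have u0 : 0 < Num.sqrt y by rewrite sqrtr_gt0.
have u2 : Num.sqrt y ^+ 2 = y by rewrite sqr_sqrtr// ltW.
pose al := Num.sqrt (Num.sqrt (1 - y) * r); pose be := Num.sqrt y * r.
have al0 : 0 < al by rewrite sqrtr_gt0 mulr_gt0.
have be0 : 0 < be by rewrite mulr_gt0.
have al2 : al ^+ 2 = Num.sqrt (1 - y) * r by rewrite sqr_sqrtr// ltW// mulr_gt0.
have := safe_lower bm la sz0 bz bpos al0 be0 Nt.
have -> : al ^+ 4 + be ^+ 2 = r ^+ 2.
  have -> : al ^+ 4 = (al ^+ 2) ^+ 2 by rewrite -exprM.
  by rewrite al2 !exprMn s2 u2; ring.
apply: le_trans; rewrite ler_pM2l ?divr_gt0 ?expR_gt0// ler_expR lerN2.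
have rr : r * ln (ln t%:R) = a ^+ 2 * t%:R by rewrite /r /rad divfK ?gt_eqF.
have -> : ub_rate y / a ^+ 2 * ln (ln t%:R) = ub_rate y / r * t%:R.
  have -> : ln (ln t%:R) = a ^+ 2 * t%:R / r by rewrite -rr [r * _]mulrC mulfK ?gt_eqF.
  by field; rewrite !gt_eqF.
have -> : sz / al ^+ 2 / 2 + (pi / (2 * be)) ^+ 2 * al ^+ 2 / 8 = ub_rate y / r.
  rewrite al2 /ub_rate /be (_ : 4 * y = 4 * Num.sqrt y ^+ 2); last by rewrite u2.
  set s := Num.sqrt (1 - y) in s0 *; set u := Num.sqrt y in u0 *.
  by field; rewrite !gt_eqF.
(* The duration t - N is bounded by t; little is lost, since N will be negligible compared with
   t. *)
by rewrite ler_wpM2l ?ler_nat ?leq_subr// divr_ge0 ?(ltW r0)// ltW.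
Qed.

Section recurrence.
Variable k0 : nat.
Hypothesis k0e : ee <= k0%:R :> R.

Let nn (k : nat) := (k.+1 + k0)%N.
(** Consecutive times have ratio [nn k ^ 3]. By [safe_maximal] the path up to [tau k] is too large
    with probability of order [ln (ln (tau k.+1)) / nn k ^ 3]; the crude bound [2 * nn k] for the
    numerator still leaves a summable [1 / nn k ^ 2]. *)
Let tau (k : nat) : nat := (((k + k0)`!) ^ 3)%N.

Let k00 : (0 < k0)%N.
Proof. by rewrite -(ltr0n R) (lt_le_trans _ k0e)// expR_gt0. Qed.

Let nnE k : ee <= (nn k)%:R :> R.
Proof. by rewrite (le_trans k0e)// ler_nat leq_addl. Qed.

Let leq_fact_self n : (n <= n`!)%N.
Proof. by case: n => // n; rewrite factS leq_pmulr// fact_gt0. Qed.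

Let tauS k : tau k.+1 = (nn k ^ 3 * tau k)%N.
Proof. by rewrite /tau /nn addSn factS expnMn. Qed.

Let tau_ge k : (nn k <= tau k.+1)%N.
Proof.
apply: (leq_trans (leq_fact_self _)); rewrite /tau -/(nn k) -[leqLHS]expn1.
by apply: leq_pexp2l => //; exact: fact_gt0.
Qed.

Let tau_ee k : ee <= (tau k.+1)%:R :> R.
Proof. by rewrite (le_trans (nnE k))// ler_nat. Qed.

Let tau_mono : {homo tau : i j / (i <= j)%N}.
Proof.
move=> i j ij; rewrite leq_exp2r// -(subnK ij) -addnA.
elim: (j - i)%N => [//|m ih]; rewrite addSn factS; apply: (leq_trans ih).
by rewrite leq_pmull.
Qed.

Let lnln_tau k : ln (ln (tau k.+1)%:R) <= 2 + ln (nn k)%:R + ln (ln (nn k)%:R) :> R.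
Proof.
have [n0 n1 n2] := ee_ln (nnE k); have [t0 t1 t2] := ee_ln (tau_ee k).
have h : ln (tau k.+1)%:R <= 3 * (nn k)%:R * ln (nn k)%:R :> R.
  rewrite /tau -/(nn k) natrX lnXn ?ltr0n ?fact_gt0// -[_ *+ 3]mulr_natl -mulrA ler_wpM2l//.
  by apply: lnX_ub; rewrite /nn addSn.
have ln0 : 0 < ln (nn k)%:R :> R by exact: lt_le_trans n1.
have h2 : ln (ln (tau k.+1)%:R) <= ln (3 * (nn k)%:R * ln (nn k)%:R) :> R.
  by rewrite ler_ln ?posrE ?mulr_gt0// (lt_le_trans _ t1).
apply: (le_trans h2); rewrite !lnM ?posrE ?mulr_gt0//.
have : ln 3 <= 3 - 1 :> R by apply: ln_le_sub1.
lra.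
Qed.

Let lnln_tau' k : ln (ln (tau k.+1)%:R) <= 2 * (nn k)%:R :> R.
Proof.
have [n0 n1 n2] := ee_ln (nnE k).
have := lnln_tau k; have := ln_le_sub1 n0.
have := @ln_le_sub1 R (ln (nn k)%:R); rewrite (lt_le_trans _ n1)// => /(_ isT); lra.
Qed.

(** [E k]: the path seen from [tau k] stays in its ball during the block, infinitely often by
    independence. [F k]: up to [tau k] the path stays in a ball of squared radius smaller by
    [del ^+ 2], for all large k. [stays_mul] joins the two, and a1 < a pays for it. *)
Lemma small_io_upper (a1 a y : R) : 0 < a1 -> a1 < a -> 0 < y < 1 -> ub_rate y < a1 ^+ 2 ->
  {ae P, forall w, small_io W1 W2 0 a w}.
Proof.
move=> a10 a1a y01 ya1; have [del /andP[del0 del1] hdel] := rad_gap a10 a1a.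
have a120 : 0 < a1 ^+ 2 by rewrite exprn_gt0.
pose rk k : R := rad a1 (tau k.+1)%:R.
have rk0 k : 0 < rk k by exact: rad_gt0.
pose E k := safe (tau k) (tau k.+1) (rk k ^+ 2).
have ub0 := ub_rate_gt0 y01.
pose rho := ub_rate y / a1 ^+ 2.
have rho0 : 0 < rho by rewrite divr_gt0.
have rho1 : rho < 1 by rewrite ltr_pdivrMr// mul1r.
have Eio : {ae P, forall w, forall n0, exists2 k, (n0 <= k)%N & E k w}.
  apply: (borel_cantelli2 bm tau_mono).
  - by move=> k; exact: safe_past.
  - by move=> k; exact: safe_future.
  (* Since rho < 1, a fraction 1 - rho of [ln (nn k)] is spare; it absorbs [ln (ln (nn k))] at the
     price of [- ln (1 - rho)], so that the probability of [E k] is at least [c / nn k]. *)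
  pose c := expR (- sz) / 4 * expR (- (2 - ln (1 - rho))).
  have c0 : 0 < c by rewrite !mulr_gt0 ?expR_gt0.
  move=> M; have [n hn] := harmonic_shift_unbounded M k0 c0.
  exists n; apply: (le_trans hn); apply: ler_sum => k _.
  apply: le_trans (safe_lower_rad a10 y01 (tau_mono (leqnSn k)) (tau_ee k)).
  rewrite /c -[leLHS]mulrA ler_pM2l ?divr_gt0 ?expR_gt0// -/(nn k).
  have [n0 n1 n2] := ee_ln (nnE k).
  rewrite -[X in _ / X](@lnK _ (nn k)%:R) ?posrE// -expRN -expRD ler_expR -/rho.
  have h := lnln_tau k; have rp : 0 < 1 - rho by rewrite subr_gt0.
  have l0 : 0 < ln (nn k)%:R :> R by exact: lt_le_trans n1.
  have := ln_le_sub1 (mulr_gt0 rp l0); rewrite lnM ?posrE//.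
  have h1 := ler_wpM2l (ltW rho0) h.
  have h2 : rho * (2 + ln (ln (nn k)%:R)) <= 2 + ln (ln (nn k)%:R).
    by rewrite ler_piMl ?(ltW rho1)//; lra.
  lra.
pose F k := safe 0 (tau k) ((del ^+ 2 * rk k) ^+ 2).
have mF k : measurable (F k) by exact: measurable_safe bm _ _ _.
pose K := 2 * Num.sqrt 2 / (del ^+ 2 * a1 ^+ 2).
have K0 : 0 <= K by apply: divr_ge0; apply: mulr_ge0; rewrite ?sqr_ge0 ?sqrtr_ge0.
have FP k : fine (P (~` F k)) <= (K ^+ 2 + 2 * K) / (k.+1 + k0)%:R ^+ 2.
  (* Makes the ball of [safe_maximal] the one in [F k]. *)
  pose c := Num.sqrt 2 / (del ^+ 2 * rk k).
  have dr0 : 0 < del ^+ 2 * rk k by rewrite mulr_gt0 ?exprn_gt0.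
  have c0 : 0 < c by rewrite divr_gt0// sqrtr_gt0.
  have := safe_maximal bm la (tau k) c0.
  have -> : 2 / c ^+ 2 = (del ^+ 2 * rk k) ^+ 2.
    by rewrite /c exprMn exprVn sqr_sqrtr// invfM invrK mulrA mulfV ?mul1r.
  rewrite probability_setC// fineB ?fin_num_measure// -/(F k).
  have [t0 t1 t2] := ee_ln (tau_ee k).
  set n : R := (k.+1 + k0)%:R.
  have n1 : 1 <= n by rewrite ler1n.
  have n0 : 0 < n by exact: lt_le_trans n1.
  have ct : c * (tau k)%:R <= K / n ^+ 2.
    have tk0 : 0 < (tau k)%:R :> R by rewrite ltr0n expn_gt0 fact_gt0.
    have -> : c * (tau k)%:R = Num.sqrt 2 / (del ^+ 2 * a1 ^+ 2) * (ln (ln (tau k.+1)%:R) / n ^+ 3).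
      have e : (tau k.+1)%:R = n ^+ 3 * (tau k)%:R :> R by rewrite tauS natrM natrX.
      have l0 : 0 < ln (ln (tau k.+1)%:R) :> R by exact: lt_le_trans t2.
      rewrite /c /rk /rad.
      move: l0; set l := ln (ln _) => l0; rewrite e.
      move: tk0; set tk := (tau k)%:R => tk0; clearbody n tk l.
      by field; rewrite !gt_eqF.
    rewrite (_ : K / n ^+ 2 = Num.sqrt 2 / (del ^+ 2 * a1 ^+ 2) * (2 / n ^+ 2)); last by rewrite /K; ring.
    apply: ler_wpM2l; first by apply: divr_ge0; [exact: sqrtr_ge0|apply: mulr_ge0; exact: sqr_ge0].
    rewrite ler_pdivrMr ?exprn_gt0// (_ : 2 / n ^+ 2 * n ^+ 3 = 2 * n); first exact: lnln_tau'.
    by field; rewrite gt_eqF.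
  have ct0 : 0 <= c * (tau k)%:R by rewrite mulr_ge0// ltW.
  have n2 : (n ^+ 2)^-1 <= 1 by rewrite invf_le1 ?exprn_gt0// exprn_ege1.
  have n20 : 0 <= (n ^+ 2)^-1 by rewrite invr_ge0 sqr_ge0.
  have ct2 : (c * (tau k)%:R) ^+ 2 <= K ^+ 2 / n ^+ 2.
    apply: (@le_trans _ _ ((K / n ^+ 2) ^+ 2)).
      by rewrite lerXn2r ?nnegrE// divr_ge0 ?sqr_ge0.
    rewrite exprMn ler_wpM2l ?sqr_ge0// [leLHS]expr2 ler_piMr//.
  rewrite exprMn in ct2.
  have c22 : 0 <= c ^+ 2 * (tau k)%:R ^+ 2 by rewrite mulr_ge0 ?sqr_ge0.
  rewrite /=; lra.
have Fev : {ae P, forall w, exists n0, forall n, (n0 <= n)%N -> ~ (~` F n) w}.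
  apply: (@borel_cantelli1 _ _ _ P _ (K ^+ 2 + 2 * K)).
    by move=> k; exact: measurableC.
  move=> n; apply: (le_trans (ler_sum _ (fun k _ => FP k))).
  apply: square_sum_bounded; last exact: k00.
  by apply: addr_ge0; [exact: sqr_ge0|exact: mulr_ge0].
have cvA := ae_area_cvg bm la.
near=> w.
have cw : area_cvg W1 W2 A w by near: w.
have Ew : forall n0, exists2 k, (n0 <= k)%N & E k w by near: w.
have [n1 Fw] : exists n0, forall n, (n0 <= n)%N -> ~ (~` F n) w by near: w.
apply/(small_ioP bm _ _ cw) => n0; have [k + Ek] := Ew (maxn n0 n1).
rewrite geq_max => /andP[kn0 kn1]; exists (tau k.+1).
  by apply: (leq_trans kn0); apply: leq_trans (tau_ge k); rewrite /nn addSn ltnW// ltnS leq_addr.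
have Fk : F k w by apply: contrapT; exact: Fw.
move=> p j pj; apply: le_trans (hdel _ (tau_ee k)).
move/(safeP bm _ _ _ cw) : Ek => Ek; move/(safeP bm _ _ _ cw) : Fk => Fk.
exact: (stays_mul bm (ltW del0) del1 (ltW (rk0 k)) Fk Ek).
Unshelve. all: by end_near.
Qed.
End recurrence.

Lemma small_io_ae (a y : R) : 0 < a -> 0 < y < 1 -> ub_rate y < a ^+ 2 ->
  {ae P, forall w, small_io W1 W2 0 a w}.
Proof.
move=> a0 y01 ya; pose k0 := (Num.truncn (ee : R)).+1.
have k0e : ee <= k0%:R :> R by rewrite ltW// Num.Theory.truncnS_gt.
have u0 := ltW (ub_rate_gt0 y01).
pose a1 := Num.sqrt ((ub_rate y + a ^+ 2) / 2).
have a12 : a1 ^+ 2 = (ub_rate y + a ^+ 2) / 2 by rewrite sqr_sqrtr// divr_ge0// addr_ge0// sqr_ge0.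
have a10 : 0 < a1 by rewrite sqrtr_gt0 divr_gt0// ltr_wpDl// exprn_gt0.
apply: (small_io_upper k0e a10 _ y01); rewrite ?a12; last lra.
by rewrite -(@ltr_pXn2r _ 2)// ?nnegrE ?(ltW a0) ?(ltW a10)// a12; lra.
Qed.

(** Four powers are needed by [not_small_io_ae]; 15 = 4 + 6 + 4 + 1 adds up the nonconstant binomial
    coefficients. *)
Let exists_eta (g : R) : 1 < g -> exists2 eta : R, 0 < eta & (1 + eta) ^+ 4 <= g.
Proof.
move=> g1; exists (Num.min 1 ((g - 1) / 15)); first by rewrite lt_min ltr01 divr_gt0// subr_gt0.
set e := Num.min _ _.
have e0 : 0 <= e by rewrite le_min ler01 divr_ge0// subr_ge0 ltW.
have e1 : e <= 1 by rewrite ge_min lexx.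
have e2 : e <= (g - 1) / 15 by rewrite ge_min lexx orbT.
have h2 : e ^+ 2 <= e by rewrite expr2 ler_piMl.
have h3 : e ^+ 3 <= e by rewrite exprS ler_piMr// exprn_ile1.
have h4 : e ^+ 4 <= e by rewrite exprS ler_piMr// exprn_ile1.
rewrite (_ : (1 + e) ^+ 4 = 1 + 4 * e + 6 * e ^+ 2 + 4 * e ^+ 3 + e ^+ 4); [lra|ring].
Qed.

Lemma expr_unbounded (r M : R) : 1 < r -> exists J, forall j, (J <= j)%N -> M <= r ^+ j.
Proof.
move=> r1; have e0 : 0 < r - 1 by rewrite subr_gt0.
have r0 : 0 < r by exact: lt_trans r1.
have b n : 1 + n%:R * (r - 1) <= r ^+ n.
  elim: n => [|n ih]; first by rewrite mul0r addr0 expr0.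
  rewrite exprS; apply: le_trans (ler_wpM2l (ltW r0) ih).
  have := mulr_ge0 (ler0n R n) (sqr_ge0 (r - 1)); rewrite -[n.+1]addn1 natrD; lra.
exists (Num.truncn (M / (r - 1))).+1 => j Jj.
apply: le_trans (_ : r ^+ (Num.truncn (M / (r - 1))).+1 <= _); last by rewrite ler_weXn2l// ltW.
apply: le_trans (b _); rewrite ler_wpDl// -ler_pdivrMr// ltW//.
exact: Num.Theory.truncnS_gt.
Qed.

Lemma geometric_bracket (r : R) (t : nat) j0 : 1 < r -> r ^+ j0 <= t%:R ->
  exists2 j, (j0 <= j)%N & r ^+ j <= t%:R < r ^+ j.+1.
Proof.
move=> r1 hj0; have r0 : 0 < r by exact: lt_trans r1.
have ex : exists J, t%:R < r ^+ J.
  have [J hJ] := expr_unbounded (t%:R + 1) r1; exists J.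
  by apply: lt_le_trans (hJ J (leqnn J)); rewrite ltrDl.
have [[|j] hj hmin] := ex_minnP ex.
  by move: (hj0); rewrite leNgt (lt_le_trans hj)// expr0 exprn_ege1// ltW.
exists j.
  rewrite leqNgt; apply/negP => jj0; move: hj; rewrite ltNge => /negP; apply.
  by apply: le_trans hj0; rewrite ler_weXn2l// ltW.
by rewrite hj andbT leNgt; apply/negP => /hmin; rewrite ltnn.
Qed.

(** The vertical coordinate is dropped. Along times [r ^ j] three powers of r are lost, one to the
    ratio of radii in [disk_upper] and two to rounding times onto the geometric grid; as
    [r ^ 4 <= g], the exponent of [1 / j] is still [r = 1 + eta], and the series converges. *)
Lemma not_small_io_ae (a : R) : 0 < a -> a ^+ 2 < sz / 2 ->
  {ae P, forall w, ~ small_io W1 W2 0 a w}.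
Proof.
move=> a0 asz; have a20 : 0 < a ^+ 2 by rewrite exprn_gt0.
pose g := sz / 2 / a ^+ 2; have g1 : 1 < g by rewrite ltr_pdivlMr// mul1r.
have [eta eta0 heta] := exists_eta g1.
pose r := 1 + eta; have r1 : 1 < r by rewrite ltrDl.
have r0 : 0 < r by exact: lt_trans r1.
have ri0 : 0 < r^-1 by rewrite invr_gt0.
have ri1 : r^-1 < 1 by rewrite invf_lt1.
have [K K0 hK] := disk_upper bm sz0 bpos ri0 ri1.
have lr0 : 0 < ln r by rewrite ln_gt0.
(* The bound [eta^-1] ensures [eta * r ^ j >= 1], which keeps the integer part of [r ^ j.+1] above
   [r ^ j]. *)
have [j1 hj1] := expr_unbounded (Num.max ee eta^-1) r1.
(* Duration at the left end, radius at the right end of [[r ^ j, r ^ j.+1]]: confinement at any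
   integer time in between implies [H j]. *)
pose H j := [set w | forall p i, (i <= Num.truncn (r ^+ j) * 2 ^ p)%N ->
   W1 (dya p i) w ^+ 2 + W2 (dya p i) w ^+ 2 <= rad a (r ^+ j.+1)].
have mH j : measurable (H j).
  rewrite (_ : H j = \bigcap_p \bigcap_(i in [set i | (i <= Num.truncn (r ^+ j) * 2 ^ p)%N])
      ~` [set w | rad a (r ^+ j.+1) < W1 (dya p i) w ^+ 2 + W2 (dya p i) w ^+ 2]).
    have [mW _ _ _] := bm.
    do 2![apply: bigcap_measurableType => ? ?]; apply: measurableC; apply: measurable_gt_set.
    by apply: measurable_funD; apply: measurable_funX; [exact: (mW _).1|exact: (mW _).2].
  apply/seteqP; split => w /=.
  - by move=> hw p _ i pi /=; apply/negP; rewrite -leNgt; exact: hw.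
  - by move=> hw p i pi; rewrite leNgt; apply/negP; exact: hw.
have PH j : (j1 < j)%N -> fine (P (H j)) <= K * expR (- (r * ln (ln r))) * expR (- ((1 + eta) * ln j.+1%:R)).
  case: j => // j; rewrite ltnS => jj.
  have := hj1 _ jj; rewrite ge_max => /andP[je jeta].
  have rj0 : 0 < r ^+ j by rewrite exprn_gt0.
  have rje : ee <= r ^+ j.+2.
    by rewrite (le_trans je)// ler_weXn2l// ?(ltW r1)// ltnW.
  have R0 := rad_gt0 a0 rje; have [_ l1 l2] := ee_ln rje.
  have := hK _ (Num.truncn (r ^+ j.+1)) (H j.+1) R0 (mH _) (fun w h => h).
  move=> h; apply: (le_trans h).
  rewrite -[leRHS]mulrA ler_pM2l// -expRD ler_expR -opprD lerN2.
  have ll : ln (ln (r ^+ j.+2)) = ln j.+2%:R + ln (ln r).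
    by rewrite lnXn// -[_ *+ j.+2]mulr_natl lnM ?posrE.
  have -> : r * ln (ln r) + (1 + eta) * ln j.+2%:R = r * ln (ln (r ^+ j.+2)) by rewrite ll /r; ring.
  set l := ln (ln (r ^+ j.+2)) in l2 *; have l0 : 0 < l by exact: lt_le_trans l2.
  set n := Num.truncn _; have hn : r ^+ j.+1 < n%:R + 1.
    by rewrite natr1; exact: Num.Theory.truncnS_gt.
  have hn' : r ^+ j <= n%:R.
    have : 1 <= eta * r ^+ j by rewrite -ler_pdivrMl// mulr1.
    by move: hn; rewrite exprS {1}/r; lra.
  rewrite /rad -/l.
  have -> : sz * r^-1 / (a ^+ 2 * r ^+ j.+2 / l) / 2 * n%:R = g / r ^+ 3 * l * (n%:R / r ^+ j).
    rewrite /g !exprS; move: rj0; set x := r ^+ j => rj0.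
    move: (n%:R) (r) r0 => m q q0; clearbody l x.
    by field; rewrite !gt_eqF.
  have h1 : r <= g / r ^+ 3 by rewrite ler_pdivlMr ?exprn_gt0// -exprS.
  have h2 : 1 <= n%:R / r ^+ j by rewrite ler_pdivlMr// mul1r.
  apply: (@le_trans _ _ (g / r ^+ 3 * l)); first by rewrite ler_pM2r.
  by rewrite ler_peMr// mulr_ge0 ?(ltW l0)// (le_trans (ltW r0)).
pose C := K * expR (- (r * ln (ln r))).
have C0 : 0 <= C by rewrite mulr_ge0 ?expR_ge0// ltW.
have Hev : {ae P, forall w, exists n0, forall n, (n0 <= n)%N -> ~ H (n + j1.+1)%N w}.
  apply: (@borel_cantelli1 _ _ _ P (fun n => H (n + j1.+1)%N) (C * (1 + eta^-1))) => // n.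
  apply: le_trans (ler_wpM2l C0 (power_sum_bounded n eta0)).
  rewrite mulr_sumr; apply: ler_sum => k _.
  apply: (le_trans (PH _ _)); first by rewrite addnS ltnS leq_addl.
  rewrite -/C ler_wpM2l// ler_expR lerN2 ler_wpM2l ?addr_ge0 ?(ltW eta0)//.
  by rewrite ler_ln ?posrE// ler_nat ltnS leq_addr.
have cvA := ae_area_cvg bm la.
near=> w => sw.
have cw : area_cvg W1 W2 A w by near: w.
have [n0 Hw] : exists n0, forall n, (n0 <= n)%N -> ~ H (n + j1.+1)%N w by near: w.
move/(small_ioP bm _ _ cw) : sw => sw.
have [t tn st] := sw (Num.truncn (r ^+ (n0 + j1.+1))).+1.
have rt : r ^+ (n0 + j1.+1) <= t%:R.
  by rewrite (le_trans (ltW (Num.Theory.truncnS_gt _)))// ler_nat.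
have [j jn /andP[jt tj]] := geometric_bracket r1 rt.
apply: (Hw (j - j1.+1)%N).
  by rewrite leq_subRL ?(leq_trans (leq_addl _ _) jn)// addnC.
rewrite subnK ?(leq_trans (leq_addl _ _) jn)// => p i ij.
have jj1 : (j1 <= j)%N by rewrite (leq_trans _ jn)// addnS ltnW// ltnS leq_addl.
have et : ee <= t%:R :> R.
  by apply: le_trans jt; have := hj1 _ jj1; rewrite ge_max => /andP[].
have nt : (Num.truncn (r ^+ j) <= t)%N.
  by rewrite -(@ler_nat R) (le_trans _ jt)// Num.Theory.truncn_le// exprn_ge0// ltW.
apply: le_trans (rad_mono a et (ltW tj)).
have := st p i; rewrite mul0n leq0n (leq_trans ij) ?leq_mul2r ?nt ?orbT// => /(_ isT).
have [_ /(_ w)[h1 h2] _ _] := bm; rewrite /hq /hstate /= h1 h2 !subr0 => h.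
have Rt := rad_gt0 a0 et.
set x := W1 _ w ^+ 2 + _ in h *.
have x0 : 0 <= x by rewrite addr_ge0 ?sqr_ge0.
rewrite -(@ler_pXn2r _ 2)// ?nnegrE ?(ltW Rt)//; apply: le_trans h.
by rewrite lerDl sqr_ge0.
Unshelve. all: by end_near.
Qed.
End chung_bounds.

(** * Dirichlet eigenvalues of the unit ball *)

Section second_derivative_test.
Context {R : realType}.

Lemma line_derivative (V : normedModType R) (f : V -> R) (x v : V) (t : R) :
  derivable f (t *: v + x) v ->
  is_derive t (1 : R) (fun s => f (s *: v + x)) ('D_v f (t *: v + x)).
Proof.
move=> df.
have e : (fun h => h^-1 *: (((fun s => f (s *: v + x)) \o shift t) (h *: (1 : R)) - f (t *: v + x))) =
    (fun h => h^-1 *: ((f \o shift (t *: v + x)) (h *: v) - f (t *: v + x))).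
  by apply/funext => h /=; rewrite /shift /= [h *: (1 : R)]mulr1 scalerDl addrA.
by split; [rewrite /derivable e|rewrite /derive e].
Qed.

(** If c were positive, g1 would be positive just to the right of its zero at 0, and the mean value
    theorem would put g above g 0 there. *)
Lemma second_derivative_max (g g1 : R -> R) (c del : R) : 0 < del ->
  (forall t, `|t| < del -> is_derive t (1 : R) g (g1 t)) -> is_derive (0 : R) (1 : R) g1 c ->
  (forall t, `|t| < del -> g t <= g 0) -> c <= 0.
Proof.
move=> d0 dg dg1 gmax.
have in_del t : t \in `]- del, del[ -> `|t| < del by rewrite in_itv /= ltr_norml.
have g10 : g1 0 = 0.
  have := @derive1_at_max R g (- del) del 0 _ _ _ _.
  move=> /(_ _ _ _ _)/wrap[]; first by lra.
  - by move=> t /in_del/dg[].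
  - by rewrite in_itv /= oppr_lt0 d0.
  - by move=> t /in_del; exact: gmax.
  move=> h; have h' := dg 0; rewrite normr0 in h'; have := h' d0.
  by move=> h2; rewrite -(@derive_val _ _ _ _ _ _ _ h2) (@derive_val _ _ _ _ _ _ _ h).
rewrite leNgt; apply/negP => c0.
have cv : (fun h => h^-1 *: ((g1 \o shift 0) (h *: (1 : R)) - g1 0)) @ (0 : R)^' --> c.
  by have [dd <-] := dg1; exact: dd.
have [e /= e0 he] : \forall h \near (0 : R)^', 0 < h^-1 *: ((g1 \o shift 0) (h *: (1 : R)) - g1 0).
  exact: cvgr_gt cv _ c0.
pose t := Num.min (e / 2) (del / 2).
have t0 : 0 < t by rewrite lt_min !divr_gt0.
have te : t < e by rewrite gt_min ltr_pdivrMr// ltr_pMr// ltr1n.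
have td : t < del by rewrite gt_min (_ : del / 2 < del) ?orbT// ltr_pdivrMr// ltr_pMr// ltr1n.
have pos s : 0 < s -> s <= t -> 0 < g1 s.
  move=> s0 st; have := he s; rewrite /ball_ /= sub0r normrN gtr0_norm// (le_lt_trans st te).
  move=> /(_ isT); rewrite gt_eqF// => /(_ isT).
  by rewrite g10 subr0 /shift /= addr0 [s *: _]mulr1 /GRing.scale /= pmulr_rgt0// invr_gt0.
have dg' s : s \in `]0, t[ -> is_derive s (1 : R) g (g1 s).
  rewrite in_itv /= => /andP[s0 st]; apply: dg; rewrite gtr0_norm//; exact: lt_trans td.
have cg : {within `[0, t], continuous g}.
  apply: derivable_within_continuous => s; rewrite in_itv /= => /andP[s0 st].
  have [] // : is_derive s (1 : R) g (g1 s).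
  by apply: dg; rewrite ger0_norm//; exact: le_lt_trans td.
have [s] := MVT t0 dg' cg; rewrite in_itv /= => /andP[s0 st].
have := pos s s0 (ltW st); rewrite subr0 => p e1.
have := mulr_gt0 p t0; rewrite -e1.
by have := gmax t; rewrite gtr0_norm// => /(_ td); lra.
Qed.
End second_derivative_test.

(** * Lower bounds on Dirichlet eigenvalues by positive comparison functions *)

Section comparison.
Context {R : realType}.

Local Notation nv x := (\sum_i x ord0 i ^+ 2).

Lemma nv_continuous n : continuous (fun x : 'rV[R]_n => nv x).
Proof.
suff h r : continuous (fun x : 'rV[R]_n => \sum_(i <- r) x ord0 i * x ord0 i).
  by have := h (index_enum _); congr (continuous _); apply/funext => x; apply: eq_bigr.
elim: r => [|i r ih] x.
  rewrite (_ : (fun _ => _) = cst 0); first exact: cst_continuous.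
  by apply/funext => y; rewrite big_nil.
rewrite (_ : (fun _ => _) = (fun y : 'rV[R]_n => y ord0 i * y ord0 i + \sum_(i <- r) y ord0 i * y ord0 i)).
  have c : {for x, continuous (fun y : 'rV[R]_n => y ord0 i)} by exact: coord_continuous.
  exact: continuousD (continuousM c c) (ih x).
by apply/funext => y; rewrite big_cons.
Qed.

Lemma enorm_le1 n (x : 'rV[R]_n) : (enorm x <= 1) = (nv x <= 1).
Proof.
have h : 0 <= nv x by apply: sumr_ge0 => i _; exact: sqr_ge0.
by rewrite /enorm -(ler_pXn2r (_ : 0 < 2)%N) ?nnegrE ?sqrtr_ge0// sqr_sqrtr// expr1n.
Qed.

Lemma enorm_lt1 n (x : 'rV[R]_n) : (enorm x < 1) = (nv x < 1).
Proof.
have h : 0 <= nv x by apply: sumr_ge0 => i _; exact: sqr_ge0.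
by rewrite /enorm -(ltr_pXn2r (_ : 0 < 2)%N) ?nnegrE ?sqrtr_ge0// sqr_sqrtr// expr1n.
Qed.

Lemma compact_ball n : compact [set x : 'rV[R]_n | enorm x <= 1].
Proof.
apply: (@subclosed_compact _ _ [set x : 'rV[R]_n | forall i, `[(-1), 1]%classic (x ord0 i)]).
- rewrite (_ : [set _ | _] = (fun x : 'rV[R]_n => nv x) @^-1` [set y | y <= 1]); last first.
    by apply/seteqP; split => x /=; rewrite enorm_le1.
  by apply: closed_comp; [move=> x _; exact: nv_continuous|exact: closed_le].
- by apply: (@rV_compact R n (fun _ => `[(-1), 1]%classic)) => i; exact: segment_compact.
move=> x /=; rewrite enorm_le1 => x1 i; rewrite in_itv /= -ler_norml.
rewrite -(ler_pXn2r (_ : 0 < 2)%N) ?nnegrE// expr1n real_normK ?num_real//.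
apply: le_trans x1; rewrite (bigD1 i)//= lerDl.
by apply: sumr_ge0 => j _; exact: sqr_ge0.
Qed.

(* At an interior maximum of [s f / u] the function [s f - M u] is maximal. *)
Lemma eigenvalue_ge n (u : 'rV[R]_n -> R) (mu lam : R) :
  (forall x, enorm x <= 1 -> 0 < u x) -> continuous u ->
  (forall x i, derivable u x (evec i)) ->
  (forall x i, derivable ('D_(evec i) u) x (evec i)) ->
  (forall x, enorm x < 1 -> - (2^-1 * laplacian u x) = mu * u x) ->
  dirichlet_eigenvalue n lam -> mu <= lam.
Proof.
move=> u0 cu du ddu lu [f [[x1 [x11 fx1]] cf f0 df lf]].
(* Makes [s f] positive somewhere, so the maximum M of [s f / u] is positive and cannot sit on the
   sphere, where f vanishes. *)
pose s : R := Num.sg (f x1).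
have sf0 : 0 < s * f x1 by rewrite /s -normrEsg normr_gt0.
pose B := [set x : 'rV[R]_n | enorm x <= 1].
have cg : {within B, continuous (fun x => s * f x / u x)}.
  apply/subspace_continuousP => x Bx; move/subspace_continuousP : cf => /(_ x Bx) cfx.
  apply: cvgM; first by apply: cvgM; [exact: cvg_cst|exact: cfx].
  apply: cvgV; first by rewrite gt_eqF// u0.
  by apply: cvg_within_filter; exact: cu.
have [x0 x0B hx0] := @EVT_max_rV R n (fun x => s * f x / u x) B (ex_intro _ x1 (ltW x11)) (@compact_ball n) cg.
pose M := s * f x0 / u x0.
have x0B' : enorm x0 <= 1 by move: x0B; rewrite inE.
have ux0 := u0 _ x0B'.
have M0 : 0 < M.
  apply: lt_le_trans (hx0 x1 _); last by rewrite inE /B /= ltW.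
  by rewrite divr_gt0// u0// ltW.
have x01 : enorm x0 < 1.
  rewrite lt_neqAle x0B' andbT; apply/eqP => /f0 e.
  by move: M0; rewrite /M e mulr0 mul0r ltxx.
have sfx0 : s * f x0 = M * u x0 by rewrite /M divfK ?gt_eqF.
have key i : s * 'D_(evec i) ('D_(evec i) f) x0 - M * 'D_(evec i) ('D_(evec i) u) x0 <= 0.
  set v := evec i.
  have [del /= del0 hdel] : \forall t \near (0 : R), nv (t *: v + x0) < 1.
    have c : (fun t : R => nv (t *: v + x0)) @ (0 : R) --> nv (0 *: v + x0).
      apply: (@continuous_comp _ _ _ (fun t : R => t *: v + x0) (fun x : 'rV[R]_n => nv x)).
        by apply: cvgD; [apply: cvgZr_tmp; exact: cvg_id|exact: cvg_cst].
      exact: nv_continuous.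
    by apply: (cvgr_lt _ c); rewrite scale0r add0r -enorm_lt1.
  have hb t : `|t| < del -> enorm (t *: v + x0) < 1.
    by move=> td; rewrite enorm_lt1; apply: hdel; rewrite /ball_ /= sub0r normrN.
  pose g t := s * f (t *: v + x0) - M * u (t *: v + x0).
  pose g1 t := s * 'D_v f (t *: v + x0) - M * 'D_v u (t *: v + x0).
  apply: (@second_derivative_max R g g1 _ del del0).
  - move=> t td; have [dft _ _] := df _ (hb t td).
    have h1 := line_derivative (diff_derivable dft (v := v)).
    have h2 := line_derivative (du (t *: v + x0) i).
    exact: is_deriveB.
  - have [_ /(_ i) ddft _] := df _ x01.
    have e0 : 0 *: v + x0 = x0 by rewrite scale0r add0r.
    have h1 : derivable ('D_v f) (0 *: v + x0) v by rewrite e0; exact: diff_derivable.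
    have h2 : derivable ('D_v u) (0 *: v + x0) v by rewrite e0; exact: ddu.
    have := is_deriveB (is_deriveZ s (line_derivative h1)) (is_deriveZ M (line_derivative h2)).
    by rewrite e0.
  move=> t td; have tB := hb t td; have ut := u0 _ (ltW tB).
  rewrite /g scale0r add0r sfx0 subrr subr_le0 -ler_pdivrMr//.
  by apply: hx0; rewrite inE /B /= ltW.
have lap : s * laplacian f x0 - M * laplacian u x0 <= 0.
  by rewrite /laplacian !mulr_sumr -sumrB; apply: sumr_le0 => i _; exact: key.
have e1 : s * laplacian f x0 = - 2 * lam * (M * u x0).
  by rewrite -sfx0; have := lf _ x01; move=> h; rewrite mulrCA -mulrA -h; field.
have e2 : M * laplacian u x0 = - 2 * mu * (M * u x0).
  by rewrite (_ : -2 * mu * (M * u x0) = -2 * M * (mu * u x0)); [rewrite -lu//; field|ring].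
have Mu : 0 < M * u x0 by rewrite mulr_gt0.
have : 0 <= (lam - mu) * (M * u x0).
  by move: lap; rewrite e1 e2; move: (M * u x0) => X hX; clear -hX; lra.
by rewrite pmulr_lge0// subr_ge0.
Qed.
End comparison.

(** * Explicit eigenfunctions of the disk and of the interval *)

Section radial_functions.
Context {R : realType}.
Local Notation nv x := (\sum_i x ord0 i ^+ 2).

Lemma is_derive_line (V : normedModType R) (f : V -> R) (x v : V) (df : R) :
  is_derive (0 : R) (1 : R) (fun s => f (s *: v + x)) df -> is_derive x v f df.
Proof.
have e : (fun h => h^-1 *: (((fun s => f (s *: v + x)) \o shift 0) (h *: (1 : R)) - f (0 *: v + x))) =
    (fun h => h^-1 *: ((f \o shift x) (h *: v) - f x)).
  by apply/funext => h /=; rewrite /shift /= [h *: (1 : R)]mulr1 addr0 scale0r add0r.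
by case; rewrite /derivable /derive e => d1 d2; split.
Qed.

Lemma is_derive_chain (V : normedModType R) (G : R -> R) (q : V -> R) (x v : V) (g dq : R) :
  is_derive x v q dq -> is_derive (q x) (1 : R) G g -> is_derive x v (fun y => G (q y)) (g * dq).
Proof.
move=> [dq1 dq2] dG; apply: is_derive_line.
have e0 : 0 *: v + x = x by rewrite scale0r add0r.
have h : is_derive (0 : R) (1 : R) (fun s => q (s *: v + x)) dq.
  by rewrite -dq2 -[in 'D_v _ x]e0; apply: line_derivative; rewrite e0.
by apply: (@is_derive1_comp _ G (fun s => q (s *: v + x))) => //; rewrite e0.
Qed.

Lemma is_derive_coord n (x : 'rV[R]_n) (i j : 'I_n) :
  is_derive x (evec i) (fun y : 'rV[R]_n => y ord0 j) ((i == j)%:R : R).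
Proof.
apply: is_derive_line; rewrite (_ : (fun s => _) = (fun s : R => s * (i == j)%:R + x ord0 j)).
  by apply: is_derive_eq; rewrite /GRing.scale /= ?addr0 ?mulr1 ?mulr0; ring.
by apply/funext => s; rewrite !mxE.
Qed.

Lemma is_derive_nv n (x : 'rV[R]_n) (i : 'I_n) :
  is_derive x (evec i) (fun y : 'rV[R]_n => nv y) (2 * x ord0 i).
Proof.
apply: is_derive_line; rewrite (_ : (fun s => _) = (fun s : R => nv x + 2 * x ord0 i * s + s * s)).
  by apply: is_derive_eq; rewrite /GRing.scale /= ?addr0 ?mulr1 ?mulr0; ring.
apply/funext => s; rewrite (bigD1 i)//= [in RHS](bigD1 i)//= !mxE eqxx.
rewrite /= mulr1n (eq_bigr (fun j => x ord0 j ^+ 2)); first by ring.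
by move=> j ji; rewrite !mxE eq_sym (negbTE ji) mulr0 add0r.
Qed.

Lemma differentiable_coord0 n (i : 'I_n) (x : 'rV[R]_n) :
  differentiable (fun y : 'rV[R]_n => y ord0 i) x.
Proof. exact: differentiable_coord. Qed.

Lemma differentiable_nv n (x : 'rV[R]_n) : differentiable (fun y : 'rV[R]_n => nv y) x.
Proof.
suff h r : differentiable (fun y : 'rV[R]_n => \sum_(i <- r) y ord0 i ^+ 2) x by exact: h.
elim: r => [|i r ih].
  rewrite (_ : (fun _ => _) = cst 0); first exact: differentiable_cst.
  by apply/funext => y; rewrite big_nil.
rewrite (_ : (fun _ => _) = (fun y : 'rV[R]_n => y ord0 i * y ord0 i) \+ (fun y => \sum_(i <- r) y ord0 i ^+ 2)).
  apply: differentiableD => //.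
  exact: (differentiableM (differentiable_coord0 i x) (differentiable_coord0 i x)).
by apply/funext => y; rewrite big_cons expr2.
Qed.

Lemma is_derive_differentiable (G G1 : R -> R) : (forall x, is_derive x (1 : R) G (G1 x)) ->
  forall x, differentiable G x.
Proof. by move=> dG x; apply/derivable1_diffP; case: (dG x). Qed.

Lemma differentiable_chain n (G : R -> R) (q : 'rV[R]_n -> R) (x : 'rV[R]_n) :
  differentiable q x -> differentiable G (q x) -> differentiable (fun y => G (q y)) x.
Proof. exact: differentiable_comp. Qed.

(** Packs a function with candidate first and second partial derivatives, so that Laplacians of
    explicit functions become finite sums. *)
Definition C2 n (f : 'rV[R]_n -> R) (f1 : 'I_n -> 'rV[R]_n -> R) (f2 : 'I_n -> 'I_n -> 'rV[R]_n -> R) :=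
  [/\ forall x, differentiable f x, forall i x, differentiable (f1 i) x,
      forall i j, continuous (f2 i j), forall i, 'D_(evec i) f = f1 i &
      forall i j, 'D_(evec j) (f1 i) = f2 i j].

Lemma laplacian_C2 n (f : 'rV[R]_n -> R) f1 f2 x : C2 f f1 f2 -> laplacian f x = \sum_i f2 i i x.
Proof. by case=> _ _ _ d1 d2; apply: eq_bigr => i _; rewrite d1 -(d2 i i). Qed.

Lemma eigenvalue_ge_C2 n (u : 'rV[R]_n -> R) u1 u2 (mu lam : R) : C2 u u1 u2 ->
  (forall x, enorm x <= 1 -> 0 < u x) ->
  (forall x, enorm x < 1 -> - (2^-1 * laplacian u x) = mu * u x) ->
  dirichlet_eigenvalue n lam -> mu <= lam.
Proof.
move=> [dif dif1 _ d1 d2] u0 lu; apply: (@eigenvalue_ge _ n u) => //.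
- by move=> x; apply: differentiable_continuous.
- by move=> x i; exact: diff_derivable.
- by move=> x i; rewrite d1; exact: diff_derivable.
Qed.

Lemma eigenvalue_C2 n (u : 'rV[R]_n -> R) u1 u2 (mu : R) : C2 u u1 u2 ->
  (exists x, enorm x < 1 /\ u x != 0) -> (forall x, enorm x = 1 -> u x = 0) ->
  (forall x, enorm x < 1 -> - (2^-1 * laplacian u x) = mu * u x) ->
  dirichlet_eigenvalue n mu.
Proof.
move=> [dif dif1 c2 d1 d2] nz bd lu; exists u; split => //.
  by apply: continuous_subspaceT => x; apply: differentiable_continuous.
move=> x _; split => //; first by move=> i; rewrite d1.
by move=> i j; rewrite d1 d2; exact: c2.
Qed.

Lemma radial_C2 n (G G1 G2 : R -> R) (k : R) :
  (forall x, is_derive x (1 : R) G (G1 x)) -> (forall x, is_derive x (1 : R) G1 (G2 x)) ->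
  continuous G2 ->
  C2 (fun y : 'rV[R]_n => G (k * nv y)) (fun i y => G1 (k * nv y) * (k * (2 * y ord0 i)))
     (fun i j y => G1 (k * nv y) * (k * (2 * (j == i)%:R)) +
        k * (2 * y ord0 i) * (G2 (k * nv y) * (k * (2 * y ord0 j)))).
Proof.
move=> dG dG1 cG2.
have dq x : differentiable (fun y : 'rV[R]_n => k * nv y) x.
  exact: (differentiableM (differentiable_cst _ _) (differentiable_nv x)).
have dq1 i x : is_derive x (evec i) (fun y : 'rV[R]_n => k * nv y) (k * (2 * x ord0 i)).
  exact: (is_deriveZ k (is_derive_nv x i)).
have dl i x : differentiable (fun y : 'rV[R]_n => k * (2 * y ord0 i)) x.
  exact: (differentiableM (differentiable_cst _ _) (differentiableM (differentiable_cst _ _) (differentiable_coord0 i x))).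
split.
- by move=> x; apply: differentiable_chain (dq x) _; exact: is_derive_differentiable dG _.
- move=> i x; apply: (differentiableM _ (dl i x)).
  by apply: differentiable_chain (dq x) _; exact: is_derive_differentiable dG1 _.
- move=> i j x.
  have cq : {for x, continuous (fun y : 'rV[R]_n => k * nv y)} by apply: differentiable_continuous; exact: dq.
  have cl m : {for x, continuous (fun y : 'rV[R]_n => k * (2 * y ord0 m))}.
    by apply: differentiable_continuous; exact: dl.
  have c1 : {for x, continuous (fun y : 'rV[R]_n => G1 (k * nv y))}.
    apply: differentiable_continuous; apply: differentiable_chain (dq x) _.
    exact: is_derive_differentiable dG1 _.
  have c2 : {for x, continuous (fun y : 'rV[R]_n => G2 (k * nv y))}.
    by apply: (@continuous_comp _ _ _ _ G2 _ cq); exact: cG2.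
  exact: (continuousD (continuousM c1 (@cst_continuous _ _ (k * (2 * (j == i)%:R)) x)) (continuousM (cl i) (continuousM c2 (cl j)))).
- move=> i; apply/funext => x; apply: derive_val.
  exact: is_derive_chain (dq1 i x) (dG _).
- move=> i j; apply/funext => x; apply: derive_val.
  have h1 := is_derive_chain (dq1 j x) (dG1 _).
  have h2 := is_deriveZ k (is_deriveZ 2 (is_derive_coord x j i)).
  exact: (is_deriveM h1 h2).
Qed.

Lemma coord_C2 n (m : 'I_n) (G G1 G2 : R -> R) (l : R) :
  (forall x, is_derive x (1 : R) G (G1 x)) -> (forall x, is_derive x (1 : R) G1 (G2 x)) ->
  continuous G2 ->
  C2 (fun y : 'rV[R]_n => G (l * y ord0 m)) (fun i y => G1 (l * y ord0 m) * (l * (i == m)%:R))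
     (fun i j y => l * (i == m)%:R * (G2 (l * y ord0 m) * (l * (j == m)%:R))).
Proof.
move=> dG dG1 cG2.
have dq x : differentiable (fun y : 'rV[R]_n => l * y ord0 m) x.
  exact: (differentiableM (differentiable_cst _ _) (differentiable_coord0 m x)).
have dq1 i x : is_derive x (evec i) (fun y : 'rV[R]_n => l * y ord0 m) (l * (i == m)%:R).
  exact: (is_deriveZ l (is_derive_coord x i m)).
split.
- by move=> x; apply: differentiable_chain (dq x) _; exact: is_derive_differentiable dG _.
- move=> i x; apply: (differentiableM _ (differentiable_cst _ _)).
  by apply: differentiable_chain (dq x) _; exact: is_derive_differentiable dG1 _.
- move=> i j x.
  have cq : {for x, continuous (fun y : 'rV[R]_n => l * y ord0 m)} by apply: differentiable_continuous; exact: dq.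
  have c2 : {for x, continuous (fun y : 'rV[R]_n => G2 (l * y ord0 m))}.
    by apply: (@continuous_comp _ _ _ _ G2 _ cq); exact: cG2.
  exact: (continuousM (@cst_continuous _ _ _ x) (continuousM c2 (@cst_continuous _ _ _ x))).
- move=> i; apply/funext => x; apply: derive_val.
  exact: is_derive_chain (dq1 i x) (dG _).
- move=> i j; apply/funext => x; apply: derive_val.
  have h1 := is_derive_chain (dq1 j x) (dG1 _).
  have := is_deriveZ (l * (i == m)%:R) h1; congr (is_derive _ _ _ _).
  by apply/funext => y /=; rewrite /GRing.scale /= mulrC.
Qed.

Lemma inf_min (S : set R) (m : R) : S m -> (forall x, S x -> m <= x) -> inf S = m.
Proof.
move=> Sm mS; apply/eqP; rewrite eq_le; apply/andP; split.
  by apply: ge_inf => //; exists m.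
by apply: lb_le_inf => //; exists m.
Qed.

(** The ground state itself vanishes on the sphere, whereas the comparison asks for positivity on
    the closed ball. Hence it is made with [bessel 0 (k |x|^2)] for k < sz, giving the bound k / 2,
    and k tends to sz. *)
Lemma lambda1_2 (sz : R) : 0 < sz -> bessel 0 sz = 0 ->
  (forall x, 0 <= x -> x < sz -> 0 < bessel 0 x) -> lambda1 2 = sz / 2.
Proof.
move=> sz0 bz bpos.
have c2 k := @radial_C2 2 (bessel 0) (bessel 1) (bessel 2) k (bessel_derive 0) (bessel_derive 1) (@bessel_continuous R 2).
have lapl k x : - (2^-1 * laplacian (fun y : 'rV[R]_2 => bessel 0 (k * nv y)) x) = k / 2 * bessel 0 (k * nv x).
  rewrite (laplacian_C2 _ (c2 k)).
  have := bessel_ode (k * nv x); rewrite !big_ord_recl !big_ord0 !eqxx /= !mulr1n.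
  set s := k * _; set x0 := x _ _; set x1 := x _ _.
  move=> h; have -> : bessel 0 s = - (4 * (s * bessel 2 s + bessel 1 s)) by rewrite h opprK.
  have es : s = k * (x0 ^+ 2 + (x1 ^+ 2 + 0)) by [].
  clearbody s x0 x1; rewrite [X in _ = _ * - (4 * (X * _ + _))]es; by field.
apply: inf_min.
- apply: (eigenvalue_C2 (c2 sz)) => //.
    exists 0; rewrite enorm_lt1 big1 ?ltr01; last by move=> i _; rewrite mxE expr0n.
    by rewrite mulr0 bessel0 oner_neq0.
  move=> x; rewrite /enorm => h.
  have : Num.sqrt (nv x) ^+ 2 = 1 by rewrite h expr1n.
  rewrite sqr_sqrtr; first by move=> ->; rewrite mulr1.
  by apply: sumr_ge0 => i _; exact: sqr_ge0.
move=> lam hlam; apply/ler_addgt0Pr => e e0.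
pose k := sz - Num.min e (sz / 2).
have m0 : 0 < Num.min e (sz / 2) by rewrite lt_min e0 divr_gt0.
have me : Num.min e (sz / 2) <= e by rewrite ge_min lexx.
have ms : Num.min e (sz / 2) <= sz / 2 by rewrite ge_min lexx orbT.
have k0 : 0 < k by rewrite /k; lra.
have ks : k < sz by rewrite /k; lra.
have := eigenvalue_ge_C2 (c2 k) _ (fun x _ => lapl k x) hlam.
move=> /(_ _)/wrap[]; last by rewrite /k; lra.
move=> x; rewrite enorm_le1 => x1; have nv0 : 0 <= nv x by apply: sumr_ge0 => i _; exact: sqr_ge0.
apply: bpos; first by rewrite mulr_ge0// ltW.
by apply: le_lt_trans ks; rewrite ler_piMr// ltW.
Qed.

Lemma lambda1_1 : lambda1 1 = pi ^+ 2 / 8 :> R.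
Proof.
have dc (x : R) : is_derive x (1 : R) cos (- sin x) by exact: is_derive_cos.
have ds (x : R) : is_derive x (1 : R) (fun y => - sin y) (- cos x).
  by apply: is_deriveN; exact: is_derive_sin.
have cc : continuous (fun x : R => - cos x) by move=> x; apply: cvgN; exact: continuous_cos.
have c2 l := @coord_C2 1 ord0 cos _ _ l dc ds cc.
have lapl l x : - (2^-1 * laplacian (fun y : 'rV[R]_1 => cos (l * y ord0 ord0)) x) = l ^+ 2 / 2 * cos (l * x ord0 ord0).
  by rewrite (laplacian_C2 _ (c2 l)) big_ord_recl big_ord0 eqxx /= mulr1n; field.
have nvE (x : 'rV[R]_1) : nv x = x ord0 ord0 ^+ 2 by rewrite big_ord_recl big_ord0 addr0.
have pi0 := pi_gt0 R.
apply: inf_min.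
- have -> : pi ^+ 2 / 8 = (pi / 2) ^+ 2 / 2 :> R by field.
  apply: (eigenvalue_C2 (c2 (pi / 2))) => //.
    exists 0; rewrite enorm_lt1 nvE mxE expr0n ltr01; split => //.
    by rewrite mulr0 cos0 oner_neq0.
  move=> x; rewrite /enorm nvE sqrtr_sqr => h.
  have : x ord0 ord0 ^+ 2 = 1 by rewrite -(real_normK (num_real _)) h expr1n.
  by move/eqP; rewrite sqrf_eq1 => /orP[]/eqP ->; rewrite ?mulrN1 ?cosN ?mulr1 cos_pihalf.
move=> lam hlam; apply/ler_addgt0Pr => e e0.
(* Lowering the frequency from pi / 2 by m keeps the cosine positive on the closed interval and
   costs at most [m * pi / 2 <= e] in the eigenvalue. *)
pose m := Num.min (e / (pi + 1)) (pi / 4); pose l := pi / 2 - m.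
have p1 : 0 < pi + 1 :> R by lra.
have m0 : 0 < m by rewrite lt_min !divr_gt0.
have me : m * (pi + 1) <= e by rewrite -ler_pdivlMr// ge_min lexx.
have ms : m <= pi / 4 by rewrite ge_min lexx orbT.
have l0 : 0 < l by rewrite /l; lra.
have := eigenvalue_ge_C2 (c2 l) _ (fun x _ => lapl l x) hlam.
move=> /(_ _)/wrap[].
  move=> x; rewrite enorm_le1 nvE => x1; apply: cos_gt0_pihalf; rewrite -ltr_norml.
  have nx : `|x ord0 ord0| <= 1.
    by rewrite -(ler_pXn2r (_ : 0 < 2)%N) ?nnegrE// expr1n real_normK ?num_real.
  rewrite normrM gtr0_norm//; apply: (@le_lt_trans _ _ l); first by rewrite ler_piMr// ltW.
  by rewrite /l; lra.
move=> h; have : pi ^+ 2 / 8 - l ^+ 2 / 2 <= m * pi / 2.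
  have := sqr_ge0 m; rewrite (_ : l ^+ 2 = pi ^+ 2 / 4 - pi * m + m ^+ 2); last by rewrite /l; field.
  by lra.
have := mulr_ge0 (ltW m0) (ltW pi0); lra.
Qed.
End radial_functions.

(** * The liminf and its level sets *)

Section liminf_events.
Context {d : measure_display} {T : measurableType d} {R : realType}.
Variables (P : probability T R) (W1 W2 A : R -> T -> R).
Hypotheses (bm : is_BM2 P W1 W2) (la : is_levy_area P W1 W2 A).
Local Notation dya := (@dya R).
Local Notation hstate := (hstate W1 W2 A).
Local Notation stays := (stays W1 W2 A).
Local Notation area_cvg := (area_cvg W1 W2 A).
Local Notation stays_io := (stays_io W1 W2 A).
Local Notation running_max := (running_max W1 W2 A).
Local Notation hnorm := (hnorm W1 W2 A).

(** The Levy area is prescribed at time 0 only up to null sets; on [area_cvg] it is a limit of empty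
    sums. *)
Lemma area0 w : area_cvg w -> A 0 w = 0.
Proof.
move=> cw; have := cw 0%N 0%N; rewrite (_ : (fun q => _) = cst 0).
  rewrite (_ : dya 0 0 = 0); last by rewrite /dya mul0r.
  by move=> h; rewrite -(cvg_lim _ h)// lim_cst.
by apply/funext => q; rewrite mul0n earea0.
Qed.

Lemma hstate0 w s : area_cvg w ->
  hq (hstate 0 s w) = (W1 s w ^+ 2 + W2 s w ^+ 2) ^+ 2 + A s w ^+ 2.
Proof.
move=> cw; have [_ /(_ w)[h1 h2] _ _] := bm.
by rewrite /hq /hstate /= h1 h2 (area0 cw) !subr0 !mul0r subr0 mulr0 subr0.
Qed.

(** By continuity a violation at s persists at nearby times; the dyadic point is taken just below s,
    so that it does not exceed t. *)
Lemma stays_all w t x s : stays 0 t x w -> 0 <= s -> s <= t%:R -> hq (hstate 0 s w) <= x.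
Proof.
move=> st s0 st'; rewrite leNgt; apply/negP => xs.
have /subspace_continuousP/(_ s) := @path_continuous _ _ _ _ _ _ _ bm la w.
rewrite /= in_itv /= s0 => /(_ isT) cv.
have : \forall y \near within `[0, +oo[ (nbhs s), x < hq (hstate 0 y w) by exact: cvgr_gt cv _ xs.
move=> [e /= e0 he].
have [p hp] : exists p : nat, (2 ^+ p)^-1 < e :> R.
  exists (Num.truncn e^-1); rewrite invf_plt ?posrE ?exprn_gt0//.
  apply: (lt_le_trans (Num.Theory.truncnS_gt _)); rewrite -natrX ler_nat; exact: ltn_expl.
pose j := Num.truncn (s * 2 ^+ p); have p0 : 0 < (2 : R) ^+ p by exact: exprn_gt0.
have /andP[j1 j2] : j%:R <= s * 2 ^+ p < j.+1%:R by apply: Num.Theory.truncn_itv; rewrite mulr_ge0// ltW.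
have d1 : dya p j <= s by rewrite /dya ler_pdivrMr.
have d2 : s - dya p j < (2 ^+ p)^-1.
  rewrite -(ltr_pM2r p0) mulrBl /dya divfK ?gt_eqF// mulVf ?gt_eqF//.
  by move: j2; rewrite -natr1; lra.
have := he (dya p j); rewrite /ball_ /= ger0_norm ?subr_ge0// => /(_ (lt_trans d2 hp)).
rewrite in_itv /= dya_ge0 => /(_ isT); rewrite ltNge => /negP; apply; apply: st.
rewrite mul0n leq0n /= -(@ler_nat R) natrM natrX; apply: (le_trans j1).
by rewrite ler_pM2r.
Qed.

Lemma hnorm_le w s (r : R) : area_cvg w -> 0 <= r ->
  (hnorm s w <= Num.sqrt r) = (hq (hstate 0 s w) <= r ^+ 2).
Proof.
move=> cw r0; rewrite hstate0// /hnorm; set q := (_ + _ : R).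
have q0 : 0 <= q by rewrite addr_ge0 ?sqr_ge0.
have p0 := powR_ge0 q (4^-1).
have q4 : (q `^ 4^-1) ^+ 4 = q by rewrite -powR_mulrn// -powRrM mulVf// powRr1.
have r4 : Num.sqrt r ^+ 4 = r ^+ 2 by rewrite -[4%N]/(2 * 2)%N exprM sqr_sqrtr.
by rewrite -(@ler_pXn2r _ 4)// ?nnegrE ?sqrtr_ge0// q4 r4.
Qed.

Lemma phi_rad (a t : R) : 0 < a -> ee <= t -> phi t * Num.sqrt (rad a t) = a.
Proof.
move=> a0 et; have [t0 t1 t2] := ee_ln et; have l0 := lt_le_trans ltr01 t2.
rewrite /phi -sqrtrM; last by rewrite divr_ge0// ltW.
rewrite (_ : ln (ln t) / t * rad a t = a ^+ 2); first by rewrite sqrtr_sqr gtr0_norm.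
by rewrite /rad; field; rewrite !gt_eqF.
Qed.

Lemma phi_gt0 (t : R) : ee <= t -> 0 < phi t.
Proof.
move=> et; have [t0 t1 t2] := ee_ln et.
by rewrite sqrtr_gt0 divr_gt0// (lt_le_trans _ t2).
Qed.

Lemma running_max_le w t (r : R) : area_cvg w -> 0 <= r -> stays 0 t (r ^+ 2) w ->
  running_max t%:R w <= Num.sqrt r.
Proof.
move=> cw r0 st; apply: ge_sup.
  by exists (hnorm 0 w), 0 => //=; rewrite in_itv /= lexx ler0n.
move=> _ [s + <-]; rewrite /= in_itv /= => /andP[s0 st'].
by rewrite hnorm_le//; exact: stays_all st s0 st'.
Qed.

Lemma hnorm_running_max w (t s : R) : area_cvg w -> 0 <= s -> s <= t -> hnorm s w <= running_max t w.
Proof.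
move=> cw s0 st; apply: ub_le_sup; last by exists s => //=; rewrite in_itv /= s0.
have [K K0 hK] := path_bound bm la w (Num.truncn t).+1.
exists (Num.sqrt (K + 1)) => _ [u + <-]; rewrite /= in_itv /= => /andP[u0 ut].
rewrite hnorm_le// ?addr_ge0//.
have ut' : u <= (Num.truncn t).+1%:R by rewrite (le_trans ut)// ltW// Num.Theory.truncnS_gt.
by apply: (le_trans (hK u u0 ut')); have := sqr_ge0 K; rewrite sqrrD1; lra.
Qed.

Lemma stays_io_liminf w a : area_cvg w -> 0 < a -> stays_io 0 a w ->
  (chung_liminf W1 W2 A w <= a%:E)%E.
Proof.
move=> cw a0 sw; rewrite /chung_liminf limf_einfE; apply: ge_ereal_sup => _ [V [M [_ hM]] <-].
have [t tn st] := sw (Num.truncn (Num.max M ee)).+1.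
have tt : Num.max M ee < t%:R :> R.
  by apply: lt_le_trans (Num.Theory.truncnS_gt _) _; rewrite ler_nat.
move: tt; rewrite gt_max => /andP[tM te].
apply: ge_ereal_inf; exists (phi t%:R * running_max t%:R w)%:E.
  by exists t%:R => //; exact: hM.
rewrite lee_fin -[leRHS](phi_rad a0 (ltW te)) ler_pM2l ?phi_gt0 ?(ltW te)//.
by apply: running_max_le => //; exact: ltW (rad_gt0 a0 (ltW te)).
Qed.

(** By contraposition: if the path is confined at finitely many integer times only, then for each b
    < a the normalised maximum at any large real t is at least b, otherwise the integer part of t
    would be one more such time. *)
Lemma liminf_stays_io w a : area_cvg w -> 0 < a ->
  (chung_liminf W1 W2 A w < a%:E)%E -> stays_io 0 a w.
Proof.
move=> cw a0 ca; apply: contrapT => /existsNP[n0 hn0].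
have {}hn0 t : (n0 <= t)%N -> ~ stays 0 t (rad a t%:R ^+ 2) w.
  by move=> nt st; apply: hn0; exists t.
suff key (b : R) : 0 < b -> b < a -> (b%:E <= chung_liminf W1 W2 A w)%E.
  move: ca key; case: (chung_liminf W1 W2 A w) => [c| |] //.
  - rewrite lte_fin => ca key; pose b := Num.max (a / 2) ((c + a) / 2).
    have := key b; rewrite lt_max gt_max lee_fin ge_max divr_gt0//=.
    have -> : a / 2 < a by lra.
    have -> : (c + a) / 2 < a by lra.
    by move=> /(_ isT isT)/andP[_]; lra.
  - have h2 : a / 2 < a by lra.
    by move=> _ /(_ (a / 2)); rewrite divr_gt0// => /(_ isT h2).
move=> b0 ba; have ab : 0 < a ^+ 2 - b ^+ 2 by rewrite subr_gt0 ltrXn2r// ?nnegrE ltW.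
(* The last term gives [b^2 (n + 1) <= a^2 n] for the integer part n of t, which pays for replacing
   t by n; the 1 added to the maximum compensates the truncation. *)
pose M : R := Num.max n0%:R (Num.max ee (b ^+ 2 / (a ^+ 2 - b ^+ 2))) + 1.
rewrite /chung_liminf limf_einfE; apply: le_ereal_sup_tmp; exists (ereal_inf [set (phi t * running_max t w)%:E | t in `]M, +oo[%classic]).
  by exists `]M, +oo[%classic => //; exists M; split; [exact: num_real|move=> x /= xM; rewrite in_itv /= xM].
apply: le_ereal_inf_tmp => _ [t + <-]; rewrite /= in_itv /= andbT lee_fin => Mt.
rewrite leNgt; apply/negP => hb; pose n := Num.truncn t.
have t0 : 0 <= t.
  apply/ltW; apply: lt_trans Mt; rewrite ltr_wpDl// le_max ler0n//.
have /andP[n1 n2] : n%:R <= t < n.+1%:R by exact: Num.Theory.truncn_itv.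
have nM : Num.max n0%:R (Num.max ee (b ^+ 2 / (a ^+ 2 - b ^+ 2))) <= n%:R :> R.
  by rewrite -(lerD2r 1) natr1 (le_trans (ltW Mt))// ltW.
move: nM; rewrite !ge_max ler_nat => /and3P[nn0 ne nb].
apply: (hn0 n nn0); have et := le_trans ne n1.
have [u0 u1 u2] := ee_ln ne; have [v0 v1 v2] := ee_ln et.
have rb0 := rad_gt0 b0 et; have ra0 := rad_gt0 a0 ne.
have rab : rad b t <= rad a n%:R.
  rewrite /rad; apply: (@le_trans _ _ (b ^+ 2 * t / ln (ln n%:R))).
    apply: ler_wpM2l; first by rewrite mulr_ge0 ?sqr_ge0.
    rewrite lef_pV2 ?posrE ?(lt_le_trans _ u2) ?(lt_le_trans _ v2)//.
    exact: lnln_mono.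
  rewrite ler_pM2r ?invr_gt0 ?(lt_le_trans _ u2)//.
  move: nb; rewrite ler_pdivrMr// => nb.
  have : b ^+ 2 * t <= b ^+ 2 * (n%:R + 1) by rewrite ler_pM2l ?exprn_gt0// natr1 ltW.
  by lra.
move=> p j /andP[_ jn]; apply: (@le_trans _ _ (rad b t ^+ 2)); last first.
  by rewrite lerXn2r// ?nnegrE ltW.
rewrite -(hnorm_le _ cw (ltW rb0)).
have dt : dya p j <= t by apply: le_trans n1; exact: dya_le_nat.
apply: (le_trans (hnorm_running_max cw (dya_ge0 _ _) dt)).
by rewrite -(ler_pM2l (phi_gt0 et)) (phi_rad b0 et) ltW.
Qed.

(** Probabilities are computed for [small_liminf], which is measurable; this equivalence transfers
    them to the liminf itself. *)
Lemma small_liminfP w a : area_cvg w -> 0 < a ->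
  small_liminf W1 W2 0 a w <-> (chung_liminf W1 W2 A w <= a%:E)%E.
Proof.
move=> cw a0; have am m : 0 < a + m.+1%:R^-1 by rewrite addr_gt0// invr_gt0.
split=> [h|h m].
- apply/lee_addgt0Pr => e e0.
  have [m hm] : exists m : nat, m.+1%:R^-1 <= e.
    exists (Num.truncn e^-1); rewrite invf_ple ?posrE// ltW// Num.Theory.truncnS_gt//.
  have /(small_ioP bm _ _ cw)/(stays_io_liminf cw (am m)) := h m.
  by move=> h'; apply: (le_trans h'); rewrite -EFinD lee_fin lerD2l.
- apply/(small_ioP bm _ _ cw)/(liminf_stays_io cw (am m)).
  by apply: (le_lt_trans h); rewrite lte_fin ltrDl invr_gt0.
Qed.
End liminf_events.

(** * The almost sure value of the liminf *)

Section value_of_liminf.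
Context {d : measure_display} {T : measurableType d} {R : realType}.
Variables (P : probability T R) (W1 W2 A : R -> T -> R).
Hypotheses (bm : is_BM2 P W1 W2) (la : is_levy_area P W1 W2 A).
Variable sz : R.
Hypotheses (sz0 : 0 < sz) (bz : bessel 0 sz = 0)
  (bpos : forall x, 0 <= x -> x < sz -> 0 < bessel 0 x).
Local Notation X := (chung_liminf W1 W2 A).

Let aeX (a : R) : 0 < a -> {ae P, forall w, small_liminf W1 W2 0 a w <-> (X w <= a%:E)%E}.
Proof.
by move=> a0; apply: filterS (ae_area_cvg bm la) => w cw; exact: (small_liminfP bm la cw a0).
Qed.

Lemma liminf_le_ae (a y : R) : 0 < a -> 0 < y < 1 -> ub_rate sz y < a ^+ 2 ->
  P (small_liminf W1 W2 0 a) = 1%E.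
Proof.
move=> a0 y01 ya; apply: ae_prob1; first exact: (measurable_small_liminf bm).
have hc := ae_area_cvg bm la; have hs := small_io_ae bm la sz0 bz bpos a0 y01 ya.
near=> w.
have cw : area_cvg W1 W2 A w by near: w.
have sw : small_io W1 W2 0 a w by near: w.
apply/(small_liminfP bm la cw a0); apply: (stays_io_liminf bm la cw a0).
exact/(small_ioP bm _ _ cw).
Unshelve. all: by end_near.
Qed.

Lemma liminf_ge_ae (a : R) : 0 < a -> P (small_liminf W1 W2 0 a) = 1%E -> sz / 2 <= a ^+ 2.
Proof.
move=> a0 P1; rewrite leNgt; apply/negP => asz.
(* Strictly between a and the square root of sz / 2: a liminf of at most a forces recurrent
   confinement only at levels above a. *)
pose b := Num.sqrt ((a ^+ 2 + sz / 2) / 2).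
have s20 : 0 < sz / 2 by rewrite divr_gt0.
have b2 : b ^+ 2 = (a ^+ 2 + sz / 2) / 2.
  by rewrite sqr_sqrtr// divr_ge0// addr_ge0 ?sqr_ge0// ltW.
have b0 : 0 < b by rewrite sqrtr_gt0 divr_gt0// ltr_wpDl// sqr_ge0.
have ab : a < b by rewrite -(@ltr_pXn2r _ 2)// ?nnegrE ?(ltW a0) ?(ltW b0)// b2; lra.
have bs : b ^+ 2 < sz / 2 by rewrite b2; lra.
have mS := measurable_small_liminf bm 0 a.
have : P (small_liminf W1 W2 0 a) = P set0.
  have hc := ae_area_cvg bm la; have hb := not_small_io_ae bm la sz0 bpos b0 bs.
  apply: ae_prob_eq => //; near=> w; split => // sw.
  have cw : area_cvg W1 W2 A w by near: w.
  have nb : ~ small_io W1 W2 0 b w by near: w.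
  apply: nb; apply/(small_ioP bm _ _ cw); apply: (liminf_stays_io bm la cw b0).
  by apply: (@le_lt_trans _ _ a%:E); [exact/(small_liminfP bm la cw a0)|rewrite lte_fin].
by rewrite P1 measure0 => -[] /eqP; rewrite oner_eq0.
Unshelve. all: by end_near.
Qed.

Lemma liminf_constant : exists c : R,
  [/\ {ae P, forall w, X w = c%:E}, Num.sqrt (sz / 2) <= c &
      forall y, 0 < y < 1 -> c ^+ 2 <= ub_rate sz y].
Proof.
pose S := [set a : R | 0 < a /\ P (small_liminf W1 W2 0 a) = 1%E].
have SE (a y : R) : 0 < a -> 0 < y < 1 -> ub_rate sz y < a ^+ 2 -> S a.
  by move=> a0 y01 ya; split => //; exact: liminf_le_ae y01 ya.
have S0 : S !=set0.
  have y01 : 0 < (2^-1 : R) < 1 by lra.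
  have u0 := ub_rate_gt0 sz0 y01; exists (ub_rate sz 2^-1 + 1); apply: (SE _ _ _ y01); first lra.
  by have := sqr_ge0 (ub_rate sz 2^-1); rewrite sqrrD1; lra.
have lb a : S a -> Num.sqrt (sz / 2) <= a.
  move=> [a0 /(liminf_ge_ae a0) h].
  by rewrite -(ger0_norm (ltW a0)) -sqrtr_sqr ler_wsqrtr.
have hS : has_inf S by split => //; exists (Num.sqrt (sz / 2)) => a /lb.
pose c := inf S; have c1 : Num.sqrt (sz / 2) <= c by apply: lb_le_inf => // a /lb.
have c0 : 0 < c by apply: lt_le_trans c1; rewrite sqrtr_gt0 divr_gt0.
exists c; split => //; last first.
  move=> y y01; rewrite leNgt; apply/negP => uc; have u0 := ub_rate_gt0 sz0 y01.
  pose b := Num.sqrt ((ub_rate sz y + c ^+ 2) / 2).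
  have b2 : b ^+ 2 = (ub_rate sz y + c ^+ 2) / 2.
    by rewrite sqr_sqrtr// divr_ge0// addr_ge0 ?sqr_ge0// ltW.
  have b0 : 0 < b by rewrite sqrtr_gt0 divr_gt0// ltr_wpDr// sqr_ge0.
  have bc : b < c by rewrite -(@ltr_pXn2r _ 2)// ?nnegrE ?(ltW b0) ?(ltW c0)// b2; lra.
  have : c <= b.
    apply: ge_inf; first by case: hS.
    by apply: (SE _ _ b0 y01); rewrite b2; lra.
  lra.
have up m : {ae P, forall w, (X w <= (c + m.+1%:R^-1)%:E)%E}.
  have m0 : 0 < m.+1%:R^-1 :> R by rewrite invr_gt0.
  have [a [a0 Pa] ac] := inf_adherent m0 hS.
  have mS := measurable_small_liminf bm 0 a.
  have hX := aeX a0; have hP := prob1_ae mS Pa.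
  near=> w; apply: (@le_trans _ _ a%:E); last by rewrite lee_fin ltW.
  have [h _] : small_liminf W1 W2 0 a w <-> (X w <= a%:E)%E by near: w.
  by apply: h; near: w.
(* The levels approach c from below by factors, not differences, and start at c / 2: the zero-one
   law is available for positive levels. *)
have dn m : {ae P, forall w, ((c * (1 - m.+2%:R^-1))%:E < X w)%E}.
  set b := c * _; have m1 : m.+2%:R^-1 < 1 :> R by rewrite invf_lt1// ltr1n.
  have b0 : 0 < b by rewrite mulr_gt0// subr_gt0.
  have bc : b < c by rewrite gtr_pMr// gtrBl invr_gt0.
  have mS := measurable_small_liminf bm 0 b.
  have Pb : P (small_liminf W1 W2 0 b) = 0%E.
    have [//|P1] := small_liminf_zero_one bm la b0.
    have : c <= b by apply: ge_inf; [case: hS|split].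
    by rewrite leNgt bc.
  have hX := aeX b0; have hP := prob0_ae mS Pb.
  near=> w; rewrite ltNge; apply/negP => hw.
  have [_ h] : small_liminf W1 W2 0 b w <-> (X w <= b%:E)%E by near: w.
  have : ~ small_liminf W1 W2 0 b w by near: w.
  by apply; apply: h.
have hu := ae_foralln up; have hd := ae_foralln dn.
near=> w.
have hu' : forall m, (X w <= (c + m.+1%:R^-1)%:E)%E by near: w.
have hd' : forall m, ((c * (1 - m.+2%:R^-1))%:E < X w)%E by near: w.
have small (e : R) : 0 < e -> exists m : nat, m.+1%:R^-1 <= e.
  move=> e0; exists (Num.truncn e^-1).
  by rewrite invf_ple ?posrE// ltW// Num.Theory.truncnS_gt.
apply/eqP; rewrite eq_le; apply/andP; split.
  apply/lee_addgt0Pr => e e0; have [m hm] := small e e0.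
  by apply: (le_trans (hu' m)); rewrite -EFinD lee_fin lerD2l.
apply/lee_addgt0Pr => e e0; have [m hm] := small _ (divr_gt0 e0 c0).
apply: (@le_trans _ _ ((c * (1 - m.+2%:R^-1))%:E + e%:E)%E).
  rewrite -EFinD lee_fin mulrBr mulr1 -addrA lerDl addrC subr_ge0.
  rewrite mulrC -ler_pdivlMr//; apply: le_trans hm.
  by rewrite lef_pV2 ?posrE// ler_nat.
by rewrite leeD2r// ltW// hd'.
Unshelve. all: by end_near.
Qed.
End value_of_liminf.

Theorem theorem5p5 (d : measure_display) (T : measurableType d) (R : realType)
    (P : probability T R) (W1 W2 A : R -> T -> R) :
  is_BM2 P W1 W2 -> is_levy_area P W1 W2 A ->
  exists c : R,
    {ae P, forall w, chung_liminf W1 W2 A w = c%:E} /\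
    Num.sqrt (lambda1 2 : R) <= c /\
    c <= Num.sqrt (c_const (lambda1 1) (lambda1 2)).
Proof.
move=> bm la; have [sz [sz0 bz bpos]] := @first_zero R.
have [c [hc c1 c2]] := liminf_constant bm la sz0 bz bpos.
exists c; split => //; rewrite (lambda1_2 sz0 bz bpos) lambda1_1; split => //.
have c0 : 0 <= c by rewrite (le_trans _ c1).
rewrite -(ger0_norm c0) -sqrtr_sqr ler_wsqrtr//; apply: lb_le_inf.
  by exists (ub_rate sz 2^-1), 2^-1 => //=; rewrite in_itv /=; lra.
by move=> _ [y + <-]; rewrite /= in_itv /= => /c2.
Qed.
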